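(* Let $H$ be the Hilbert space with inner product $\langle\cdot,\cdot\rangle_H$, let $A:D(A)\to H$, $B:\mathbb R^3\to H$ and $G:H\to\mathbb R^3$ be the operators defined in the context (for arbitrary positive constants $k,\alpha_1,\alpha_2,\alpha_3$), and let $F=A+BG$ with domain $D(F)=D(A)$, i.e. $F\xi=A\xi+B(G\xi)$ for $\xi\in D(A)$. Then the (nonlinear, unbounded) operator $F:D(F)\to H$ is dissipative, in the sense that $$\langle F\xi,\xi\rangle_H\le 0\quad\text{for all }\xi\in D(F),$$ and $D(F)$ is dense in $H$, i.e. $\overline{D(F)}=H$.
   Context: **Parameters.** Index $n\in\{1,2\}$ labels two plates. Given are positive constants $I_1,I_2,I_3$ (principal moments of inertia of the rigid body), $\rho_n$ (area densities), $a_n$ (stiffness parameters, entering through $a_n^2$), $l_{1n},l_{2n}$ (side lengths), real constants $d_{1n},d_{2n},d_{3n}$, and positive constants $k,\alpha_1,\alpha_2,\alpha_3$. Put $\Omega_n=[0,l_{1n}]\times[0,l_{2n}]$, with points $x=(x_1,x_2)$, and $\Delta=\partial^2/\partial x_1^2+\partial^2/\partial x_2^2$. All function spaces are real. **Inertia matrices.** $I=\mathrm{diag}(I_1,I_2,I_3)$, and $J=(J_{ij})$ is the symmetric $3\times3$ matrix with $$J_{11}=\sum_{n=1}^2\rho_n\int_{\Omega_n}\big((x_2+d_{2n})^2+d_{3n}^2\big)dx,\qquad J_{22}=\sum_{n=1}^2\rho_n\int_{\Omega_n}\big((x_1+d_{1n})^2+d_{3n}^2\big)dx,$$ $$J_{33}=\sum_{n=1}^2\rho_n\int_{\Omega_n}\big((x_1+d_{1n})^2+(x_2+d_{2n})^2\big)dx,\qquad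 J_{12}=J_{21}=-\sum_{n=1}^2\rho_n\int_{\Omega_n}(x_1+d_{1n})(x_2+d_{2n})dx,$$ $$J_{23}=J_{32}=-\sum_{n=1}^2\rho_nd_{3n}\int_{\Omega_n}(x_2+d_{2n})dx,\qquad J_{13}=J_{31}=-\sum_{n=1}^2\rho_nd_{3n}\int_{\Omega_n}(x_1+d_{1n})dx.$$ Write $M_i=I_i+\sum_{n=1}^2\rho_nd_{3n}^2l_{1n}l_{2n}$ for $i=1,2$, and $$D=M_1M_2(I_3+J_{33})-J_{13}^2M_2-J_{23}^2M_1.$$ Standing assumption: $D\neq0$. The symmetric matrix $\hat J=(\hat J_{ij})$ is $$\hat J_{11}=\tfrac{M_2(I_3+J_{33})-J_{23}^2}{D},\quad \hat J_{12}=\hat J_{21}=\tfrac{J_{13}J_{23}}{D},\quad \hat J_{13}=\hat J_{31}=-\tfrac{M_2J_{13}}{D},$$ $$\hat J_{22}=\tfrac{M_1(I_3+J_{33})-J_{13}^2}{D},\quad \hat J_{23}=\hat J_{32}=-\tfrac{M_1J_{23}}{D},\quad \hat J_{33}=\tfrac{M_1M_2}{D}.$$ **State space.** For $m=2,4$, $\mathring H^m(\Omega_n)$ denotes the space of functions $u$ in the Sobolev space $H^m(\Omega_n)$ having zero trace on $\partial\Omega_n$ (only $u|_{\partial\Omega_n}=0$ is required). $H$ is the space of $\xi=(u_1,v_1,u_2,v_2,\omega,\tilde g)$ with $u_n\in\mathring H^2(\Omega_n)$, $v_n\in L^2(\Omega_n)$ ($n=1,2$), $\omega=(\omega_1,\omega_2,\omega_3)\in\mathbb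 R^3$, $\tilde g=(\tilde g_{ij})_{i,j=1}^3\in\mathbb R^9$. For $\xi^s=(u_1^s,v_1^s,u_2^s,v_2^s,\omega^s,\tilde g^s)$, $s=1,2$, where $(\cdot,\cdot)$ is the Euclidean inner product of $\mathbb R^3$, $$\langle\xi^1,\xi^2\rangle_H=\sum_{n=1}^2\rho_n\int_{\Omega_n}\Big\{a_n^2\Delta u_n^1\Delta u_n^2+v_n^1v_n^2+(\omega_1^2v_n^1+\omega_1^1v_n^2)(d_{2n}+x_2)-(\omega_2^2v_n^1+\omega_2^1v_n^2)(d_{1n}+x_1)\Big\}dx+\big((I+J)\omega^1,\omega^2\big)+\sum_{i,j=1}^3\alpha_i\tilde g^1_{ij}\tilde g^2_{ij}$$ (here the superscripts $1,2$ on $u_n,v_n,\omega_i,\omega,\tilde g$ denote the vectors $\xi^1,\xi^2$, not powers). The norm $\|\xi\|_H=\sqrt{\langle\xi,\xi\rangle_H}$ is equivalent to the standard norm of the product space, so $H$ is a Hilbert space. **Operator $A$.** Its domain is $$D(A)=\Big\{\xi\in H:\ u_n\in\mathring H^4(\Omega_n),\ v_n\in\mathring H^2(\Omega_n),\ \tfrac{\partial^2u_n}{\partial x_1^2}\Big|_{\partial\Omega_n}=\tfrac{\partial^2u_n}{\partial x_2^2}\Big|_{\partial\Omega_n}=0,\ n=1,2\Big\}.$$ For $\xi\in D(A)$, $A\xi=(u_1^\xi,v_1^\xi,u_2^\xi,v_2^\xi,\omega^\xi,\tilde g^\xi)$, where, for $i=1,2,3$, $$\begin{aligned}\omega_i^\xi=&(\hat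 J_{i1}\omega_3-\hat J_{i3}\omega_1)\big[J_{21}\omega_1+(J_{22}+I_2)\omega_2+J_{23}\omega_3\big]+(\hat J_{i2}\omega_1-\hat J_{i1}\omega_2)\big[J_{31}\omega_1+J_{32}\omega_2+(J_{33}+I_3)\omega_3\big]\\&+(\hat J_{i3}\omega_2-\hat J_{i2}\omega_3)\big[(J_{11}+I_1)\omega_1+J_{12}\omega_2+J_{13}\omega_3\big]\\&+\sum_{n=1}^2\rho_n\int_{\Omega_n}\Big(\hat J_{i3}[(x_1+d_{1n})\omega_1+(x_2+d_{2n})\omega_2]-[\hat J_{i1}(x_1+d_{1n})+\hat J_{i2}(x_2+d_{2n})]\omega_3\Big)v_n(x)\,dx\\&+\sum_{n=1}^2\rho_na_n^2\int_{\Omega_n}\big(\hat J_{i1}(x_2+d_{2n})-\hat J_{i2}(x_1+d_{1n})\big)\Delta^2u_n(x)\,dx,\end{aligned}$$ $$u_n^\xi=v_n,\qquad v_n^\xi(x)=-a_n^2\Delta^2u_n(x)+(x_1+d_{1n})\omega_2^\xi-(x_2+d_{2n})\omega_1^\xi,\qquad n=1,2,$$ $$\tilde g^\xi_{11}=\omega_3\tilde g_{12}-\omega_2\tilde g_{13},\quad \tilde g^\xi_{12}=\omega_1\tilde g_{13}-\omega_3(\tilde g_{11}+1),\quad \tilde g^\xi_{13}=\omega_2(\tilde g_{11}+1)-\omega_1\tilde g_{12},$$ $$\tilde g^\xi_{21}=\omega_3(\tilde g_{22}+1)-\omega_2\tilde g_{23},\quad \tilde g^\xi_{22}=\omega_1\tilde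 g_{23}-\omega_3\tilde g_{21},\quad \tilde g^\xi_{23}=\omega_2\tilde g_{21}-\omega_1(\tilde g_{22}+1),$$ $$\tilde g^\xi_{31}=\omega_3\tilde g_{32}-\omega_2(\tilde g_{33}+1),\quad \tilde g^\xi_{32}=\omega_1(\tilde g_{33}+1)-\omega_3\tilde g_{31},\quad \tilde g^\xi_{33}=\omega_2\tilde g_{31}-\omega_1\tilde g_{32}.$$ **Operator $B$.** For $f=(f_1,f_2,f_3)\in\mathbb R^3$, $Bf=(u_1^f,v_1^f,u_2^f,v_2^f,\omega^f,\tilde g^f)$ with $$u_n^f=0,\quad v_n^f(x)=\sum_{m=1}^3\big(\hat J_{2m}(x_1+d_{1n})-\hat J_{1m}(x_2+d_{2n})\big)f_m,\quad \omega_i^f=\sum_{m=1}^3\hat J_{im}f_m,\quad \tilde g^f=0.$$ **Feedback operator $G$.** For $\xi\in H$, $G\xi=(f_1^\xi,f_2^\xi,f_3^\xi)$ with $$\begin{aligned}f_1^\xi=&-\omega_3\big(J_{21}\omega_1+(J_{22}+I_2)\omega_2+J_{23}\omega_3\big)-k\omega_1+\alpha_2\tilde g_{23}-\alpha_3\tilde g_{32}\\&+\omega_2\big(J_{31}\omega_1+J_{32}\omega_2+(J_{33}+I_3)\omega_3\big)+\omega_3\sum_{n=1}^2\rho_n\int_{\Omega_n}(x_1+d_{1n})v_n(x)\,dx,\\ f_2^\xi=&-\omega_1\big(J_{31}\omega_1+J_{32}\omega_2+(J_{33}+I_3)\omega_3\big)-k\omega_2-\alpha_1\tilde g_{13}+\alpha_3\tilde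 g_{31}\\&+\omega_3\big((J_{11}+I_1)\omega_1+J_{12}\omega_2+J_{13}\omega_3\big)+\omega_3\sum_{n=1}^2\rho_n\int_{\Omega_n}(x_2+d_{2n})v_n(x)\,dx,\\ f_3^\xi=&-\omega_2\big((J_{11}+I_1)\omega_1+J_{12}\omega_2+J_{13}\omega_3\big)-k\omega_3+\alpha_1\tilde g_{12}-\alpha_2\tilde g_{21}\\&+\omega_1\big(J_{21}\omega_1+(J_{22}+I_2)\omega_2+J_{23}\omega_3\big)-\sum_{n=1}^2\rho_n\int_{\Omega_n}\big[(x_1+d_{1n})\omega_1+(x_2+d_{2n})\omega_2\big]v_n(x)\,dx.\end{aligned}$$ *)

(* Defs.v *)
From HB Require Import structures.
From mathcomp Require Export all_boot all_order all_algebra.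
From mathcomp Require Export all_classical all_reals all_analysis measurable_realfun.
From mathcomp Require Import ring lra.
Export Order.TTheory GRing.Theory Num.Theory.
Export numFieldNormedType.Exports.

Set Implicit Arguments.
Unset Strict Implicit.
Unset Printing Implicit Defensive.

#[global] Open Scope classical_set_scope.
#[global] Open Scope ring_scope.

Section Sobolev.
Context {R : realType}.
Implicit Types (l : R * R) (u g f phi : R * R -> R).

Definition area : {measure set (measurableTypeR R * measurableTypeR R) -> \bar R} :=
  (@lebesgue_measure R \x @lebesgue_measure R)%E.

Definition plate l : set (R * R) := `[0, l.1] `*` `[0, l.2].

Definition open_plate l : set (R * R) := `]0, l.1[ `*` `]0, l.2[.

(* Elements of L^2 and of the Sobolev spaces are represented by functions on
   the plane; values outside the plate and on null sets are irrelevant, and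
   every notion below depends only on the a.e. class on the plate. *)
Definition L2 l u : Prop := u \_ (plate l) \in Lfun area 2%:E.

Definition partial (i : bool) f : R * R -> R :=
  fun x => 'D_(if i then (0, 1) else (1, 0)) f x.

(* f is C^oo on the plane: all iterated partial derivatives, in any order,
   exist and are continuous *)
Definition smooth f : Prop := forall s : seq bool,
  continuous (foldr partial f s) /\
  forall (i : bool) (x : R * R),
    derivable (foldr partial f s) x (if i then (0, 1) else (1, 0)).

(* C^oo functions with support in the open plate; the support is then compact,
   being closed and bounded. *)
Definition test_function l phi : Prop :=
  smooth phi /\ closure [set x | phi x != 0] `<=` open_plate l.

(* g is the weak derivative d^(i+j) u / dx1^i dx2^j on the open plate *)
Definition is_weak_derivative l (i j : nat) u g : Prop :=
  forall phi, test_function l phi ->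
    \int[area]_(x in plate l)
      (u x * iter i (partial false) (iter j (partial true) phi) x) =
    (-1) ^+ (i + j) * \int[area]_(x in plate l) (g x * phi x).

(* The weak derivative as an operation: it is a.e. unique, and the value is the
   junk 0 when there is no weak derivative in L^2. *)
Definition wD l (i j : nat) u : R * R -> R :=
  xget (cst 0) [set g | L2 l g /\ is_weak_derivative l i j u g].

Definition sobolev l (m : nat) u : Prop :=
  L2 l u /\ forall i j : nat, (i + j <= m)%N ->
    exists2 g, L2 l g & is_weak_derivative l i j u g.

Definition H1_dist_sq l phi u : R :=
  \int[area]_(x in plate l)
    ((phi x - u x) ^+ 2 + (partial false phi x - wD l 1 0 u x) ^+ 2
     + (partial true phi x - wD l 0 1 u x) ^+ 2).

Definition boundary_norm_sq l phi : R :=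
  \int[lebesgue_measure]_(t in `[0, l.1]) (phi (t, 0) ^+ 2 + phi (t, l.2) ^+ 2)
  + \int[lebesgue_measure]_(t in `[0, l.2]) (phi (0, t) ^+ 2 + phi (l.1, t) ^+ 2).

(* The trace H^1 -> L^2(boundary) is the continuous extension of the
   restriction map on functions smooth up to the boundary, which are dense in
   H^1; u has zero trace when it is an H^1-limit of smooth functions whose
   restrictions to the boundary tend to 0 in L^2(boundary). *)
Definition zero_trace l u : Prop :=
  sobolev l 1 u /\ exists phi : nat -> R * R -> R,
    [/\ forall k, smooth (phi k),
        (fun k => H1_dist_sq l (phi k) u) @ \oo --> (0 : R) &
        (fun k => boundary_norm_sq l (phi k)) @ \oo --> (0 : R)].

Definition sobolev0 l (m : nat) u : Prop := sobolev l m u /\ zero_trace l u.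

Definition laplacian l u : R * R -> R :=
  fun x => wD l 2 0 u x + wD l 0 2 u x.

End Sobolev.

Section SobolevFacts.
Context {R : realType}.
Implicit Types (l : R * R) (u g f phi : R * R -> R).

Lemma measurable_plate l : measurable (plate l).
Proof. by apply: measurableX; exact: measurable_itv. Qed.

Lemma area_plateE l : area (plate l) =
  (lebesgue_measure `[0%R, l.1] * lebesgue_measure `[0%R, l.2])%E.
Proof. by apply: product_measure1E; exact: measurable_itv. Qed.

Lemma area_plate l : 0 <= l.1 -> 0 <= l.2 -> area (plate l) = (l.1 * l.2)%:E.
Proof.
move=> l1 l2; rewrite area_plateE !lebesgue_measure_itv/= !lte_fin !sube0.
case: ltgtP l1 => // [l1 _|<- _]; last by rewrite mul0r mul0e.
by case: ltgtP l2 => // <- _; rewrite mulr0 mule0.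
Qed.

Lemma area_plate_lty l : (area (plate l) < +oo)%E.
Proof.
rewrite area_plateE !lebesgue_measure_itv/=.
by case: ifP => _; case: ifP => _; rewrite -?EFinB -?EFinM ?mule0 ?mul0e ltry.
Qed.

Lemma L2_bounded l f (M : R) : measurable_fun [set: R * R] f ->
  (forall x, plate l x -> `|f x| <= M) -> L2 l f.
Proof.
move=> mf fM.
have mP := @measurable_plate l.
have mfP : measurable_fun setT (f \_ (plate l)).
  by apply/(measurable_restrictT f mP); exact: measurable_funTS.
rewrite /L2 inE; apply/andP; split; rewrite inE//=.
rewrite /finite_norm unlock poweR_lty//.
have le0 (x : R * R) : (0 <= (`|M| `^ 2)%:E)%E by rewrite lee_fin powR_ge0.
apply: (@le_lt_trans _ _ (\int[area]_(x in plate l) cst (`|M| `^ 2)%:E x)%E).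
  rewrite [leRHS]integral_mkcond; apply: ge0_le_integral => //=.
  - apply/measurable_EFinP.
    apply: (@measurableT_comp _ _ _ _ _ _ (fun y : R => y `^ 2)).
      exact: measurable_powR.
    exact: measurableT_comp.
  - by apply/(measurable_restrictT _ mP).
  move=> x _; rewrite /patch; case: ifPn => [|_]; last first.
    by rewrite normr0 powR0// pnatr_eq0.
  rewrite inE => Px; rewrite lee_fin ge0_ler_powR ?nnegrE//.
  exact: le_trans (fM x Px) (ler_norm _).
by rewrite integral_cst// lte_mul_pinfty// ?fin_num_fun ?area_plate_lty.
Qed.

Lemma L2_cst l (c : R) : L2 l (cst c).
Proof. by apply: (@L2_bounded _ _ `|c|). Qed.

Lemma L2_fst l : L2 l fst.
Proof.
apply: (@L2_bounded _ _ `|l.1|); first exact: measurable_fst.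
move=> [a b] [/=]; rewrite !in_itv/= => /andP[a0 al] _.
by rewrite ger0_norm// (le_trans al)// ler_norm.
Qed.

Lemma L2_snd l : L2 l snd.
Proof.
apply: (@L2_bounded _ _ `|l.2|); first exact: measurable_snd.
move=> [a b] [/=] _; rewrite !in_itv/= => /andP[b0 bl].
by rewrite ger0_norm// (le_trans bl)// ler_norm.
Qed.

Lemma L2_add l f g : L2 l f -> L2 l g -> L2 l (fun x => f x + g x).
Proof.
move=> Lf Lg; rewrite /L2.
have -> : (fun x => f x + g x) \_ (plate l) = f \_ (plate l) + g \_ (plate l).
  by apply/funext => x; rewrite /patch [RHS]/GRing.add/=; case: ifP => // _; rewrite addr0.
have p1 : (1 <= 2%:E :> \bar R)%E by rewrite lee_fin ler1n.
exact: (Lfun_addr_closed _ p1).2.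
Qed.

Lemma L2_scale l (c : R) f : L2 l f -> L2 l (fun x => c * f x).
Proof.
move=> Lf; rewrite /L2.
have -> : (fun x => c * f x) \_ (plate l) = c \o* (f \_ (plate l)).
  by apply/funext => x; rewrite /patch /=; case: ifP => // _; rewrite ?mul0r// mulrC.
by apply: Lfun_scale => //; rewrite ler1n.
Qed.

Lemma L2_wD l (i j : nat) u : L2 l (wD l i j u).
Proof. by rewrite /wD; case: xgetP => [y _ []//|_]; exact: L2_cst. Qed.

Lemma L2_laplacian l u : L2 l (laplacian l u).
Proof. by apply: L2_add; exact: L2_wD. Qed.

End SobolevFacts.

Definition mx3 {R : realType} (s : seq (seq R)) : 'M[R]_3 :=
  \matrix_(i < 3, j < 3) (nth [::] s i)`_j.

(* The plates n = 1, 2 are indexed by 'I_2, coordinates by 'I_3; the index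
   written (1-based) i in formulas is c_i. *)
Definition c1 : 'I_3 := @Ordinal 3 0 isT.
Definition c2 : 'I_3 := @Ordinal 3 1 isT.
Definition c3 : 'I_3 := @Ordinal 3 2 isT.

Record params (R : realType) := Params {
  inertia : 'I_3 -> R;     (* I_i *)
  rho : 'I_2 -> R;
  stiff : 'I_2 -> R;       (* a_n *)
  len : 'I_2 -> R * R;     (* (l_1n, l_2n) *)
  d1 : 'I_2 -> R;
  d2 : 'I_2 -> R;
  d3 : 'I_2 -> R;
  gain : R;                (* k *)
  alpha : 'I_3 -> R
}.

(* xi = (u_1, v_1, u_2, v_2, omega, g~) *)
Record state (R : realType) := State {
  su : 'I_2 -> R * R -> R;
  sv : 'I_2 -> R * R -> R;
  som : 'cV[R]_3;
  sg : 'M[R]_3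
}.

Section Model.
Context {R : realType} (p : params R).
Implicit Types (n : 'I_2) (i j : 'I_3) (x : R * R) (xi eta : state R).

Definition Om n : set (R * R) := plate (len p n).

(* x_1 + d_1n and x_2 + d_2n *)
Definition y1 n x : R := x.1 + d1 p n.
Definition y2 n x : R := x.2 + d2 p n.

(* sum over the plates of rho_n times the integral over Omega_n *)
Definition intp (f : 'I_2 -> R * R -> R) : R :=
  \sum_(n < 2) rho p n * \int[area]_(x in Om n) f n x.

Definition J11 : R := intp (fun n x => y2 n x ^+ 2 + d3 p n ^+ 2).
Definition J22 : R := intp (fun n x => y1 n x ^+ 2 + d3 p n ^+ 2).
Definition J33 : R := intp (fun n x => y1 n x ^+ 2 + y2 n x ^+ 2).
Definition J12 : R := - intp (fun n x => y1 n x * y2 n x).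
Definition J23 : R :=
  - \sum_(n < 2) rho p n * d3 p n * \int[area]_(x in Om n) y2 n x.
Definition J13 : R :=
  - \sum_(n < 2) rho p n * d3 p n * \int[area]_(x in Om n) y1 n x.

Definition Jmx : 'M[R]_3 :=
  mx3 [:: [:: J11; J12; J13]; [:: J12; J22; J23]; [:: J13; J23; J33]].

Definition Imx : 'M[R]_3 := diag_mx (\row_i inertia p i).

Definition Mm i : R :=
  inertia p i
  + \sum_(n < 2) rho p n * d3 p n ^+ 2 * (len p n).1 * (len p n).2.

Definition Ddet : R :=
  Mm c1 * Mm c2 * (inertia p c3 + J33) - J13 ^+ 2 * Mm c2 - J23 ^+ 2 * Mm c1.

Definition Jhat : 'M[R]_3 :=
  let h11 := (Mm c2 * (inertia p c3 + J33) - J23 ^+ 2) / Ddet in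
  let h12 := J13 * J23 / Ddet in
  let h13 := - (Mm c2 * J13 / Ddet) in
  let h22 := (Mm c1 * (inertia p c3 + J33) - J13 ^+ 2) / Ddet in
  let h23 := - (Mm c1 * J23 / Ddet) in
  let h33 := Mm c1 * Mm c2 / Ddet in
  mx3 [:: [:: h11; h12; h13]; [:: h12; h22; h23]; [:: h13; h23; h33]].

Definition state_add xi eta : state R :=
  State (fun n x => su xi n x + su eta n x) (fun n x => sv xi n x + sv eta n x)
        (som xi + som eta) (sg xi + sg eta).

Definition state_sub xi eta : state R :=
  State (fun n x => su xi n x - su eta n x) (fun n x => sv xi n x - sv eta n x)
        (som xi - som eta) (sg xi - sg eta).

Definition in_H xi : Prop := forall n,
  sobolev0 (len p n) 2 (su xi n) /\ L2 (len p n) (sv xi n).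

Definition innerH xi eta : R :=
  intp (fun n x =>
    stiff p n ^+ 2 * laplacian (len p n) (su xi n) x
                   * laplacian (len p n) (su eta n) x
    + sv xi n x * sv eta n x
    + (som eta c1 0 * sv xi n x + som xi c1 0 * sv eta n x) * y2 n x
    - (som eta c2 0 * sv xi n x + som xi c2 0 * sv eta n x) * y1 n x)
  + \sum_i ((Imx + Jmx) *m som xi) i 0 * som eta i 0
  + \sum_i \sum_j alpha p i * sg xi i j * sg eta i j.

Definition normH xi : R := Num.sqrt (innerH xi xi).

Definition dom_A xi : Prop := in_H xi /\ forall n,
  [/\ sobolev0 (len p n) 4 (su xi n),
      sobolev0 (len p n) 2 (sv xi n),
      zero_trace (len p n) (wD (len p n) 2 0 (su xi n)) &
      zero_trace (len p n) (wD (len p n) 0 2 (su xi n))].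

Definition bilaplacian n (u : R * R -> R) : R * R -> R :=
  laplacian (len p n) (laplacian (len p n) u).

(* i-th component of (I + J) omega *)
Definition moment xi i : R := ((Imx + Jmx) *m som xi) i 0.

Definition A_om xi : 'cV[R]_3 := \col_i
  let w j := som xi j 0 in
  (Jhat i c1 * w c3 - Jhat i c3 * w c1) * moment xi c2
  + (Jhat i c2 * w c1 - Jhat i c1 * w c2) * moment xi c3
  + (Jhat i c3 * w c2 - Jhat i c2 * w c3) * moment xi c1
  + intp (fun n x =>
      (Jhat i c3 * (y1 n x * w c1 + y2 n x * w c2)
       - (Jhat i c1 * y1 n x + Jhat i c2 * y2 n x) * w c3) * sv xi n x)
  + \sum_(n < 2) rho p n * stiff p n ^+ 2 *
      \int[area]_(x in Om n)
        ((Jhat i c1 * y2 n x - Jhat i c2 * y1 n x) * bilaplacian n (su xi n) x).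

Definition A_g xi : 'M[R]_3 :=
  let w j := som xi j 0 in
  let g i j := sg xi i j in
  mx3 [:: [:: w c3 * g c1 c2 - w c2 * g c1 c3;
              w c1 * g c1 c3 - w c3 * (g c1 c1 + 1);
              w c2 * (g c1 c1 + 1) - w c1 * g c1 c2];
          [:: w c3 * (g c2 c2 + 1) - w c2 * g c2 c3;
              w c1 * g c2 c3 - w c3 * g c2 c1;
              w c2 * g c2 c1 - w c1 * (g c2 c2 + 1)];
          [:: w c3 * g c3 c2 - w c2 * (g c3 c3 + 1);
              w c1 * (g c3 c3 + 1) - w c3 * g c3 c1;
              w c2 * g c3 c1 - w c1 * g c3 c2]].

(* A as a total function; it is the operator A on dom_A, and junk elsewhere,
   where the weak fourth derivatives need not exist *)
Definition opA xi : state R :=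
  State (sv xi)
        (fun n x => - stiff p n ^+ 2 * bilaplacian n (su xi n) x
                    + y1 n x * A_om xi c2 0 - y2 n x * A_om xi c1 0)
        (A_om xi)
        (A_g xi).

Definition opB (f : 'cV[R]_3) : state R :=
  State (fun _ _ => 0)
        (fun n x => \sum_m (Jhat c2 m * y1 n x - Jhat c1 m * y2 n x) * f m 0)
        (\col_i \sum_m Jhat i m * f m 0)
        0.

Definition opG xi : 'cV[R]_3 :=
  let w j := som xi j 0 in
  let g i j := sg xi i j in
  let f1 :=
    - w c3 * moment xi c2 - gain p * w c1
    + alpha p c2 * g c2 c3 - alpha p c3 * g c3 c2
    + w c2 * moment xi c3
    + w c3 * intp (fun n x => y1 n x * sv xi n x) in
  let f2 :=
    - w c1 * moment xi c3 - gain p * w c2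
    - alpha p c1 * g c1 c3 + alpha p c3 * g c3 c1
    + w c3 * moment xi c1
    + w c3 * intp (fun n x => y2 n x * sv xi n x) in
  let f3 :=
    - w c2 * moment xi c1 - gain p * w c3
    + alpha p c1 * g c1 c2 - alpha p c2 * g c2 c1
    + w c1 * moment xi c2
    - intp (fun n x => (y1 n x * w c1 + y2 n x * w c2) * sv xi n x) in
  \col_i [:: f1; f2; f3]`_i.

Definition opF xi : state R := state_add (opA xi) (opB (opG xi)).

Definition dom_F : state R -> Prop := dom_A.

Definition dissipative (D : state R -> Prop) (T : state R -> state R) : Prop :=
  forall xi, D xi -> innerH (T xi) xi <= 0.

Definition dense_in_H (D : state R -> Prop) : Prop :=
  (forall xi, D xi -> in_H xi) /\
  forall xi, in_H xi -> forall eps : R, 0 < eps ->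
    exists eta, D eta /\ normH (state_sub xi eta) < eps.

End Model.

Lemma opF_in_H {R : realType} (p : params R) (xi : state R) :
  dom_F p xi -> in_H p (opF p xi).
Proof.
move=> [_ Dxi] n; have [_ Dv _ _] := Dxi n; split.
  rewrite (_ : su _ _ = sv xi n)//.
  by apply/funext => x /=; rewrite addr0.
have L2y1 : L2 (len p n) (y1 p n) by apply: L2_add (L2_fst _) (L2_cst _ _).
have L2y2 : L2 (len p n) (y2 p n) by apply: L2_add (L2_snd _) (L2_cst _ _).
rewrite /=; set c := A_om p xi.
rewrite (_ : (fun x => _) = (fun x =>
    (- stiff p n ^+ 2 * bilaplacian p n (su xi n) x
     + (c c2 0 + \sum_m Jhat p c2 m * opG p xi m 0) * y1 p n x)
     + (- (c c1 0 + \sum_m Jhat p c1 m * opG p xi m 0)) * y2 p n x)); last first.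
  apply/funext => x.
  rewrite [X in _ + X = _](_ : _ =
      (\sum_m Jhat p c2 m * opG p xi m 0) * y1 p n x
      - (\sum_m Jhat p c1 m * opG p xi m 0) * y2 p n x); first by ring.
  by rewrite !mulr_suml -sumrB; apply: eq_bigr => m _; ring.
apply: L2_add; last exact: L2_scale.
by apply: L2_add; apply: L2_scale => //; exact: L2_laplacian.
Qed.

(* Main.v *)
(* Dissipativity: Jhat is the inverse of the inertia matrix seen by omega once the
   accelerations of the plates have been eliminated, so in <F xi, xi> all terms
   cancel except - k |omega|^2, provided that Green's formula
   int (Lap u) (Lap v) = int (Lap^2 u) v holds.  With the definition of zero traces
   by approximation, Green's formula follows from testing weak derivatives
   against phi_k chi_k, where phi_k are the smooth approximants and chi_k are cutoff
   functions of the open plate; the terms containing the derivatives of chi_k tend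
   to 0 by Hardy's inequality.

   Density: finite sums of sin (m pi x1 / l1) sin (n pi x2 / l2) lie in the domain
   and the Laplacian is bijective on them, so it suffices that they are dense in
   L^2.  They are closed under multiplication by polynomials in the cosines, and
   iterating s |-> s (3 - s^2) / 2, which converges to the sign of s on [-1, 1],
   one gets bounded sums converging pointwise to indicators of quadrants; a
   Dynkin-class argument concludes.  Density also gives the uniqueness of weak
   derivatives. *)
Require Import Defs.
From mathcomp Require Import ring lra.

Set Implicit Arguments.
Unset Strict Implicit.
Unset Printing Implicit Defensive.

(** * Square-integrable functions on a plate *)

Section Integration.
Context {R : realType}.
Implicit Types (l : R * R) (u v f g h : R * R -> R).

(** [wD] picks some representative, so it need not be additive, nor agree pointwise with classical
    derivatives. Equality in L^2 is therefore stated as [ip l] of the difference with itself being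
    0, and is used through Cauchy-Schwarz after pairing with an L^2 function.

    The smooth approximants of a function with zero trace have small boundary values, not zero ones,
    so the usual Hardy inequality does not apply to them. Its weight is regularised by a width d, at
    the price of a boundary term with factor 4 / d. With d = 1 / (k + 1), the k-th approximant is
    chosen with squared boundary norm and squared errors at most d^2, which pays for that factor.
    The same d is the scale of the cutoff, whose derivative is at most 5 times the weight.

    Sines vanish at the ends, so constants are not in their span, and products of two sines leave
    it. Approximate indicators are thus a sine sum tending to 1 times a polynomial in cosines.

    The norm of H sees u only through its Laplacian, so approximating the Laplacian in L^2 and
    inverting it on sine sums gives density without elliptic estimates. *)

Lemma open_measurable2 (A : set (R * R)) : open A -> measurable A.
Proof.
move=> oA.
pose B (q : rat * rat * (rat * rat)) : set (R * R) :=
  `]ratr q.1.1, ratr q.1.2[ `*` `]ratr q.2.1, ratr q.2.2[.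
(* Boxes that are not contained in [A] are replaced by the empty set, so the union runs over all
   rational quadruples and is countable. *)
have -> : A = \bigcup_q (if `[< B q `<=` A >] then B q else set0).
  apply/seteqP; split=> [[a b] Aab|x [q _]]; last by case: asboolP => // + Bx; apply.
  have [e /= e0 bA] : exists2 e : R, 0 < e & ball (a, b) e `<=` A.
    by have /nbhs_ballP[e e0 ?] := open_nbhs_nbhs (conj oA Aab); exists e.
  have [p1 P1] : exists q : rat, ratr q \in `]a - e, a[ by apply: rat_in_itvoo; lra.
  have [p2 P2] : exists q : rat, ratr q \in `]a, a + e[ by apply: rat_in_itvoo; lra.
  have [p3 P3] : exists q : rat, ratr q \in `]b - e, b[ by apply: rat_in_itvoo; lra.
  have [p4 P4] : exists q : rat, ratr q \in `]b, b + e[ by apply: rat_in_itvoo; lra.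
  move: P1 P2 P3 P4; rewrite !in_itv/=.
  move=> /andP[A1 A2] /andP[B1 B2] /andP[C1 C2] /andP[D1 D2].
  exists (p1, p2, (p3, p4)) => //; case: asboolP => [_|].
    by rewrite /B/=; split=> /=; rewrite in_itv/=; lra.
  case=> -[x y] [/=]; rewrite !in_itv/= => X Y; apply: bA; split; rewrite /ball/=.
    by rewrite ltr_distlC; lra.
  by rewrite ltr_distlC; lra.
apply: countable_bigcupT_measurable => // q; case: ifPn => // _.
by apply: measurableX; exact: measurable_itv.
Qed.

Lemma continuous_measurable_fun2 f : continuous f -> measurable_fun setT f.
Proof.
move=> /continuousP cf.
apply: (measurability _ (RGenOpens.measurableE R)) => _ [_ [a [b ->] <-]].
by rewrite setTI; apply: open_measurable2; apply: cf; exact: interval_open.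
Qed.

Lemma L2_measurable l f : L2 l f -> measurable_fun (plate l) f.
Proof.
rewrite /L2 inE => /andP[+ _]; rewrite inE/= => mf.
by apply/(measurable_restrictT f (@measurable_plate _ l)).
Qed.

Lemma restrictM (D : set (R * R)) f g :
  (fun x => f x * g x) \_ D = (f \_ D) \* (g \_ D).
Proof. by apply/funext => x; rewrite /patch/=; case: ifP; rewrite ?mulr0. Qed.

Lemma L2_mul l f g : L2 l f -> L2 l g ->
  area.-integrable (plate l) (fun x => (f x * g x)%:E).
Proof.
move=> Lf Lg; have mP := @measurable_plate _ l.
have /Lfun1_integrable := Lfun2_mul_Lfun1 Lf Lg.
rewrite -restrictM => ifg.
rewrite -(setTI (plate l)); apply/integrable_restrict => //.
by rewrite restrict_EFin.
Qed.

Lemma L2_of_sqr l f : measurable_fun (plate l) f ->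
  area.-integrable (plate l) (fun x => (f x ^+ 2)%:E) -> L2 l f.
Proof.
move=> mf /integrableP[_ fin]; have mP := @measurable_plate _ l.
have mf' : measurable_fun setT (f \_ (plate l)) by apply/(measurable_restrictT f mP).
rewrite /L2 inE; apply/andP; split; rewrite inE//=.
rewrite /finite_norm unlock poweR_lty//.
apply: le_lt_trans fin; rewrite [leRHS]integral_mkcond; apply: ge0_le_integral => //=.
- apply/measurable_EFinP.
  apply: (@measurableT_comp _ _ _ _ _ _ (fun y : R => y `^ 2)).
    exact: measurable_powR.
  exact: measurableT_comp.
- apply/(measurable_restrictT _ mP).
  under eq_fun do rewrite /= ger0_norm ?sqr_ge0//.
  by apply/measurable_EFinP; exact: measurable_funX.
move=> x _; rewrite /patch; case: ifPn => [|_]; last first.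
  by rewrite normr0 powR0// pnatr_eq0.
by rewrite inE => Px; rewrite lee_fin powR_mulrn// normrX.
Qed.

Lemma L2_sqr l f : L2 l f -> area.-integrable (plate l) (fun x => (f x ^+ 2)%:E).
Proof. by move=> Lf; rewrite (_ : (fun x => _) = fun x => (f x * f x)%:E) ?L2_mul. Qed.

Lemma L2_le l f g : measurable_fun (plate l) f -> L2 l g ->
  (forall x, plate l x -> `|f x| <= `|g x|) -> L2 l f.
Proof.
move=> mf Lg fg; apply: L2_of_sqr => //.
apply: le_integrable (L2_sqr Lg) => //; first exact: measurable_plate.
  by apply/measurable_EFinP; exact: measurable_funX.
by move=> x Px; rewrite /= lee_fin !normrX lerXn2r ?nnegrE ?fg.
Qed.

Lemma L2_bmul l (M : R) f g : measurable_fun (plate l) f ->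
  (forall x, plate l x -> `|f x| <= M) -> L2 l g -> L2 l (fun x => f x * g x).
Proof.
move=> mf fM Lg; apply: (L2_le (g := fun x => M * g x)).
- by apply: measurable_funM => //; exact: L2_measurable.
- exact: L2_scale.
by move=> x Px; rewrite !normrM ler_wpM2r// (le_trans (fM x Px))// ler_norm.
Qed.

Lemma compact_plate l : compact (plate l).
Proof. by apply: compact_setX; exact: segment_compact. Qed.

Lemma continuous_plate_bounded l f : continuous f ->
  exists M, forall x, plate l x -> `|f x| <= M.
Proof.
move=> cf.
have cfP : compact (f @` plate l).
  by apply: continuous_compact; [exact: continuous_subspaceT|exact: compact_plate].
have [M [_ HM]] := compact_bounded cfP.
by exists (M + 1) => x Px; apply: (HM (M + 1)); [lra|exists x].
Qed.

Lemma L2_continuous l f : continuous f -> L2 l f.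
Proof.
move=> cf; have [M fM] := continuous_plate_bounded l cf.
by apply: L2_bounded fM; exact: continuous_measurable_fun2.
Qed.

Lemma continuous_integrable l f : continuous f ->
  area.-integrable (plate l) (EFin \o f).
Proof.
move=> cf; have := L2_mul (L2_continuous l cf) (@L2_cst _ l 1).
by under eq_fun do rewrite mulr1.
Qed.

Lemma L2_opp l f : L2 l f -> L2 l (fun x => - f x).
Proof.
by move=> /(L2_scale (-1)); rewrite (_ : (fun x => _) = fun x => - f x)//;
  apply/funext => x; rewrite mulN1r.
Qed.

Lemma L2_sub l f g : L2 l f -> L2 l g -> L2 l (fun x => f x - g x).
Proof. by move=> Lf /L2_opp; exact: L2_add. Qed.

End Integration.

(** * The L^2 pairing on a plate and dominated convergence *)

Section InnerProduct.
Context {R : realType}.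
Implicit Types (l : R * R) (u v f g h : R * R -> R).

Definition ip l f g : R := \int[area]_(x in plate l) (f x * g x).

Lemma ipC l f g : ip l f g = ip l g f.
Proof. by apply: eq_Rintegral => x _; rewrite mulrC. Qed.

Lemma eq_ip l f f' g g' : (forall x, plate l x -> f x * g x = f' x * g' x) ->
  ip l f g = ip l f' g'.
Proof. by move=> e; apply: eq_Rintegral => x; rewrite inE => /e. Qed.

Lemma ipDl l f g h : L2 l f -> L2 l g -> L2 l h ->
  ip l (fun x => f x + g x) h = ip l f h + ip l g h.
Proof.
move=> Lf Lg Lh; rewrite -RintegralD; [|exact: measurable_plate|exact: L2_mul|exact: L2_mul].
by apply: eq_Rintegral => x _; rewrite mulrDl.
Qed.

Lemma ipZl l (c : R) f h : L2 l f -> L2 l h ->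
  ip l (fun x => c * f x) h = c * ip l f h.
Proof.
move=> Lf Lh; rewrite -RintegralZl; [|exact: measurable_plate|exact: L2_mul].
by apply: eq_Rintegral => x _; rewrite mulrA.
Qed.

Lemma ipNl l f h : L2 l f -> L2 l h -> ip l (fun x => - f x) h = - ip l f h.
Proof.
move=> Lf Lh; rewrite -mulN1r -ipZl//; apply: eq_ip => x _.
by rewrite mulN1r.
Qed.

Lemma ipBl l f g h : L2 l f -> L2 l g -> L2 l h ->
  ip l (fun x => f x - g x) h = ip l f h - ip l g h.
Proof. by move=> Lf Lg Lh; rewrite ipDl// ?ipNl//; exact: L2_opp. Qed.

Lemma ipDr l f g h : L2 l f -> L2 l g -> L2 l h ->
  ip l h (fun x => f x + g x) = ip l h f + ip l h g.
Proof. by move=> Lf Lg Lh; rewrite ipC ipDl// !(ipC l h). Qed.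

Lemma ipZr l (c : R) f h : L2 l f -> L2 l h ->
  ip l h (fun x => c * f x) = c * ip l h f.
Proof. by move=> Lf Lh; rewrite ipC ipZl// ipC. Qed.

Lemma ipBr l f g h : L2 l f -> L2 l g -> L2 l h ->
  ip l h (fun x => f x - g x) = ip l h f - ip l h g.
Proof. by move=> Lf Lg Lh; rewrite ipC ipBl// !(ipC l h). Qed.

Lemma ip_ge0 l f : 0 <= ip l f f.
Proof. by apply: Rintegral_ge0 => x _; rewrite -expr2 sqr_ge0. Qed.

Lemma ip_sqrD l (t : R) f g : L2 l f -> L2 l g ->
  ip l (fun x => f x + t * g x) (fun x => f x + t * g x)
  = ip l f f + 2 * t * ip l f g + t ^+ 2 * ip l g g.
Proof.
move=> Lf Lg; have Ltg := L2_scale t Lg.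
rewrite ipDl//; last exact: L2_add.
by rewrite !ipDr// !ipZl// !ipZr// (ipC l g f); ring.
Qed.

Lemma ip_CauchySchwarz l f g : L2 l f -> L2 l g ->
  ip l f g ^+ 2 <= ip l f f * ip l g g.
Proof.
move=> Lf Lg; set a := ip l f f; set b := ip l f g; set c := ip l g g.
have q t : 0 <= a + 2 * t * b + t ^+ 2 * c by rewrite -ip_sqrD// ip_ge0.
have [c0|c0] := eqVneq c 0.
  have [->|b0] := eqVneq b 0; first by rewrite c0 expr2 !mulr0.
  (* In the degenerate case the quadratic is affine in t, and this t gives it the value -1. *)
  have := q (- (a + 1) / (2 * b)).
  by rewrite (_ : _ + _ = -1) ?ler0N1// c0; field.
have cp : 0 < c by rewrite lt_neqAle eq_sym c0 ip_ge0.
have := q (- b / c).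
rewrite (_ : _ + _ = (a * c - b ^+ 2) / c); last by field.
by rewrite pmulr_lge0 ?invr_gt0// subr_ge0.
Qed.

(** The parallelogram law with the square of f - g dropped. All estimates are kept between squares
    of norms, and the factor 2 is the cost. *)
Lemma ip_triangle l f g : L2 l f -> L2 l g ->
  ip l (fun x => f x + g x) (fun x => f x + g x) <= 2 * ip l f f + 2 * ip l g g.
Proof.
move=> Lf Lg.
have := ip_ge0 l (fun x => f x + (-1) * g x); rewrite ip_sqrD//.
have := ip_sqrD 1 Lf Lg.
rewrite (_ : (fun x => f x + 1 * g x) = fun x => f x + g x); last first.
  by apply/funext => x; rewrite mul1r.
by move=> ->; lra.
Qed.

(** The substitute for almost everywhere equality: a difference of zero seminorm is invisible in
    every pairing. *)
Lemma ip0_orth l f g : L2 l f -> L2 l g -> ip l f f = 0 -> ip l f g = 0.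
Proof.
move=> Lf Lg f0; have := ip_CauchySchwarz Lf Lg; rewrite f0 mul0r => h.
by apply/eqP; rewrite -sqrf_eq0 eq_le h sqr_ge0.
Qed.

Lemma ip_sqr_cvg0 l (f : nat -> R * R -> R) g : (forall k, L2 l (f k)) -> L2 l g ->
  ip l (f k) (f k) @[k --> \oo] --> 0 -> ip l (f k) g @[k --> \oo] --> 0.
Proof.
move=> Lf Lg f0.
have h : (fun k => ip l (f k) g ^+ 2) @ \oo --> 0.
  apply: (@squeeze_cvgr _ _ _ _ (cst 0) (fun k => ip l (f k) (f k) * ip l g g)).
  - by apply: nearW => k; rewrite sqr_ge0 ip_CauchySchwarz.
  - exact: cvg_cst.
  - by rewrite -(mul0r (ip l g g)); apply: cvgMr_tmp.
apply/cvgr0Pnorm_lt => e e0.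
have e2 : 0 < e ^+ 2 by rewrite exprn_gt0.
move/cvgr0Pnorm_lt : h => /(_ _ e2); apply: filterS => k.
by rewrite normrX ltr_pXn2r// ?nnegrE// ltW.
Qed.

(** The boundary lies on four lines, each null for the product measure. The cutoffs and the
    approximate indicators are shown to converge only inside the open plate, so dominated
    convergence rests on this. *)
Lemma area_boundary0 l : area (plate l `\` open_plate l) = 0%E.
Proof.
have m1 (a : R) : measurable [set a] by exact: measurable_set1.
pose V (a : R) : set (R * R) := [set a] `*` [set: R].
pose H (a : R) : set (R * R) := [set: R] `*` [set a].
have mV a : measurable (V a) by exact: measurableX.
have mH a : measurable (H a) by exact: measurableX.
have V0 a : area (V a) = 0%E.
  transitivity (lebesgue_measure [set a] * lebesgue_measure [set: R])%E.
    exact: product_measure1E.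
  by rewrite lebesgue_measure_set1 mul0e.
have H0 a : area (H a) = 0%E.
  transitivity (lebesgue_measure [set: R] * lebesgue_measure [set a])%E.
    exact: product_measure1E.
  by rewrite lebesgue_measure_set1 mule0.
have mVH a b : measurable (V a `|` H b) by exact: measurableU.
have VH0 a b : area (V a `|` H b) = 0%E.
  by apply: (@null_set_setU _ _ _ area (V a) (H b));
    [exact: mV|exact: mH|exact: V0|exact: H0].
have BB : area ((V 0 `|` H 0) `|` (V l.1 `|` H l.2)) = 0%E.
  by apply: (@null_set_setU _ _ _ area (V 0 `|` H 0) (V l.1 `|` H l.2));
    [exact: mVH|exact: mVH|exact: VH0|exact: VH0].
have mP := @measurable_plate _ l.
have mO : measurable (open_plate l) by apply: measurableX; exact: measurable_itv.
apply/eqP; rewrite -measure_le0 -BB; apply: le_measure; rewrite ?inE.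
- exact: (measurableD mP mO).
- exact: (measurableU _ _ (mVH _ _) (mVH _ _)).
move=> [x y] [[/=]]; rewrite !in_itv/= => /andP[x0 xl] /andP[y0 yl].
rewrite /open_plate/= !in_itv/=.
have [<-|xn] := eqVneq 0 x; first by move=> _; left; left.
have [->|xn'] := eqVneq x l.1; first by move=> _; right; left.
have [<-|yn] := eqVneq 0 y; first by move=> _; left; right.
have [->|yn'] := eqVneq y l.2; first by move=> _; right; right.
by case; rewrite !lt_neqAle xn xn' yn yn' x0 xl y0 yl.
Qed.

Lemma plate_dominated_cvg l (F : nat -> R * R -> R) f G :
  (forall k, measurable_fun (plate l) (F k)) -> measurable_fun (plate l) f ->
  area.-integrable (plate l) (EFin \o G) ->
  (forall k x, plate l x -> `|F k x| <= G x) ->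
  (forall x, open_plate l x -> F k x @[k --> \oo] --> f x) ->
  \int[area]_(x in plate l) F k x @[k --> \oo] --> \int[area]_(x in plate l) f x.
Proof.
move=> mF mf iG FG Ff; have mP := @measurable_plate _ l.
have [||||| iF _ h] := @dominated_convergence _ _ _ area _ mP
    (fun k => EFin \o F k) (EFin \o f) (EFin \o G).
- by move=> k; apply/measurable_EFinP; exact: mF.
- by apply/measurable_EFinP; exact: mf.
- exists (plate l `\` open_plate l); split.
  + apply: measurableD => //; apply: measurableX; exact: measurable_itv.
  + exact: area_boundary0.
  move=> x /= /not_implyP[Px] h; split=> // /Ff c; apply: h.
  by apply/fine_cvgP; split; [exact: nearW|exact: c].
- exact: iG.
- by apply: aeW => x k Px; rewrite lee_fin FG.
rewrite /Rintegral; apply: (fine_cvg (f := fun k => \int[area]_(x in plate l) (F k x)%:E)%E).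
rewrite fineK//; exact: integrable_fin_num iF.
Qed.

End InnerProduct.

(** * Smooth functions *)

Section Smooth1.
Context {R : realType}.
Implicit Types (f g : R -> R) (P : {poly R}).

Lemma is_derive1_continuous f (g : R -> R) :
  (forall x : R, is_derive x (1 : R) f (g x)) -> continuous f.
Proof.
by move=> fg x; apply/differentiable_continuous/derivable1_diffP; have [] := fg x.
Qed.

(* The classical C^oo functions vanishing to infinite order at 0: the
   derivative of P(1/x) exp(-1/x) has the same shape. *)
Definition flat P (x : R) : R := if 0 < x then P.[x^-1] * expR (- x^-1) else 0.

(** Induction on P in Horner form, with n free because the factor X raises n by one. The constant
    coefficient is handled by t^(n+1) <= (n+1)! e^t. The factor 1 / t on the right becomes the decay
    of [flat] at 0 once t = 1 / x. *)
Lemma poly_expRN_bound P (n : nat) : exists C : R, forall t, 0 < t ->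
  t ^+ n * `|P.[t]| * expR (- t) <= C / t.
Proof.
elim/poly_ind: P n => [|P c IH] n.
  by exists 0 => t t0; rewrite horner0 normr0 mulr0 !mul0r.
have [C HC] := IH n.+1; exists (C + `|c| * (n.+1)`!%:R) => t t0.
have e0 : 0 < expR (- t) by exact: expR_gt0.
rewrite hornerMXaddC mulrDl.
apply: (@le_trans _ _ (t ^+ n.+1 * `|P.[t]| * expR (- t) + t ^+ n * `|c| * expR (- t))).
  rewrite -mulrDl ler_wpM2r ?(ltW e0)//.
  rewrite (_ : t ^+ n.+1 * _ + _ = t ^+ n * (t * `|P.[t]| + `|c|)); last by rewrite exprS; ring.
  rewrite ler_wpM2l ?exprn_ge0 ?(ltW t0)//.
  by rewrite (le_trans (ler_normD _ _))// normrM (gtr0_norm t0) mulrC.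
apply: lerD; first exact: HC.
have := expR_ge1Dxn n (ltW t0).
set F := (n.+1)`!%:R; have F0 : 0 < F :> R by rewrite ltr0n fact_gt0.
move=> h; rewrite expRN.
have et : 0 < expR t by exact: expR_gt0.
rewrite ler_pdivlMr// mulrAC ler_pdivrMr//.
have : t ^+ n.+1 <= F * expR t.
  by rewrite mulrC -ler_pdivrMr//; lra.
move=> /(ler_wpM2l (normr_ge0 c)).
rewrite (_ : t ^+ n * `|c| * t = `|c| * t ^+ n.+1); last by rewrite exprS; ring.
by rewrite -mulrA.
Qed.

Lemma flat_le0 P x : x <= 0 -> flat P x = 0.
Proof. by rewrite /flat ltNge => ->. Qed.

Lemma flat_continuous0 P : flat P z @[z --> 0] --> 0.
Proof.
have [C HC] := poly_expRN_bound P 0.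
apply/cvgr0Pnorm_lt => e e0.
have d0 : 0 < e / (`|C| + 1) by rewrite divr_gt0// ltr_wpDl.
near=> z; rewrite /flat; case: ifPn => [z0|]; last by rewrite normr0.
rewrite normrM (gtr0_norm (expR_gt0 _)).
have zi : 0 < z^-1 by rewrite invr_gt0.
have := HC _ zi; rewrite expr0 mul1r invrK => /le_lt_trans; apply.
apply: (@le_lt_trans _ _ (`|C| * z)); first by rewrite ler_wpM2r ?ler_norm// (ltW z0).
have : z < e / (`|C| + 1).
  by near: z; exact: lt_nbhsl.
rewrite ltr_pdivlMr ?ltr_wpDl//.
by apply: le_lt_trans; rewrite mulrC ler_pM2l// lerDl.
Unshelve. all: by end_near. Qed.

(** With t = 1 / x one has dt/dx = - t^2, so the derivative of P(t) e^(-t) in x is t^2 (P - P')(t)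
    e^(-t). *)
Definition flat_deriv P : {poly R} := 'X^2 * P - 'X^2 * P^`().

Lemma is_derive_flat P x : is_derive (x : R) (1 : R) (flat P) (flat (flat_deriv P) x).
Proof.
have [x0|x0|<-] := ltgtP 0 x.
- apply: (@near_eq_is_derive _ _ _ (fun y => (horner P \o GRing.inv) y * expR (- y^-1))).
    near=> y; rewrite /flat ifT//; near: y; exact: lt_nbhsr.
  have xn : x != 0 by rewrite gt_eqF.
  have dV : is_derive (x : R) (1 : R) (GRing.inv : R -> R) (- x ^- 2 *: 1).
    exact: (@is_deriveV _ id).
  have dP := is_derive1_comp (is_derive_poly P x^-1) dV.
  have dN : is_derive (x : R) (1 : R) (fun y : R => - y^-1) (- (- x ^- 2 *: 1)).
    exact: is_deriveN.
  have dE := @is_derive1_comp _ expR (fun y : R => - y^-1) x _ _ (is_derive_expR (- x^-1)) dN.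
  have := is_deriveM dP dE.
  rewrite (_ : _ + _ = flat (flat_deriv P) x)//.
  rewrite /flat x0 /flat_deriv !hornerE/= /GRing.scale/=.
  by field.
- rewrite flat_le0 ?ltW//.
  apply: (@near_eq_is_derive _ _ _ (cst 0)).
  near=> y; rewrite flat_le0//; apply: ltW; near: y; exact: lt_nbhsl.
(* At 0 the difference quotient P(1/z) exp(-1/z) / z is again of the form [flat], hence tends to
   0. *)
apply/is_derive1_caratheodory; exists (flat ('X * P)); split.
- move=> z; rewrite subr0 [flat P 0]flat_le0// subr0 /flat; case: ifPn => z0.
    by rewrite !hornerE/=; field; rewrite gt_eqF.
  by rewrite mul0r.
- by rewrite /prop_for /continuous_at flat_le0//; exact: flat_continuous0.
by rewrite !flat_le0.
Unshelve. all: by end_near. Qed.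

(* A class of functions closed under differentiation, so that its members are C^oo. *)
Inductive smooth1 : (R -> R) -> Prop :=
| smooth1_cst c : smooth1 (fun=> c)
| smooth1_sin : smooth1 sin
| smooth1_cos : smooth1 cos
| smooth1_flat P : smooth1 (flat P)
| smooth1_affine f a b : smooth1 f -> smooth1 (fun x => f (a * x + b))
| smooth1_add f g : smooth1 f -> smooth1 g -> smooth1 (fun x => f x + g x)
| smooth1_mul f g : smooth1 f -> smooth1 g -> smooth1 (fun x => f x * g x).

Lemma smooth1_scale (c : R) f : smooth1 f -> smooth1 (fun x => c * f x).
Proof. by move=> sf; apply: smooth1_mul => //; exact: smooth1_cst. Qed.

Lemma smooth1_is_derive f : smooth1 f ->
  exists2 g, smooth1 g & forall x, is_derive (x : R) (1 : R) f (g x).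
Proof.
elim=> {f}[c|||P|f a b _ [f' sf' ff']|f g sf [f' sf' ff'] sg [g' sg' gg']
  |f g sf [f' sf' ff'] sg [g' sg' gg']].
- by exists (fun=> 0); [exact: smooth1_cst|move=> x; exact: is_derive_cst].
- by exists cos; [exact: smooth1_cos|move=> x; exact: is_derive_sin].
- exists (fun x => -1 * sin x); first by apply: smooth1_scale; exact: smooth1_sin.
  by move=> x; rewrite mulN1r; exact: is_derive_cos.
- by exists (flat (flat_deriv P)); [exact: smooth1_flat|move=> x; exact: is_derive_flat].
- exists (fun x => a * f' (a * x + b)).
    by apply: smooth1_scale; exact: smooth1_affine.
  move=> x.
  have dab : is_derive (x : R) (1 : R) (fun x : R => a * x + b) a.
    have h1 : is_derive (x : R) (1 : R) (a \*: (@id R)) (a *: 1) by exact: is_deriveZ.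
    have := is_deriveD h1 (is_derive_cst b x 1).
    by rewrite addr0 /GRing.scale/= mulr1.
  by have := @is_derive1_comp _ f (fun x => a * x + b) x _ _ (ff' (a * x + b)) dab; rewrite mulrC.
- exists (fun x => f' x + g' x); first exact: smooth1_add.
  by move=> x; exact: is_deriveD.
- exists (fun x => f x * g' x + g x * f' x).
    by apply: smooth1_add; apply: smooth1_mul.
  by move=> x; exact: is_deriveM.
Qed.

Lemma smooth1_continuous f : smooth1 f -> continuous f.
Proof. by move=> /smooth1_is_derive[g _]; exact: is_derive1_continuous. Qed.

End Smooth1.

(** * Smooth functions of two variables and symmetry of mixed partial derivatives *)

Section Smooth2.
Context {R : realType}.
Implicit Types (f g : R * R -> R) (x : R * R) (i : bool) (d : R).

Definition dir i : R * R := if i then (0, 1) else (1, 0).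

Lemma is_derive_fstP f x d :
  is_derive x ((1, 0) : R * R) f d <-> is_derive x.1 (1 : R) (fun t => f (t, x.2)) d.
Proof.
have e : (fun h : R => h^-1 *: (f (h *: (1, 0) + x) - f x)) =
         (fun h : R => h^-1 *: (f (h *: 1 + x.1, x.2) - f (x.1, x.2))).
  apply/funext => h; case: x => a b /=; congr (_ *: (f _ - _)).
  by congr pair; rewrite /= scaler0 add0r.
split=> -[h1 h2]; apply: DeriveDef.
- by move: h1; rewrite /derivable e.
- by move: h2; rewrite /derive e.
- by move: h1; rewrite /derivable e.
- by move: h2; rewrite /derive e.
Qed.

Lemma is_derive_sndP f x d :
  is_derive x ((0, 1) : R * R) f d <-> is_derive x.2 (1 : R) (fun t => f (x.1, t)) d.
Proof.
have e : (fun h : R => h^-1 *: (f (h *: (0, 1) + x) - f x)) =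
         (fun h : R => h^-1 *: (f (x.1, h *: 1 + x.2) - f (x.1, x.2))).
  apply/funext => h; case: x => a b /=; congr (_ *: (f _ - _)).
  by congr pair; rewrite /= scaler0 add0r.
split=> -[h1 h2]; apply: DeriveDef.
- by move: h1; rewrite /derivable e.
- by move: h2; rewrite /derive e.
- by move: h1; rewrite /derivable e.
- by move: h2; rewrite /derive e.
Qed.

Lemma partialP i f g : (forall x, is_derive x (dir i) f (g x)) -> partial i f = g.
Proof. by move=> fg; apply/funext => x; have [_] := fg x. Qed.

Lemma smooth_is_derive i f x : smooth f -> is_derive x (dir i) f (partial i f x).
Proof. by move=> /(_ [::])[_ /(_ i x)] df; apply: DeriveDef. Qed.

Lemma smooth_continuous f : smooth f -> continuous f.
Proof. by move=> /(_ [::])[]. Qed.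

Lemma smooth_partial i f : smooth f -> smooth (partial i f).
Proof. by move=> sf s; rewrite -(foldr_rcons (@partial R) f s i); exact: sf. Qed.

(** Since [smooth] quantifies over all iterated partial derivatives, a direct proof for products
    would need a Leibniz formula of every order. A class that contains [smooth] and is closed under
    one partial derivative gives the same by induction on the word of derivatives. *)
Inductive smooth2 : (R * R -> R) -> Prop :=
| smooth2_smooth f : smooth f -> smooth2 f
| smooth2_fst (f : R -> R) : smooth1 f -> smooth2 (fun x => f x.1)
| smooth2_snd (f : R -> R) : smooth1 f -> smooth2 (fun x => f x.2)
| smooth2_add f g : smooth2 f -> smooth2 g -> smooth2 (fun x => f x + g x)
| smooth2_mul f g : smooth2 f -> smooth2 g -> smooth2 (fun x => f x * g x).

Lemma smooth2_is_derive i f : smooth2 f ->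
  exists2 g, smooth2 g & forall x, is_derive x (dir i) f (g x).
Proof.
have s0 : smooth2 (fun=> 0) by apply: (@smooth2_fst (fun=> 0)); exact: smooth1_cst.
elim=> {f}[f sf|f sf|f sf|f g sf [f' sf' ff'] sg [g' sg' gg']|f g sf [f' sf' ff'] sg [g' sg' gg']].
- exists (partial i f); first by apply: smooth2_smooth; exact: smooth_partial.
  by move=> x; exact: smooth_is_derive.
- have [g sg fg] := smooth1_is_derive sf; case: i.
    by exists (fun=> 0) => // x; apply/is_derive_sndP; exact: (is_derive_cst (f x.1)).
  by exists (fun x => g x.1); [exact: smooth2_fst|move=> x; exact/is_derive_fstP].
- have [g sg fg] := smooth1_is_derive sf; case: i.
    by exists (fun x => g x.2); [exact: smooth2_snd|move=> x; exact/is_derive_sndP].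
  by exists (fun=> 0) => // x; apply/is_derive_fstP; exact: (is_derive_cst (f x.2)).
- exists (fun x => f' x + g' x); first exact: smooth2_add.
  by move=> x; exact: is_deriveD.
- exists (fun x => f x * g' x + g x * f' x).
    by apply: smooth2_add; apply: smooth2_mul.
  by move=> x; exact: is_deriveM.
Qed.

Lemma smooth2_continuous f : smooth2 f -> continuous f.
Proof.
elim=> {f}[f sf|f sf|f sf|f g sf cf sg cg|f g sf cf sg cg] x.
- exact: smooth_continuous.
- by apply: continuous_comp; [exact: cvg_fst|exact: smooth1_continuous].
- by apply: continuous_comp; [exact: cvg_snd|exact: smooth1_continuous].
- by apply: cvgD; [exact: cf|exact: cg].
- by apply: cvgM; [exact: cf|exact: cg].
Qed.

Lemma smooth2P f : smooth2 f -> smooth f.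
Proof.
move=> sf s; suff : smooth2 (foldr partial f s).
  move=> h; split; first exact: smooth2_continuous.
  by move=> i x; have [g _ /(_ x)[]] := smooth2_is_derive i h.
elim: s => //= i s /(smooth2_is_derive i)[g sg fg].
by rewrite (partialP fg).
Qed.

Lemma smooth_fst (f : R -> R) : smooth1 f -> smooth (fun x => f x.1).
Proof. by move=> sf; apply: smooth2P; exact: smooth2_fst. Qed.

Lemma smooth_snd (f : R -> R) : smooth1 f -> smooth (fun x => f x.2).
Proof. by move=> sf; apply: smooth2P; exact: smooth2_snd. Qed.

Lemma smooth_add f g : smooth f -> smooth g -> smooth (fun x => f x + g x).
Proof. by move=> sf sg; apply/smooth2P/smooth2_add; exact: smooth2_smooth. Qed.

Lemma smooth_mul f g : smooth f -> smooth g -> smooth (fun x => f x * g x).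
Proof. by move=> sf sg; apply/smooth2P/smooth2_mul; exact: smooth2_smooth. Qed.

Lemma smooth_cst (c : R) : smooth (fun=> c).
Proof. by apply: (@smooth_fst (fun=> c)); exact: smooth1_cst. Qed.

Lemma smooth_scale (c : R) f : smooth f -> smooth (fun x => c * f x).
Proof. by move=> sf; apply: smooth_mul; [exact: smooth_cst|exact: sf]. Qed.

Lemma smooth_iter i n f : smooth f -> smooth (iter n (partial i) f).
Proof. by move=> sf; elim: n => [|n IH]; [exact: sf|exact: smooth_partial]. Qed.

Lemma partial_add i f g : smooth f -> smooth g ->
  partial i (fun x => f x + g x) = (fun x => partial i f x + partial i g x).
Proof. by move=> sf sg; apply: partialP => x; apply: is_deriveD; exact: smooth_is_derive. Qed.

Lemma partial_mul i f g : smooth f -> smooth g ->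
  partial i (fun x => f x * g x) = (fun x => f x * partial i g x + g x * partial i f x).
Proof. by move=> sf sg; apply: partialP => x; apply: is_deriveM; exact: smooth_is_derive. Qed.

Lemma partial_scale i (c : R) f : smooth f ->
  partial i (fun x => c * f x) = (fun x => c * partial i f x).
Proof. by move=> sf; apply: partialP => x; apply: is_deriveZ; exact: smooth_is_derive. Qed.

Lemma partial_prod i (f g f' g' : R -> R) :
  (forall t : R, is_derive t (1 : R) f (f' t)) ->
  (forall t : R, is_derive t (1 : R) g (g' t)) ->
  partial i (fun x => f x.1 * g x.2) =
  if i then (fun x => f x.1 * g' x.2) else (fun x => f' x.1 * g x.2).
Proof.
move=> ff' gg'; apply: partialP => x; case: i.
  by apply/is_derive_sndP => /=; apply: (@is_deriveZ _ _ _ g).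
apply/is_derive_fstP => /=; under eq_fun do rewrite mulrC.
by rewrite mulrC; exact: (@is_deriveZ _ _ _ f).
Qed.

(** The mean value theorem is applied to the difference of two horizontal slices of [f], then to [g]
    in the second variable. The side r / 2 keeps the intermediate point in the open ball of radius
    r. *)
Lemma mixed_MVT f g h x (r : R) : 0 < r ->
  (forall y, is_derive y (dir false) f (g y)) ->
  (forall y, is_derive y (dir true) g (h y)) ->
  exists2 y, ball x r y & f (x.1 + r / 2, x.2 + r / 2) - f (x.1 + r / 2, x.2)
     - (f (x.1, x.2 + r / 2) - f x) = h y * (r / 2) * (r / 2).
Proof.
case: x => a b /= r0 fg gh.
pose F t := f (t, b + r / 2) - f (t, b); pose F' t := g (t, b + r / 2) - g (t, b).
have dF (t : R) : is_derive t (1 : R) F (F' t).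
  by apply: is_deriveB;
    [have /is_derive_fstP := fg (t, b + r / 2)|have /is_derive_fstP := fg (t, b)].
have ar : a < a + r / 2 by lra.
have br : b < b + r / 2 by lra.
have [|c] := MVT ar (fun t _ => dF t).
  by apply: continuous_subspaceT; exact: is_derive1_continuous dF.
rewrite in_itv/= => /andP[ac cr] E1.
have dG (t : R) : is_derive t (1 : R) (fun t => g (c, t)) (h (c, t)).
  by have /is_derive_sndP := gh (c, t).
have [|e] := MVT br (fun t _ => dG t).
  by apply: continuous_subspaceT; exact: is_derive1_continuous dG.
rewrite in_itv/= => /andP[be er] E2.
exists (c, e); first by split; rewrite /ball/= ltr_distlC; lra.
by rewrite -[LHS]/(F (a + r / 2) - F a) E1 /F' E2; ring.
Qed.

(** Schwarz's theorem: the second difference over a small square is symmetric in the two variables,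
    so it equals a value of either mixed derivative at some point of the ball, up to the same
    factor; continuity of both concludes. *)
Lemma partial_comm i j f : smooth f -> partial i (partial j f) = partial j (partial i f).
Proof.
wlog : i j / i = false /\ j = true => [wl sf|[-> ->] sf].
  have ft : partial false (partial true f) = partial true (partial false f).
    by apply: wl sf; split.
  by case: i; case: j; [exact: erefl|exact/esym|exact: ft|exact: erefl].
have mulh (r u v : R) : 0 < r -> u * (r / 2) * (r / 2) = v * (r / 2) * (r / 2) -> u = v.
  move=> r0; have r20 : r / 2 != 0 by rewrite gt_eqF// divr_gt0.
  by move=> /(mulIf r20)/(mulIf r20).
have s1 := smooth_partial false sf; have s2 := smooth_partial true sf.
(* Exchanging the coordinates lets [mixed_MVT] serve for the other order of differentiation; the
   point that it yields must then be exchanged back. *)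
pose sw (x : R * R) := (x.2, x.1); pose f' x := f (sw x).
have D1 y : is_derive y (dir false) f' (partial true f (sw y)).
  by apply/is_derive_fstP; have /is_derive_sndP := smooth_is_derive true (sw y) sf.
have D2 y : is_derive y (dir true) (fun z => partial true f (sw z))
    (partial false (partial true f) (sw y)).
  by apply/is_derive_sndP; have /is_derive_fstP := smooth_is_derive false (sw y) s2.
pose p := partial false (partial true f); pose q := partial true (partial false f).
have cp : continuous p by apply: smooth_continuous; exact: smooth_partial.
have cq : continuous q by apply: smooth_continuous; exact: smooth_partial.
apply/funext => x; apply/eqP; rewrite -subr_eq0 -normr_le0; apply/ler_addgt0Pr => e e0.
rewrite add0r -/p -/q.
have e2 : 0 < e / 2 by lra.
have [r r0 Hr] : exists2 r : R, 0 < r & forall y, ball x r y ->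
    `|p x - p y| < e / 2 /\ `|q x - q y| < e / 2.
  have /cvgrPdist_lt/(_ _ e2) np := cp x; have /cvgrPdist_lt/(_ _ e2) nq := cq x.
  have /nbhs_ballP[r r0 Hr] : nbhs x [set y | `|p x - p y| < e / 2 /\ `|q x - q y| < e / 2].
    exact: filterI np nq.
  by exists r => [|y /Hr].
have [y By E1] := mixed_MVT x r0 (fun y => smooth_is_derive false y sf)
  (fun y => smooth_is_derive true y s1).
have [z Bz E2] := mixed_MVT (sw x) r0 D1 D2.
have swz : ball x r (sw z) by case: Bz => ? ?; split.
have {E1 E2} pq : p (sw z) = q y.
  apply: (mulh r); first exact: r0.
  refine (etrans (esym E2) (etrans _ E1)); clear; rewrite /f' /sw.
  case: (x) => a b /=.
  move: (f (a + r / 2, b + r / 2)) (f (a + r / 2, b)) (f (a, b + r / 2)) (f (a, b)).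
  by clear; move=> u v w t; ring.
have [_ h1] := Hr _ By; have [h2 _] := Hr _ swz.
move: pq h1 h2; move: (p x) (p (sw z)) (q x) (q y) => a b c d -> h1 h2.
rewrite (_ : a - c = (a - d) - (c - d)); last by ring.
by apply: (le_trans (ler_normB _ _)); lra.
Qed.

Lemma partial_iter_comm i j m n f : smooth f ->
  iter m (partial i) (iter n (partial j) f) = iter n (partial j) (iter m (partial i) f).
Proof.
have comm1 g : smooth g -> partial i (iter n (partial j) g) = iter n (partial j) (partial i g).
  move=> sg; elim: n => [|n IH]; first exact: erefl.
  by rewrite !iterS -IH; apply: partial_comm; exact: smooth_iter.
move=> sf; elim: m => [|m IH]; first exact: erefl.
by rewrite !iterS IH; apply: comm1; exact: smooth_iter.
Qed.

End Smooth2.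

(** * Integration of derivatives over a plate *)

Section Divergence.
Context {R : realType}.
Implicit Types (l : R * R) (f g F : R * R -> R).
Local Notation mu := (@lebesgue_measure R).

Lemma segment_FTC (f g : R -> R) (a b : R) : a < b -> continuous f -> continuous g ->
  (forall t : R, a < t < b -> is_derive t (1 : R) f (g t)) ->
  (\int[mu]_(t in `[a, b]) (g t)%:E = (f b - f a)%:E)%E.
Proof.
move=> ab cf cg fg; rewrite (continuous_FTC2 (F := f))//.
- exact: continuous_subspaceT.
- split.
  + by move=> t; rewrite in_itv/= => /fg[].
  + exact/cvg_at_right_filter/cf.
  + exact/cvg_at_left_filter/cf.
- by move=> t; rewrite in_itv/= => /fg[] _; rewrite derive1E.
Qed.

Lemma fubini21 l f : continuous f ->
  (\int[area]_(x in plate l) (f x)%:E =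
   \int[mu]_(t in `[0%R, l.2]) \int[mu]_(s in `[0%R, l.1]) (f (s, t))%:E)%E.
Proof.
move=> cf; have mP := @measurable_plate _ l.
rewrite integral_mkcond [RHS]integral_mkcond.
rewrite -(@integral21_prod_meas1 _ _ _ _ _ mu mu); last first.
  have /= := (@integrable_restrict _ _ _ area _ mP _ measurableT (EFin \o f)).1.
  by rewrite setTI; apply; exact: continuous_integrable.
apply: eq_integral => t _; rewrite [RHS]patchE; case: ifPn => [|tn].
  rewrite inE/= => t2; rewrite [RHS]integral_mkcond; apply: eq_integral => s _.
  rewrite !patchE; congr (if _ then _ else _).
  by apply/idP/idP; rewrite !inE; [move=> []|split].
apply: integral0_eq => s _; rewrite patchE ifF//.
by apply/negbTE; apply: contra tn; rewrite !inE => -[].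
Qed.

Lemma fubini12 l f : continuous f ->
  (\int[area]_(x in plate l) (f x)%:E =
   \int[mu]_(s in `[0%R, l.1]) \int[mu]_(t in `[0%R, l.2]) (f (s, t))%:E)%E.
Proof.
move=> cf; have mP := @measurable_plate _ l.
rewrite integral_mkcond [RHS]integral_mkcond.
rewrite -(@integral12_prod_meas1 _ _ _ _ _ mu mu); last first.
  have /= := (@integrable_restrict _ _ _ area _ mP _ measurableT (EFin \o f)).1.
  by rewrite setTI; apply; exact: continuous_integrable.
apply: eq_integral => s _; rewrite [RHS]patchE; case: ifPn => [|sn].
  rewrite inE/= => t2; rewrite [RHS]integral_mkcond; apply: eq_integral => t _.
  rewrite !patchE; congr (if _ then _ else _).
  by apply/idP/idP; rewrite !inE; [move=> []|split].
apply: integral0_eq => t _; rewrite patchE ifF//.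
by apply/negbTE; apply: contra sn; rewrite !inE => -[].
Qed.

Definition coord (i : bool) (x : R * R) : R := if i then x.2 else x.1.

(** Parametrises the line on which coordinate [i] equals [a], so that both pairs of opposite sides
    are treated by one statement. *)
Definition with_coord (i : bool) (a t : R) : R * R := if i then (t, a) else (a, t).

Lemma continuous_with_coord i a f : continuous f -> continuous (fun t => f (with_coord i a t)).
Proof.
move=> cf t; have ca : (fun=> a) @ t --> a by exact: cvg_cst.
have ci : (fun s : R => s) @ t --> t by exact: cvg_id.
case: i; first exact: (cvg_comp _ f (cvg_pair ci ca) (cf (t, a))).
exact: (cvg_comp _ f (cvg_pair ca ci) (cf (a, t))).
Qed.

(** The derivative is asked for only strictly between the two opposite sides, because the weight in
    Hardy's inequality contains absolute values with kinks exactly on them. *)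
Lemma plate_FTC i l F f : 0 < coord i l -> continuous F -> continuous f ->
  (forall x, 0 < coord i x < coord i l -> is_derive x (dir i) F (f x)) ->
  \int[area]_(x in plate l) f x =
  \int[mu]_(t in `[0, coord (~~ i) l]) (F (with_coord i (coord i l) t) - F (with_coord i 0 t)).
Proof.
move=> l0 cF cf Ff; rewrite /Rintegral; congr fine.
case: i l0 Ff => /= l0 Ff; [rewrite fubini12//|rewrite fubini21//].
  apply: eq_integral => s _; apply: (@segment_FTC (fun t => F (s, t)) (fun t => f (s, t))) => //.
  - exact: (@continuous_with_coord false s F).
  - exact: (@continuous_with_coord false s f).
  by move=> t tl; have /is_derive_sndP := Ff (s, t) tl.
apply: eq_integral => t _; apply: (@segment_FTC (fun s => F (s, t)) (fun s => f (s, t))) => //.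
- exact: (@continuous_with_coord true t F).
- exact: (@continuous_with_coord true t f).
by move=> s sl; have /is_derive_fstP := Ff (s, t) sl.
Qed.

End Divergence.

(** * Density in L^2 from indicators of quadrants *)

Section L2Closure.
Context {R : realType}.
Variable l : R * R.
Variable S : set (R * R -> R).
Hypothesis S_L2 : forall f, S f -> L2 l f.
Hypothesis S_add : forall f g, S f -> S g -> S (fun x => f x + g x).
Hypothesis S_scale : forall (c : R) f, S f -> S (fun x => c * f x).
Hypothesis S_0 : S (fun=> 0).
Implicit Types (f g h : R * R -> R).

Definition L2_closure f : Prop := L2 l f /\ forall e : R, 0 < e ->
  exists2 s, S s & ip l (fun x => f x - s x) (fun x => f x - s x) < e.

Lemma L2_closure_sub f : S f -> L2_closure f.
Proof.
move=> Sf; split; [exact: S_L2|move=> e e0; exists f => //].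
rewrite (_ : ip _ _ _ = 0)// /ip; under eq_Rintegral do rewrite subrr mulr0.
by rewrite Rintegral_cst ?mul0r//; exact: measurable_plate.
Qed.

Lemma L2_closure_add f g : L2_closure f -> L2_closure g -> L2_closure (fun x => f x + g x).
Proof.
move=> [Lf cf] [Lg cg]; split; [exact: L2_add|move=> e e0].
have e4 : 0 < e / 4 by lra.
have [s Ss fs] := cf _ e4; have [t St gt] := cg _ e4.
exists (fun x => s x + t x); first exact: S_add.
have := ip_triangle (L2_sub Lf (S_L2 Ss)) (L2_sub Lg (S_L2 St)).
rewrite (_ : (fun x => _ + _) = fun x => f x + g x - (s x + t x)); first lra.
by apply/funext => x; ring.
Qed.

Lemma L2_closure_cvg (F : nat -> R * R -> R) f : L2 l f -> (forall k, L2_closure (F k)) ->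
  ip l (fun x => f x - F k x) (fun x => f x - F k x) @[k --> \oo] --> 0 -> L2_closure f.
Proof.
move=> Lf cF Ff; split => // e e0; have e4 : 0 < e / 4 by lra.
move/cvgr0Pnorm_lt : Ff => /(_ _ e4)[n _ /(_ n (leqnn n))].
rewrite ger0_norm ?ip_ge0// => fn; have [LF /(_ _ e4)[s Ss Fs]] := cF n.
exists s => //.
have := ip_triangle (L2_sub Lf LF) (L2_sub LF (S_L2 Ss)).
rewrite (_ : (fun x => _ + _) = fun x => f x - s x); first lra.
by apply/funext => x; ring.
Qed.

Lemma L2_closure_scale (c : R) f : L2_closure f -> L2_closure (fun x => c * f x).
Proof.
move=> [Lf cf]; split; [exact: L2_scale|move=> e e0].
(* The summand 1 allows dividing by this bound also when c is 0. *)
have c0 : 0 < c ^+ 2 + 1 by rewrite ltr_wpDl ?sqr_ge0.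
have e4 : 0 < e / (c ^+ 2 + 1) by rewrite divr_gt0.
have [s Ss fs] := cf _ e4; exists (fun x => c * s x); first exact: S_scale.
have Lfs := L2_sub Lf (S_L2 Ss).
rewrite (_ : (fun x => _ - _) = fun x => c * (f x - s x)); last first.
  by apply/funext => x; rewrite mulrBr.
rewrite ipZl ?ipZr//; last exact: L2_scale.
rewrite mulrA -expr2.
apply: (@le_lt_trans _ _ ((c ^+ 2 + 1) * ip l (fun x => f x - s x) (fun x => f x - s x))).
  by rewrite ler_wpM2r ?ip_ge0// lerDl.
by rewrite mulrC -ltr_pdivlMr.
Qed.

(** The squared difference is at most (2 G)^2, so pointwise convergence inside the open plate
    becomes convergence in L^2. *)
Lemma L2_closure_dominated (F : nat -> R * R -> R) f G : (forall k, L2_closure (F k)) ->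
  measurable_fun (plate l) f -> L2 l G ->
  (forall k x, plate l x -> `|F k x| <= G x) -> (forall x, plate l x -> `|f x| <= G x) ->
  (forall x, open_plate l x -> F k x @[k --> \oo] --> f x) -> L2_closure f.
Proof.
move=> cF mf LG FG fG Ff.
have Lf : L2 l f.
  by apply: L2_le mf LG _ => x Px; rewrite (le_trans (fG x Px))// ler_norm.
have mF k : measurable_fun (plate l) (F k) by apply: L2_measurable; case: (cF k).
apply: (L2_closure_cvg Lf cF).
have -> : 0 = \int[area]_(x in plate l) (cst 0 x : R).
  by rewrite Rintegral_cst ?mul0r//; exact: measurable_plate.
apply: (@plate_dominated_cvg _ l (fun k x => (f x - F k x) * (f x - F k x)) (cst 0)
  (fun x => (2 * G x) * (2 * G x))).
- by move=> k; apply: measurable_funM; apply: measurable_funB.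
- exact: measurable_cst.
- by apply: L2_mul; exact: L2_scale.
- move=> k x Px; rewrite normrM; have := ler_normB (f x) (F k x).
  have := FG k x Px; have := fG x Px => h1 h2 h3.
  by apply: ler_pM => //; lra.
move=> x Ox; have := Ff x Ox => {}Ff; rewrite /cst.
have c : f x - F k x @[k --> \oo] --> 0.
  by rewrite -(subrr (f x)); apply: cvgB => //; exact: cvg_cst.
by rewrite -(mulr0 0); exact: cvgM.
Qed.

Hypothesis S_quadrant : forall a b : R,
  L2_closure \1_(`]-oo, a[ `*` `]-oo, b[ : set (R * R)).

Definition quadrants : set (set (R * R)) :=
  [set `]-oo, x.1[ `*` `]-oo, x.2[ | x in [set: R * R]].

(** The half-plane x < a is the union of the quadrants with corner (a, k), k a natural number, and
    likewise for y. Hence both coordinates, and so the identity, are measurable from the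
    sigma-algebra generated by quadrants. *)
Lemma quadrants_measurable A : measurable A -> <<s quadrants >> A.
Proof.
move=> mA; pose T := g_sigma_algebraType quadrants.
have H (g : T -> R) : (forall a, exists F : nat -> R * R, g @^-1` `]-oo, a[ =
    \bigcup_k (`]-oo, (F k).1[ `*` `]-oo, (F k).2[)) -> measurable_fun setT g.
  move=> Hg; apply: (measurability _ (RGenInftyO.measurableE R)) => _ [_ [a ->] <-].
  have [F HF] := Hg a; rewrite setTI HF; apply: bigcupT_measurable => k.
  by apply: sub_sigma_algebra; exists (F k).
have bnd (y : R) : exists k : nat, y < k%:R.
  by exists (Num.truncn `|y|).+1; rewrite (le_lt_trans (ler_norm _)) ?truncnS_gt.
have : measurable_fun [set: T] (fun x : T => (x : R * R)).
  apply/measurable_fun_pairP; split; apply: H => a.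
    exists (fun k => (a, k%:R)); apply/seteqP; split=> [[x y] /=|[x y] [k _ [/=]]].
      rewrite in_itv/= => xa; have [k yk] := bnd y; exists k => //.
    by move=> h _; exact: h.
  exists (fun k => (k%:R, a)); apply/seteqP; split=> [[x y] /=|[x y] [k _ [/=]]].
    rewrite in_itv/= => xa; have [k yk] := bnd x; exists k => //.
  by move=> _ h; exact: h.
by move=> /(_ measurableT _ mA); rewrite setTI.
Qed.

Lemma quadrants_subset A : quadrants A -> measurable A.
Proof. by move=> [x _ <-]; apply: measurableX; exact: measurable_itv. Qed.

(** By disjointness at most one set contains x, and the partial sums are constant once its index is
    passed. *)
Lemma indic_bigcup_cvg (F : nat -> set (R * R)) x : trivIset setT F ->
  (\sum_(0 <= i < k) \1_(F i) x : R) @[k --> \oo] --> (\1_(\bigcup_i F i) x : R).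
Proof.
move=> tF; rewrite [in X in _ --> X]indicE; case: (boolP (x \in _)) => [|xF].
  rewrite inE => -[i _ Fix]; apply: cvg_near_cst; exists i.+1 => // k /= ik.
  rewrite (big_cat_nat (n := i)) ?(ltnW ik)//= big_nat big1 => [|j /andP[_ ji]].
    rewrite add0r big_ltn// indicE mem_set//= big_nat big1 ?addr0// => j /andP[ij _].
    rewrite indicE memNset// => Fjx; move: ij; rewrite (_ : j = i) ?ltnn//.
    by apply: tF => //; exists x.
  rewrite indicE memNset// => Fjx; move: ji; rewrite (_ : j = i) ?ltnn//.
  by apply: tF => //; exists x.
apply: cvg_near_cst; apply: nearW => k; rewrite big1// => i _.
by rewrite indicE memNset// => Fix; move/negP: xF; apply; rewrite inE; exists i.
Qed.

Lemma indic_partial_le1 (F : nat -> set (R * R)) x k : trivIset setT F ->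
  `|\sum_(0 <= i < k) \1_(F i) x : R| <= 1.
Proof.
move=> tF; rewrite ger0_norm; last by apply: sumr_ge0 => i _; rewrite indicE.
have [[i [ik Fix]]|no] := pselect (exists i, (i < k)%N /\ F i x).
  rewrite (big_cat_nat (n := i)) ?(ltnW ik)//= big_nat big1 => [|j /andP[_ ji]].
    rewrite add0r big_ltn// indicE mem_set//= big_nat big1 ?addr0// => j /andP[ij _].
    rewrite indicE memNset// => Fjx; move: ij; rewrite (_ : j = i) ?ltnn//.
    by apply: tF => //; exists x.
  rewrite indicE memNset// => Fjx; move: ji; rewrite (_ : j = i) ?ltnn//.
  by apply: tF => //; exists x.
rewrite big_nat big1// => i /andP[_ ik]; rewrite indicE memNset// => Fix.
by apply: no; exists i.
Qed.

(** Quadrants are stable under intersection, and the sets whose indicator is in the closure form a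
    Dynkin class. The whole plane and disjoint unions come from dominated convergence with bound 1,
    which is square-integrable on a plate. *)
Lemma L2_closure_indic A : measurable A -> L2_closure \1_A.
Proof.
move=> mA; have := quadrants_measurable mA.
have mq : forall B, <<s quadrants >> B -> measurable B.
  by apply: smallest_sub; [exact: sigma_algebra_measurable|exact: quadrants_subset].
pose P B := L2_closure \1_B.
have PT : P setT.
  apply: (@L2_closure_dominated (fun k => \1_(`]-oo, k%:R[ `*` `]-oo, k%:R[)) _ (cst 1)).
  - by move=> k; exact: S_quadrant.
  - exact: measurable_indic.
  - exact: L2_cst.
  - by move=> k x _; rewrite indicE; case: (_ \in _); rewrite ?normr1 ?normr0.
  - by move=> x _; rewrite indicT normr1.
  move=> x _; apply: cvg_near_cst; exists (Num.truncn (`|x.1| + `|x.2|)).+1 => // k /= xk.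
  rewrite indicT indicE mem_set//.
  have : `|x.1| + `|x.2| < k%:R.
    by apply: lt_le_trans (truncnS_gt _) _; rewrite ler_nat.
  have := ler_norm x.1; have := ler_norm x.2; have := normr_ge0 x.1; have := normr_ge0 x.2.
  by move=> ? ? ? ? ?; split; rewrite /= in_itv/=; lra.
move: A {mA}; apply: (@dynkin_induction _ _ quadrants P) => //.
- by apply/seteqP; split=> B; [exact: quadrants_measurable|exact: mq].
- move=> _ _ [x _ <-] [y _ <-]; exists (Num.min x.1 y.1, Num.min x.2 y.2) => //=.
  by apply/seteqP; split=> -[a b]; rewrite /= !in_itv/= !lt_min;
    [move=> [/andP[-> ->] /andP[-> ->]]|move=> [[-> ->] [-> ->]]].
- by move=> _ [x _ <-]; exact: S_quadrant.
- move=> B mB PB; rewrite /P (_ : \1_(~` B) = fun x => \1_setT x + (-1) * \1_B x).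
    by apply: L2_closure_add => //; exact: L2_closure_scale.
  apply/funext => x; rewrite indicT !indicE in_setC.
  by case: (_ \in B) => /=; ring.
move=> F mF tF PF.
apply: (@L2_closure_dominated (fun k x => \sum_(0 <= i < k) \1_(F i) x) _ (cst 1)).
- elim=> [|k IH].
    by under eq_fun do rewrite big_geq//; exact: (L2_closure_sub S_0).
  by under eq_fun do rewrite big_nat_recr//=; exact: (L2_closure_add IH (PF k)).
- by apply: measurable_indic; exact: bigcupT_measurable.
- exact: L2_cst.
- by move=> k x _; exact: indic_partial_le1.
- by move=> x _; rewrite indicE; case: (_ \in _); rewrite ?normr1 ?normr0.
by move=> x _; exact: indic_bigcup_cvg.
Qed.

Lemma L2_closure_sum n (c : nat -> R) (B : nat -> set (R * R)) :
  (forall i, measurable (B i)) ->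
  L2_closure (fun x => \sum_(i < n) c i * \1_(B i) x).
Proof.
move=> mB; elim: n => [|n IH].
  by under eq_fun do rewrite big_ord0; exact: (L2_closure_sub S_0).
under eq_fun do rewrite big_ord_recr/=.
by apply: L2_closure_add => //; apply: L2_closure_scale; exact: L2_closure_indic.
Qed.

Import HBNNSimple.

Lemma L2_closure_nnsfun (g : {nnsfun (R * R)%type >-> R}) : L2_closure (g : R * R -> R).
Proof.
rewrite (funext (fimfunEord g)); set s := finmap.enum_fset _.
apply: (@L2_closure_sum _ (fun i => s`_i) (fun i => g @^-1` [set s`_i])) => i.
exact: measurable_funPTI.
Qed.

(** Positive and negative parts reduce to f >= 0, where increasing simple functions are dominated by
    f itself. *)
Lemma L2_closure_L2 f : L2 l f -> L2_closure f.
Proof.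
suff nn g : L2 l g -> (forall x, 0 <= g x) -> L2_closure g.
  move=> Lf; have mf := L2_measurable Lf.
  have Lp (g : R * R -> R) : measurable_fun (plate l) g -> (forall x, `|g x| <= `|f x|) -> L2 l g.
    by move=> mg gf; exact: (L2_le mg Lf).
  rewrite (_ : f = fun x => Num.max (f x) 0 + (-1) * Num.max (- f x) 0).
    apply: L2_closure_add; last apply: L2_closure_scale.
    - apply: nn => [|x]; last by rewrite le_max lexx orbT.
      apply: Lp => [|x]; first exact: measurable_maxr.
      by case: (leP (f x) 0) => f0; rewrite ?normr0.
    - apply: nn => [|x]; last by rewrite le_max lexx orbT.
      apply: Lp => [|x]; first by apply: measurable_maxr => //; exact: measurableT_comp.
      by case: (leP (- f x) 0) => f0; rewrite ?normr0 ?normrN.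
  apply/funext => x; case: (leP (f x) 0) => f0.
    by rewrite max_l ?oppr_ge0//; ring.
  by rewrite max_r ?oppr_le0 ?ltW//; ring.
move=> Lg g0; have mg := L2_measurable Lg; have mP := @measurable_plate _ l.
have [h [ndh hg]] := @approximation _ _ _ _ mP (EFin \o g) ((measurable_EFinP _ _).2 mg)
  (fun x _ => g0 x).
have hg' x : plate l x -> h k x @[k --> \oo] --> g x.
  by move=> /hg; exact: fine_cvg.
apply: (@L2_closure_dominated h g g) => //.
- by move=> k; exact: L2_closure_nnsfun.
- move=> k x Px; rewrite ger0_norm//.
  rewrite -(cvg_lim _ (hg' _ Px))//; apply: nondecreasing_cvgn_le.
    by move=> m n mn; have /lefP := ndh _ _ mn.
  by apply/cvg_ex; eexists; exact: hg'.
- by move=> x Px; rewrite ger0_norm.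
move=> x [/= O1 O2]; apply: hg'.
by split => /=; [move: O1|move: O2]; rewrite !in_itv/= => /andP[/ltW -> /ltW ->].
Qed.

End L2Closure.

(** * Density of sine sums *)

Section SignIteration.
Context {R : realType}.

(* Its iterates converge to the sign of s for s in [-1, 1]; the polynomials are odd
   in s, so iterating from a sine stays in the span of the sines. *)
Definition sgn_step (s : R) : R := s * (3 - s ^+ 2) / 2.

Lemma sgn_step_bound s : `|s| <= 1 -> `|sgn_step s| <= 1.
Proof.
rewrite /sgn_step !ler_norml => /andP[h1 h2].
(* The two bounds are the factorisations 2 - s (3 - s^2) = (1 - s)^2 (2 + s) and its mirror image
   under s -> - s. *)
have : 0 <= (1 - s) ^+ 2 * (2 + s) by rewrite mulr_ge0 ?sqr_ge0//; lra.
have : 0 <= (1 + s) ^+ 2 * (2 - s) by rewrite mulr_ge0 ?sqr_ge0//; lra.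
by move=> ? ?; apply/andP; split; lra.
Qed.

Lemma iter_sgn_step_bound n s : `|s| <= 1 -> `|iter n sgn_step s| <= 1.
Proof. by move=> s1; elim: n => //= n; exact: sgn_step_bound. Qed.

Lemma iter_sgn_stepN n s : iter n sgn_step (- s) = - iter n sgn_step s.
Proof. by elim: n => //= n ->; rewrite /sgn_step sqrrN !mulNr. Qed.

Lemma iter_sgn_step0 n : iter n sgn_step 0 = 0.
Proof. by elim: n => //= n ->; rewrite /sgn_step !mul0r. Qed.

(** One step turns the error e = 1 - t into e * e (3 - e) / 2. The factor e (3 - e) / 2 increases on
    [0, 1] and is below 1 for e < 1, so its value r at the initial error bounds all later ones and
    the convergence is geometric. *)
Lemma iter_sgn_step_cvg s : 0 < s -> s <= 1 -> iter n sgn_step s @[n --> \oo] --> (1 : R).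
Proof.
move=> s0 s1; pose d := 1 - s; pose r := d * (3 - d) / 2.
have r0 : 0 <= r by rewrite /r /d; nra.
have r1 : r < 1 by rewrite /r /d; nra.
have H n : 0 <= 1 - iter n sgn_step s /\ 1 - iter n sgn_step s <= d * r ^+ n.
  elim: n => [|n [IH1 IH2]]; first by rewrite expr0 mulr1 /= /d; lra.
  have dn : 1 - iter n sgn_step s <= d.
    apply: le_trans IH2 _; rewrite -[leRHS]mulr1 ler_wpM2l// /d; first lra.
    by rewrite exprn_ile1// ltW.
  rewrite iterS; move: IH1 IH2 dn; move: (iter n sgn_step s) => t IH1 IH2 dn.
  have -> : 1 - sgn_step t = (1 - t) * ((1 - t) * (3 - (1 - t)) / 2).
    by rewrite /sgn_step; field.
  have d1 : d < 1 by rewrite /d; lra.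
  have h1 : 0 <= (1 - t) * (3 - (1 - t)) / 2 by nra.
  split; first by rewrite mulr_ge0.
  rewrite exprSr [leRHS]mulrA; apply: ler_pM => //.
  by rewrite /r; nra.
apply/cvgrPdist_lt => e e0.
have cr : d * r ^+ n @[n --> \oo] --> 0.
  by rewrite -(mulr0 d); apply: cvgMl_tmp; apply: cvg_expr; rewrite ger0_norm.
move/cvgr0Pnorm_lt : cr => /(_ _ e0); apply: filterS => n.
have [h1 h2] := H n; rewrite (ger0_norm h1) => h3.
by apply: le_lt_trans h2 (le_lt_trans (ler_norm _) h3).
Qed.

End SignIteration.

Section Sines.
Context {R : realType}.
Implicit Types (L : R) (l : R * R).

Definition sine L (m : nat) (t : R) : R := sin (m%:R * (pi / L) * t).

Inductive sine_span L : (R -> R) -> Prop :=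
| sine_span_basis m : sine_span L (sine L m.+1)
| sine_span_add f g : sine_span L f -> sine_span L g -> sine_span L (fun t => f t + g t)
| sine_span_scale c f : sine_span L f -> sine_span L (fun t => c * f t).

Lemma sine_span0 L : sine_span L (fun=> 0).
Proof.
have := sine_span_scale 0 (sine_span_basis L 0).
by congr (sine_span L _); apply/funext => t; rewrite mul0r.
Qed.

(** The product of two sines is a combination of cosines and leaves the span. Multipliers do form an
    algebra; it contains the constants and the basic cosine, hence also the square of the basic
    sine. *)
Definition sine_multiplier L (c : R -> R) : Prop :=
  forall f, sine_span L f -> sine_span L (fun t => f t * c t).

Lemma sine_multiplier_cst L (c : R) : sine_multiplier L (fun=> c).
Proof.
move=> f /(sine_span_scale c).
by congr (sine_span L _); apply/funext => t; rewrite mulrC.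
Qed.

Lemma sine_multiplier_add L c d : sine_multiplier L c -> sine_multiplier L d ->
  sine_multiplier L (fun t => c t + d t).
Proof.
move=> mc md f sf; have := sine_span_add (mc _ sf) (md _ sf).
by congr (sine_span L _); apply/funext => t; rewrite mulrDr.
Qed.

Lemma sine_multiplier_mul L c d : sine_multiplier L c -> sine_multiplier L d ->
  sine_multiplier L (fun t => c t * d t).
Proof.
move=> mc md f sf; have := md _ (mc _ sf).
by congr (sine_span L _); apply/funext => t; rewrite mulrA.
Qed.

Definition cosine L (t : R) : R := cos (pi / L * t).

Lemma sine_multiplier_cosine L : sine_multiplier L (cosine L).
Proof.
move=> f; elim=> [m|{}f g _ IHf _ IHg|c {}f _ IHf].
- have trig (a b : R) : sin a * cos b = 2^-1 * sin (a + b) + 2^-1 * sin (a - b).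
    by rewrite sinD sinB; field.
  have -> : (fun t => sine L m.+1 t * cosine L t) =
      (fun t => 2^-1 * sine L m.+2 t + 2^-1 * sine L m t).
    apply/funext => t; rewrite /sine /cosine trig -[in m.+2%:R]addn1 natrD.
    by congr (_ * sin _ + _ * sin _); rewrite -?[in m.+1%:R]addn1 ?natrD; ring.
  apply: sine_span_add; first exact/sine_span_scale/sine_span_basis.
  (* The basis starts at frequency 1; for the lowest sine the difference term has frequency 0 and
     vanishes. *)
  case: m => [|m]; last exact/sine_span_scale/sine_span_basis.
  rewrite (_ : (fun t => _) = fun=> 0); first exact: sine_span0.
  by apply/funext => t; rewrite /sine !mul0r sin0 mulr0.
- have := sine_span_add IHf IHg.
  by congr (sine_span L _); apply/funext => t; rewrite mulrDl.
- have := sine_span_scale c IHf.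
  by congr (sine_span L _); apply/funext => t; rewrite mulrA.
Qed.

(** Each step multiplies s by a polynomial in s^2. The induction therefore carries two facts: s is
    in the span, and s^2 is a multiplier. *)
Lemma sgn_step_sine n L : let s := (fun t => iter n sgn_step (sine L 1 t)) in
  sine_span L s /\ sine_multiplier L (fun t => s t ^+ 2).
Proof.
elim: n => [|n [IH1 IH2]] /=.
  split; first exact: sine_span_basis.
  rewrite (_ : (fun t => _) = fun t => 1 + (-1) * (cosine L t * cosine L t)).
    apply: sine_multiplier_add; first exact: sine_multiplier_cst.
    apply: sine_multiplier_mul; first exact: sine_multiplier_cst.
    by apply: sine_multiplier_mul; exact: sine_multiplier_cosine.
  apply/funext => t; rewrite /sine /cosine mul1r.
  by rewrite -[X in X + _](cos2Dsin2 (pi / L * t)); ring.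
have m3 : sine_multiplier L (fun t => (3 + (-1) * iter n sgn_step (sine L 1 t) ^+ 2) * 2^-1).
  apply: sine_multiplier_mul; last exact: sine_multiplier_cst.
  apply: sine_multiplier_add; first exact: sine_multiplier_cst.
  by apply: sine_multiplier_mul => //; exact: sine_multiplier_cst.
split.
  have := m3 _ IH1; congr (sine_span L _); apply/funext => t.
  by rewrite /sgn_step; field.
have := sine_multiplier_mul IH2 (sine_multiplier_mul m3 m3).
congr (sine_multiplier L _); apply/funext => t.
by rewrite /sgn_step; field.
Qed.

(** Approximates the indicator of t < a on ]0, L[. The cosine decreases there, so q tends to 1, 1/2
    or 0 according as t < a, t = a or t > a, and 2 q^2 - q sends these to 1, 0, 0. The first factor
    tends to 1 and brings the product into the sine span. Halving the difference of cosines keeps it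
    in [-1, 1], where the sign iteration converges. *)
Definition step_approx L (a : R) n (t : R) : R :=
  let q := (1 + iter n sgn_step ((cosine L t - cosine L a) / 2)) / 2 in
  iter n sgn_step (sine L 1 t) * (2 * q ^+ 2 - q).

Lemma step_approx_span L a n : sine_span L (step_approx L a n).
Proof.
have [s1 _] := sgn_step_sine n L.
pose c := fun t => iter n sgn_step ((cosine L t - cosine L a) / 2).
suff m : sine_multiplier L (fun t => 2 * ((1 + c t) / 2) ^+ 2 - (1 + c t) / 2).
  exact: m _ s1.
have mc : sine_multiplier L c.
  rewrite /c; elim: n {s1 c} => [|n IH].
    apply: sine_multiplier_mul; last exact: sine_multiplier_cst.
    apply: sine_multiplier_add; first exact: sine_multiplier_cosine.
    exact: sine_multiplier_cst.
  rewrite (_ : (fun t => _) = fun t => iter n sgn_step ((cosine L t - cosine L a) / 2) *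
     (3 + (-1) * (iter n sgn_step ((cosine L t - cosine L a) / 2) *
       iter n sgn_step ((cosine L t - cosine L a) / 2))) * 2^-1); last first.
    by apply/funext => t; rewrite iterS /sgn_step mulN1r expr2.
  apply: sine_multiplier_mul; last exact: sine_multiplier_cst.
  apply: sine_multiplier_mul => //.
  apply: sine_multiplier_add; first exact: sine_multiplier_cst.
  apply: sine_multiplier_mul; first exact: sine_multiplier_cst.
  exact: sine_multiplier_mul.
have -> : (fun t => 2 * ((1 + c t) / 2) ^+ 2 - (1 + c t) / 2) =
    (fun t => 2^-1 * (c t + c t * c t)) by apply/funext => t; field.
apply: sine_multiplier_mul; first exact: sine_multiplier_cst.
by apply: sine_multiplier_add => //; exact: sine_multiplier_mul.
Qed.

Lemma step_approx_bound L a n t : `|step_approx L a n t| <= 1.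
Proof.
rewrite normrM -[leRHS]mulr1 ler_pM//.
  apply: iter_sgn_step_bound; rewrite ler_norml.
  by rewrite sin_geN1 sin_le1.
set c := iter n _ _; have : `|c| <= 1.
  apply: iter_sgn_step_bound; rewrite ler_norml /cosine.
  have := cos_geN1 (pi / L * t); have := cos_le1 (pi / L * t).
  have := cos_geN1 (pi / L * a); have := cos_le1 (pi / L * a); lra.
by rewrite !ler_norml => /andP[h1 h2]; apply/andP; split; nra.
Qed.

Lemma step_approx_cvg L a t : 0 < L -> 0 <= a <= L -> 0 < t < L ->
  step_approx L a n t @[n --> \oo] --> ((t < a)%R%:R : R).
Proof.
move=> L0 /andP[a0 aL] /andP[t0 tL].
have pL : 0 < pi / L by rewrite divr_gt0 ?pi_gt0.
have rng (u : R) : 0 <= u <= L -> pi / L * u \in `[0, pi].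
  move=> /andP[u0 uL]; rewrite in_itv/= mulr_ge0 ?(ltW pL)//=.
  by rewrite mulrAC ler_pdivrMr// ler_wpM2l// pi_ge0.
have c1 : iter n sgn_step (sine L 1 t) @[n --> \oo] --> (1 : R).
  apply: iter_sgn_step_cvg; last exact: sin_le1.
  rewrite /sine mul1r sin_gt0_pi// mulr_gt0//=.
  by rewrite mulrAC ltr_pdivrMr// ltr_pM2l// pi_gt0.
have key (v : R) (b : bool) : iter n sgn_step ((cosine L t - cosine L a) / 2) @[n --> \oo] --> v ->
    2 * ((1 + v) / 2) ^+ 2 - (1 + v) / 2 = b%:R ->
    step_approx L a n t @[n --> \oo] --> (b%:R : R).
  move=> cv <-; rewrite -[X in _ --> X]mul1r; apply: cvgM => //.
  have cq : (1 + iter n sgn_step ((cosine L t - cosine L a) / 2)) / 2 @[n --> \oo] --> (1 + v) / 2.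
    by apply: cvgMr_tmp; apply: cvgD => //; exact: cvg_cst.
  apply: cvgB => //; apply: cvgMl_tmp; under eq_fun do rewrite expr2.
  by rewrite expr2; exact: cvgM.
have bt : -1 <= cosine L t <= 1 by rewrite /cosine cos_geN1 cos_le1.
have ba : -1 <= cosine L a <= 1 by rewrite /cosine cos_geN1 cos_le1.
have dec (u v : R) : 0 <= u <= L -> 0 <= v <= L -> u < v -> cosine L v < cosine L u.
  by move=> u1 v1 uv; rewrite /cosine ltr_cos ?rng// ltr_pM2l.
have tr : 0 <= t <= L by rewrite !ltW.
have ar : 0 <= a <= L by rewrite a0 aL.
have [ta|at_|ta] := ltgtP t a.
- apply: (key 1); last by rewrite /=; field.
  by apply: iter_sgn_step_cvg; have := dec _ _ tr ar ta; lra.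
- apply: (key (-1)); last by rewrite /=; field.
  rewrite (_ : _ / 2 = - ((cosine L a - cosine L t) / 2)); last by ring.
  under eq_fun do rewrite iter_sgn_stepN.
  by apply: cvgN; apply: iter_sgn_step_cvg; have := dec _ _ ar tr at_; lra.
- apply: (key 0); last by rewrite /=; field.
  rewrite ta subrr mul0r; under eq_fun do rewrite iter_sgn_step0.
  exact: cvg_cst.
Qed.

End Sines.

Section Sines2.
Context {R : realType}.
Implicit Types (L : R) (l : R * R) (f g u : R * R -> R).

Inductive sine_span2 l : (R * R -> R) -> Prop :=
| sine_span2_basis m n :
    sine_span2 l (fun x => sine l.1 m.+1 x.1 * sine l.2 n.+1 x.2)
| sine_span2_add f g :
    sine_span2 l f -> sine_span2 l g -> sine_span2 l (fun x => f x + g x)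
| sine_span2_scale c f : sine_span2 l f -> sine_span2 l (fun x => c * f x).

Lemma sine_span2_prod l (f g : R -> R) : sine_span l.1 f -> sine_span l.2 g ->
  sine_span2 l (fun x => f x.1 * g x.2).
Proof.
move=> sf sg; elim: sf => [m|{}f f' _ IH _ IH'|c {}f _ IH].
- elim: sg => [n|{}g g' _ IH _ IH'|c {}g _ IH]; first exact: sine_span2_basis.
    have := sine_span2_add IH IH'.
    by congr (sine_span2 l _); apply/funext => x; rewrite mulrDr.
  have := sine_span2_scale c IH.
  by congr (sine_span2 l _); apply/funext => x; rewrite mulrCA.
- have := sine_span2_add IH IH'.
  by congr (sine_span2 l _); apply/funext => x; rewrite mulrDl.
have := sine_span2_scale c IH.
by congr (sine_span2 l _); apply/funext => x; rewrite mulrA.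
Qed.

Lemma sine_span20 l : sine_span2 l (fun=> 0).
Proof.
have := sine_span2_scale 0 (sine_span2_basis l 0 0).
by congr (sine_span2 l _); apply/funext => t; rewrite mul0r.
Qed.

Lemma is_derive_sine L m (t : R) :
  is_derive t (1 : R) (sine L m) (m%:R * (pi / L) * cos (m%:R * (pi / L) * t)).
Proof.
set a := m%:R * _.
have h1 : is_derive t (1 : R) (a \*: (@id R)) (a *: 1) by exact: is_deriveZ.
have := @is_derive1_comp _ sin (a \*: (@id R)) t _ _ (is_derive_sin _) h1.
by rewrite /GRing.scale/= mulr1 mulrC.
Qed.

Lemma is_derive_dsine L m (t : R) :
  is_derive t (1 : R) (fun t => m%:R * (pi / L) * cos (m%:R * (pi / L) * t))
    (- (m%:R * (pi / L)) ^+ 2 * sine L m t).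
Proof.
rewrite /sine; set a := m%:R * _.
have h1 : is_derive t (1 : R) (a \*: (@id R)) (a *: 1) by exact: is_deriveZ.
have h2 := @is_derive1_comp _ cos (a \*: (@id R)) t _ _ (is_derive_cos _) h1.
have := @is_deriveZ _ _ _ _ a _ _ _ h2.
rewrite (_ : a *: _ = - a ^+ 2 * sin (a * t))//.
by rewrite /GRing.scale/=; ring.
Qed.

Lemma smooth_sine_span2 l f : sine_span2 l f -> smooth f.
Proof.
have s1 L m : smooth1 (sine L m).
  have := smooth1_affine (m%:R * (pi / L)) 0 (@smooth1_sin R).
  by congr (smooth1 _); apply/funext => t; rewrite addr0.
elim=> [m n|{}f g _ sf _ sg|c {}f _ sf]; last 2 first.
- exact: smooth_add.
- exact: smooth_scale.
apply: smooth_mul; [exact: (@smooth_fst _ (sine l.1 m.+1))|].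
exact: (@smooth_snd _ (sine l.2 n.+1)).
Qed.

Lemma partial2_sine l i m n :
  partial i (partial i (fun x => sine l.1 m x.1 * sine l.2 n x.2)) =
  (fun x => - ((if i then n%:R else m%:R) * (pi / coord i l)) ^+ 2 *
     (sine l.1 m x.1 * sine l.2 n x.2)).
Proof.
have d (L : R) k := @is_derive_sine L k; have d' (L : R) k := @is_derive_dsine L k.
rewrite (partial_prod i (d l.1 m) (d l.2 n)); case: i => /=.
  rewrite (partial_prod true (d l.1 m) (d' l.2 n)).
  by apply/funext => x; rewrite mulrCA.
rewrite (partial_prod false (d' l.1 m) (d l.2 n)).
by apply/funext => x; rewrite -[LHS]mulrA.
Qed.

Lemma sine_span2_partial2 l i f : sine_span2 l f -> sine_span2 l (partial i (partial i f)).
Proof.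
elim=> [m n|{}f g sf IH sg IH'|c {}f sf IH].
- by rewrite partial2_sine; apply: sine_span2_scale; exact: sine_span2_basis.
- have Sf := smooth_sine_span2 sf; have Sg := smooth_sine_span2 sg.
  rewrite (partial_add i Sf Sg).
  rewrite (partial_add i (smooth_partial i Sf) (smooth_partial i Sg)).
  exact: sine_span2_add.
- have Sf := smooth_sine_span2 sf.
  rewrite (partial_scale i c Sf) (partial_scale i c (smooth_partial i Sf)).
  exact: sine_span2_scale.
Qed.

(** Each product of sines is an eigenfunction of the Laplacian. Its eigenvalue is strictly negative
    because the frequencies start at 1, so the inverse is taken term by term. *)
Lemma sine_span2_laplacian_inv l f : 0 < l.1 -> 0 < l.2 -> sine_span2 l f ->
  exists2 u, sine_span2 l u & forall x,
    partial false (partial false u) x + partial true (partial true u) x = f x.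
Proof.
move=> l1 l2; elim=> [m n|{}f g sf [u su uf] sg [v sv vg]|c {}f sf [u su uf]].
- pose a := - (m.+1%:R * (pi / l.1)) ^+ 2 - (n.+1%:R * (pi / l.2)) ^+ 2.
  have a0 : a != 0.
    have := pi_gt0 R => p0.
    have h1 : 0 < (m.+1%:R * (pi / l.1)) ^+ 2 by rewrite exprn_gt0// mulr_gt0// divr_gt0.
    have h2 : 0 < (n.+1%:R * (pi / l.2)) ^+ 2 by rewrite exprn_gt0// mulr_gt0// divr_gt0.
    by rewrite lt_eqF// /a; lra.
  exists (fun x => a^-1 * (sine l.1 m.+1 x.1 * sine l.2 n.+1 x.2)).
    exact/sine_span2_scale/sine_span2_basis.
  have S := smooth_sine_span2 (sine_span2_basis l m n).
  move=> x; rewrite !(partial_scale _ _ S) !(partial_scale _ _ (smooth_partial _ S)).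
  by rewrite !partial2_sine /= -!mulrDr -mulrDl mulrA mulVf ?mul1r.
- exists (fun x => u x + v x); first exact: sine_span2_add.
  have Su := smooth_sine_span2 su; have Sv := smooth_sine_span2 sv.
  move=> x; rewrite !(partial_add _ Su Sv).
  rewrite !(partial_add _ (smooth_partial _ Su) (smooth_partial _ Sv)).
  by rewrite -(uf x) -(vg x); exact: addrACA.
exists (fun x => c * u x); first exact: sine_span2_scale.
have Su := smooth_sine_span2 su.
move=> x; rewrite !(partial_scale _ _ Su) !(partial_scale _ _ (smooth_partial _ Su)).
by rewrite -mulrDr uf.
Qed.

Lemma sine_bounds L m : L != 0 -> sine L m 0 = 0 /\ sine L m L = 0.
Proof.
move=> L0; split; first by rewrite /sine mulr0 sin0.
rewrite /sine -mulrA divfK//; elim: m => [|m IH]; first by rewrite mul0r sin0.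
by rewrite -addn1 natrD mulrDl mul1r sinDpi IH oppr0.
Qed.

Lemma sine_span2_boundary l i f x : l.1 != 0 -> l.2 != 0 -> sine_span2 l f ->
  coord i x = 0 \/ coord i x = coord i l -> f x = 0.
Proof.
move=> l1 l2 + xi; elim=> [m n|{}f g _ IH _ IH'|c {}f _ IH].
- have [a1 a2] := sine_bounds m.+1 l1; have [b1 b2] := sine_bounds n.+1 l2.
  by case: i xi => /= -[] ->; rewrite ?a1 ?a2 ?b1 ?b2 ?mul0r ?mulr0.
- by rewrite IH IH' addr0.
by rewrite IH mulr0.
Qed.

Lemma sine_span2_dense l f : 0 < l.1 -> 0 < l.2 -> L2 l f -> forall e : R, 0 < e ->
  exists2 s, sine_span2 l s & ip l (fun x => f x - s x) (fun x => f x - s x) < e.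
Proof.
move=> l1 l2 Lf; have SL g : sine_span2 l g -> L2 l g.
  by move=> /smooth_sine_span2 sg; apply: L2_continuous; exact: smooth_continuous.
suff Q a b : L2_closure l (sine_span2 l) \1_(`]-oo, a[ `*` `]-oo, b[ : set (R * R)).
  by have [] := L2_closure_L2 SL (@sine_span2_add l) (@sine_span2_scale l) (sine_span20 l) Q Lf.
(* The corner is clamped into the plate, since the cosine compares t with a only for a in [0, L].
   Inside the open plate this does not change the indicator. *)
pose cl (L a : R) := Num.min L (Num.max 0 a).
have cl01 L c : 0 < L -> 0 <= cl L c <= L.
  by move=> L0; rewrite /cl ge_min lexx le_min le_max lexx (ltW L0).
have clE L c t : 0 < t < L -> (t < cl L c) = (t < c).
  by move=> /andP[t0 tL]; rewrite /cl lt_min tL lt_max (ltNge t 0) (ltW t0).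
apply: (@L2_closure_dominated _ l _ SL
  (fun k x => step_approx l.1 (cl l.1 a) k x.1 * step_approx l.2 (cl l.2 b) k x.2) _ (cst 1)).
- move=> k; apply: L2_closure_sub => //.
  by apply: sine_span2_prod; exact: step_approx_span.
- by apply: measurable_indic; apply: measurableX; exact: measurable_itv.
- exact: L2_cst.
- by move=> k x _; rewrite normrM -[leRHS]mulr1 ler_pM// step_approx_bound.
- by move=> x _; rewrite indicE; case: (_ \in _); rewrite ?normr1 ?normr0.
move=> [s t] [/=]; rewrite !in_itv/= => sl tl.
rewrite (_ : \1_(_) _ = (s < cl l.1 a)%R%:R * (t < cl l.2 b)%R%:R).
  by apply: cvgM; apply: step_approx_cvg => //; exact: cl01.
rewrite !clE// indicE -natrM mulnb; congr (_%:R); congr nat_of_bool.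
by apply/idP/andP; rewrite inE /= !in_itv/=.
Qed.

End Sines2.

(** * Test functions and weak derivatives *)

Section TestFunctions.
Context {R : realType}.
Implicit Types (l : R * R) (f g u phi : R * R -> R).

Lemma test_function_notin l phi x : test_function l phi -> ~ open_plate l x -> phi x = 0.
Proof.
move=> [_ sub] Ox; apply/eqP; apply: contra_notT Ox => phix; apply: sub.
exact: subset_closure.
Qed.

(** Off the closed support the function is 0 in a neighbourhood, so its derivative is 0 there too
    and the support does not grow. *)
Lemma test_function_partial l i phi : test_function l phi -> test_function l (partial i phi).
Proof.
move=> [sphi sub]; split; first exact: smooth_partial.
apply: subset_trans sub; rewrite [X in _ `<=` X](closure_id _).1; last exact: closed_closure.
apply: closure_subset => x /= /eqP; apply: contra_notP => xc.
have nx : \forall y \near x, 0 = phi y.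
  have oc : open (~` closure [set x | phi x != 0]).
    by apply: closed_openC; exact: closed_closure.
  have := open_nbhs_nbhs (conj oc xc); apply: filterS => y yc.
  apply/esym/eqP; apply: contra_notT yc => phiy; exact: subset_closure.
have [_ <-] := @near_eq_is_derive _ _ _ (cst 0) phi x (dir i) 0 nx (is_derive_cst _ _ _).
by [].
Qed.

Lemma test_function_iter l i n phi : test_function l phi ->
  test_function l (iter n (partial i) phi).
Proof. by move=> tphi; elim: n => [|n IH]; [exact: tphi|exact: test_function_partial]. Qed.

Lemma flat1_bound (s : R) : 0 <= flat 1 s <= 1.
Proof.
rewrite /flat; case: ifP => s0; last by rewrite lexx ler01.
by rewrite hornerC mul1r expR_ge0 expR_le1 oppr_le0 invr_ge0 ltW.
Qed.

Lemma flat1_cvg (t : R) : 0 < t -> flat 1 (k.+1%:R * t - 1) @[k --> \oo] --> (1 : R).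
Proof.
move=> t0.
have t2 : 0 < t / 2 by lra.
have cvi : (k.+1%:R * t - 1)^-1 @[k --> \oo] --> (0 : R).
  (* As soon as (k + 1) t > 2, one has (k + 1) t - 1 >= (k + 1) t / 2, which gives the comparison
     sequence. *)
  apply: (@squeeze_cvgr _ _ _ _ (cst 0) (fun k => (t / 2)^-1 * k.+1%:R^-1)).
  - exists (Num.truncn (2 / t)).+1 => // k /= kt.
    have kt' : 2 / t < k.+1%:R.
      by apply: lt_le_trans (truncnS_gt _) _; rewrite ler_nat ltnW.
    have h : 2 < k.+1%:R * t by move: kt'; rewrite ltr_pdivrMr.
    have p1 : 0 < t / 2 * k.+1%:R by rewrite mulr_gt0.
    have p2 : 0 < k.+1%:R * t - 1 by lra.
    apply/andP; split; first by rewrite invr_ge0 ltW.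
    by rewrite -invfM lef_pV2 ?posrE//; lra.
  - exact: cvg_cst.
  - by rewrite -(mulr0 (t / 2)^-1); apply: cvgMl_tmp; exact: cvg_harmonic.
have cve : expR (- (k.+1%:R * t - 1)^-1) @[k --> \oo] --> (1 : R).
  have c0 : - (k.+1%:R * t - 1)^-1 @[k --> \oo] --> (0 : R).
    by rewrite -[X in _ --> X]oppr0; exact: cvgN.
  by rewrite -[X in _ --> X]expR0; exact: (cvg_comp _ expR c0 (@continuous_expR R 0)).
apply: cvg_trans cve; apply: near_eq_cvg.
exists (Num.truncn (1 / t)).+1 => // k /= kt.
have kt' : 1 / t < k.+1%:R.
  by apply: lt_le_trans (truncnS_gt _) _; rewrite ler_nat ltnW.
have h : 1 < k.+1%:R * t by move: kt'; rewrite ltr_pdivrMr.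
by rewrite /flat ifT ?hornerC ?mul1r// subr_gt0.
Qed.

(** [flat 1 s] is exp(-1/s) for s > 0. The shift by 1 makes the bump vanish within distance 1 / (k +
    1) of both ends, so that its support is compact in ]0, L[. *)
Definition bump (L : R) (k : nat) (t : R) : R :=
  flat 1 (k.+1%:R * t - 1) * flat 1 (k.+1%:R * (L - t) - 1).

Lemma smooth1_bump L k : smooth1 (bump L k).
Proof.
have h1 := smooth1_affine k.+1%:R (- 1) (smooth1_flat (1 : {poly R})).
have h2 := smooth1_affine (- k.+1%:R) (k.+1%:R * L - 1) (smooth1_flat (1 : {poly R})).
have := smooth1_mul h1 h2.
by congr (smooth1 _); apply/funext => t; rewrite /bump; congr (_ * flat _ _); ring.
Qed.

Lemma bump_bound L k t : 0 <= bump L k t <= 1.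
Proof.
have /andP[a0 a1] := flat1_bound (k.+1%:R * t - 1).
have /andP[b0 b1] := flat1_bound (k.+1%:R * (L - t) - 1).
by rewrite /bump mulr_ge0//= mulr_ile1.
Qed.

Lemma bump_cvg L t : 0 < t < L -> bump L k t @[k --> \oo] --> (1 : R).
Proof.
move=> /andP[t0 tL]; rewrite -[X in _ --> X]mulr1.
by apply: cvgM; apply: flat1_cvg => //; rewrite subr_gt0.
Qed.

Lemma bump_support L k t : bump L k t != 0 -> k.+1%:R^-1 <= t <= L - k.+1%:R^-1.
Proof.
have k0 : 0 < k.+1%:R :> R by [].
apply: contraNT; rewrite negb_and -!ltNge => /orP[h|h]; rewrite /bump.
  rewrite [X in X * _]flat_le0 ?mul0r// subr_le0 mulrC -ler_pdivlMr// div1r.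
  exact: ltW.
rewrite [X in _ * X]flat_le0 ?mulr0// subr_le0 mulrC -ler_pdivlMr// div1r.
by rewrite lerBlDr addrC -lerBlDr ltW.
Qed.

Definition cutoff l k (x : R * R) : R := bump l.1 k x.1 * bump l.2 k x.2.

Lemma smooth_cutoff l k : smooth (cutoff l k).
Proof.
have s1 := smooth_fst (smooth1_bump l.1 k); have s2 := smooth_snd (smooth1_bump l.2 k).
exact: smooth_mul s1 s2.
Qed.

Lemma cutoff_bound l k x : 0 <= cutoff l k x <= 1.
Proof.
have /andP[a0 a1] := bump_bound l.1 k x.1; have /andP[b0 b1] := bump_bound l.2 k x.2.
by rewrite /cutoff mulr_ge0//= mulr_ile1.
Qed.

Lemma cutoff_cvg l x : open_plate l x -> cutoff l k x @[k --> \oo] --> (1 : R).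
Proof.
move=> [/=]; rewrite !in_itv/= => x1 x2; rewrite -[X in _ --> X]mulr1.
by apply: cvgM; exact: bump_cvg.
Qed.

Lemma test_function_cutoff l k f : smooth f -> test_function l (fun x => f x * cutoff l k x).
Proof.
move=> sf; split; first exact: smooth_mul sf (smooth_cutoff l k).
have k0 : 0 < k.+1%:R^-1 :> R by rewrite invr_gt0.
pose e : R := k.+1%:R^-1.
apply: (@subset_trans _ (`[e, l.1 - e] `*` `[e, l.2 - e])); last first.
  by move=> [a b] [/=]; rewrite !in_itv/= => A1 A2; split; rewrite /= in_itv/=;
    move: k0; rewrite -/e; lra.
rewrite [X in _ `<=` X](closure_id _).1; last first.
  apply: compact_closed; first exact: norm_hausdorff.
  by apply: compact_setX; exact: segment_compact.
apply: closure_subset => x /= fx.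
move: fx; rewrite mulf_eq0 negb_or => /andP[_].
rewrite /cutoff mulf_eq0 negb_or => /andP[h1 h2].
by split; rewrite /= in_itv/=; exact: bump_support.
Qed.

Lemma ip_cutoff_cvg l f g : L2 l f -> L2 l g ->
  ip l f (fun x => cutoff l k x * g x) @[k --> \oo] --> ip l f g.
Proof.
move=> Lf Lg; have mf := L2_measurable Lf; have mg := L2_measurable Lg.
have mc k : measurable_fun (plate l) (cutoff l k).
  apply: measurable_funTS; apply: continuous_measurable_fun2.
  exact: smooth_continuous (smooth_cutoff l k).
apply: (@plate_dominated_cvg _ l (fun k x => f x * (cutoff l k x * g x)) (fun x => f x * g x)
  (fun x => `|f x| * `|g x|)).
- by move=> k; apply: measurable_funM => //; apply: measurable_funM.
- exact: measurable_funM.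
- have Ln h : L2 l h -> L2 l (fun x => `|h x|).
    move=> Lh; apply: (L2_le _ Lh) => [|x _]; last by rewrite normr_id.
    apply: (@measurableT_comp _ _ _ _ _ _ (fun y : R => `|y|)); first exact: normr_measurable.
    exact: L2_measurable.
  by apply: L2_mul; exact: Ln.
- move=> k x _; rewrite normrM (normrM (cutoff l k x)) ler_wpM2l// ler_piMl//.
  by have /andP[c0 c1] := cutoff_bound l k x; rewrite ger0_norm.
move=> x Ox; apply: cvgMl_tmp; rewrite -[X in _ --> X]mul1r.
by apply: cvgMr_tmp; exact: cutoff_cvg.
Qed.

Lemma test_function_L2 l phi : test_function l phi -> L2 l phi.
Proof. by move=> [sphi _]; apply: L2_continuous; exact: smooth_continuous. Qed.

(** A sine sum approximates f, and the cutoffs turn it into test functions that converge to it. *)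
Lemma test_function_dense l f : 0 < l.1 -> 0 < l.2 -> L2 l f -> forall e : R, 0 < e ->
  exists2 s, test_function l s & ip l (fun x => f x - s x) (fun x => f x - s x) < e.
Proof.
move=> l1 l2 Lf e e0; have e4 : 0 < e / 4 by lra.
have [s ss fs] := sine_span2_dense l1 l2 Lf e4.
have sms := smooth_sine_span2 ss.
have Ls : L2 l s by apply: L2_continuous; exact: smooth_continuous.
pose t k x := s x * cutoff l k x.
have tt k : test_function l (t k) by exact: test_function_cutoff.
have Lt k := test_function_L2 (tt k).
suff [k sk] : exists k, ip l (fun x => s x - t k x) (fun x => s x - t k x) < e / 4.
  exists (t k); first exact: tt.
  have := ip_triangle (L2_sub Lf Ls) (L2_sub Ls (Lt k)).
  rewrite (_ : (fun x => _ + _) = fun x => f x - t k x); first lra.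
  by apply/funext => x; ring.
(* |s - s chi|^2 <= s^2 - s (chi s), since 0 <= chi <= 1 *)
have le k : ip l (fun x => s x - t k x) (fun x => s x - t k x) <= ip l s s - ip l s (t k).
  rewrite -ipBr// /ip; apply: le_Rintegral; first exact: measurable_plate.
  - by apply: L2_mul; exact: L2_sub.
  - by apply: L2_mul => //; exact: L2_sub.
  move=> x _; rewrite /t; have /andP[c0 c1] := cutoff_bound l k x.
  rewrite (_ : (_ - _) * _ = (s x * s x) * ((1 - cutoff l k x) * (1 - cutoff l k x))); last by ring.
  rewrite (_ : s x * (_ - _) = (s x * s x) * (1 - cutoff l k x)); last by ring.
  by rewrite ler_wpM2l -?expr2 ?sqr_ge0// expr2 ler_piMl//; lra.
have c : ip l s s - ip l s (t k) @[k --> \oo] --> 0.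
  rewrite -(subrr (ip l s s)); apply: cvgB; first exact: cvg_cst.
  have := ip_cutoff_cvg Ls Ls; rewrite (_ : (fun k => _) = (fun k => ip l s (t k)))//.
  by apply/funext => k; apply: eq_ip => x _; rewrite /t; ring.
move/cvgr0Pnorm_lt : c => /(_ _ e4)[n _ /(_ n (leqnn n)) h].
by exists n; apply: le_lt_trans (le n) (le_lt_trans (ler_norm _) h).
Qed.

Lemma test_function_orth l f : 0 < l.1 -> 0 < l.2 -> L2 l f ->
  (forall phi, test_function l phi -> ip l f phi = 0) -> ip l f f = 0.
Proof.
move=> l1 l2 Lf H; apply/eqP; rewrite eq_le ip_ge0 andbT; apply/ler_addgt0Pr => e e0.
rewrite add0r; set a := ip l f f.
have a0 : 0 <= a := ip_ge0 l f.
(* If s is a test function within this squared distance of f, then a = (f, f - s), and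
   Cauchy-Schwarz gives a^2 <= a e^2 / (a + 1) <= e^2. *)
have e1 : 0 < e ^+ 2 / (a + 1) by rewrite divr_gt0 ?exprn_gt0//; lra.
have [s ts fs] := test_function_dense l1 l2 Lf e1; have Ls := test_function_L2 ts.
have := ip_CauchySchwarz Lf (L2_sub Lf Ls).
rewrite ipBr// (H _ ts) subr0 -/a => h.
rewrite -(@ler_pXn2r _ 2) ?nnegrE ?(ltW e0)//.
apply: le_trans h _; apply: (@le_trans _ _ (a * (e ^+ 2 / (a + 1)))).
  by rewrite ler_wpM2l// ltW.
rewrite mulrA ler_pdivrMr; last lra.
by rewrite mulrC ler_wpM2l ?sqr_ge0//; lra.
Qed.

End TestFunctions.

(** * Weak derivatives of smooth functions and uniqueness *)

Section WeakDerivatives.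
Context {R : realType}.
Implicit Types (l : R * R) (f g u phi : R * R -> R).

(** The integral of the derivative of f phi reduces to values on two opposite sides, where a test
    function vanishes. *)
Lemma ip_partial_smooth l i f phi : 0 < l.1 -> 0 < l.2 -> smooth f -> test_function l phi ->
  ip l f (partial i phi) = - ip l (partial i f) phi.
Proof.
move=> l1 l2 sf tphi; have [sphi _] := tphi.
have sf' := smooth_partial i sf; have sphi' := smooth_partial i sphi.
have Lf : L2 l f by apply: L2_continuous; exact: smooth_continuous.
have Lf' : L2 l (partial i f) by apply: L2_continuous; exact: smooth_continuous.
have Lp := test_function_L2 tphi.
have Lp' := test_function_L2 (test_function_partial i tphi).
apply/eqP; rewrite -addr_eq0 /ip -RintegralD;
  [|exact: measurable_plate|exact: L2_mul|exact: L2_mul].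
apply/eqP; refine (etrans (@plate_FTC _ i l (fun x => f x * phi x) _ _ _ _ _) _).
- by case: i {sf' sphi' Lf' Lp'}.
- exact: smooth_continuous (smooth_mul sf sphi).
- apply: smooth_continuous; apply: smooth_add; first exact: smooth_mul sf sphi'.
  exact: smooth_mul sf' sphi.
- move=> x _; have := is_deriveM (smooth_is_derive i x sf) (smooth_is_derive i x sphi).
  by rewrite /GRing.scale/= [phi x * _]mulrC.
have z t a : a = 0 \/ a = coord i l -> phi (with_coord i a t) = 0.
  move=> h; apply: (test_function_notin tphi); rewrite /open_plate /with_coord.
  by case: i {sf' sphi' Lf' Lp'} h => -[->|->] /= -[/=]; rewrite !in_itv/= !ltxx ?andbF.
rewrite -[RHS](mul0r (fine (lebesgue_measure `[0, coord (~~ i) l]))) -Rintegral_cst//.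
by apply: eq_Rintegral => t _; rewrite !z ?mulr0 ?subrr; [|left|right].
Qed.

Lemma ip_iter_partial_smooth l i n f phi : 0 < l.1 -> 0 < l.2 -> smooth f ->
  test_function l phi ->
  ip l f (iter n (partial i) phi) = (-1) ^+ n * ip l (iter n (partial i) f) phi.
Proof.
move=> l1 l2; elim: n f phi => [|n IH] f phi sf tphi; first by rewrite expr0 mul1r.
rewrite [in LHS]iterS (ip_partial_smooth i l1 l2 sf (test_function_iter i n tphi)).
by rewrite (IH _ _ (smooth_partial i sf) tphi) -iterSr exprS mulN1r mulNr.
Qed.

Lemma is_weak_derivative_smooth l i j f : 0 < l.1 -> 0 < l.2 -> smooth f ->
  is_weak_derivative l i j f (iter i (partial false) (iter j (partial true) f)).
Proof.
move=> l1 l2 sf phi tphi; rewrite -/(ip l f _) -/(ip l _ phi).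
rewrite (ip_iter_partial_smooth _ _ l1 l2 sf (test_function_iter true j tphi)).
rewrite (ip_iter_partial_smooth _ _ l1 l2 (smooth_iter false i sf) tphi).
by rewrite mulrA -exprD (partial_iter_comm _ _ _ _ sf).
Qed.

Lemma is_weak_derivative_unique l i j u g h : 0 < l.1 -> 0 < l.2 -> L2 l g -> L2 l h ->
  is_weak_derivative l i j u g -> is_weak_derivative l i j u h ->
  ip l (fun x => g x - h x) (fun x => g x - h x) = 0.
Proof.
move=> l1 l2 Lg Lh wg wh; apply: test_function_orth => //; first exact: L2_sub.
move=> phi tphi; rewrite ipBl//; last exact: test_function_L2.
have := wg _ tphi; rewrite (wh _ tphi) -/(ip l h _) -/(ip l g _).
by move=> /(mulfI _) -> //; rewrite ?subrr// signr_eq0.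
Qed.

Lemma wD_weak l i j u : (exists2 g, L2 l g & is_weak_derivative l i j u g) ->
  is_weak_derivative l i j u (wD l i j u).
Proof.
move=> [g Lg wg]; rewrite /wD; case: xgetP => [y _ []//|/(_ g)].
by case; split.
Qed.

Lemma wD_unique l i j u g : 0 < l.1 -> 0 < l.2 -> L2 l g -> is_weak_derivative l i j u g ->
  ip l (fun x => wD l i j u x - g x) (fun x => wD l i j u x - g x) = 0.
Proof.
move=> l1 l2 Lg wg; apply: (is_weak_derivative_unique l1 l2 (L2_wD _ _ _ _) Lg _ wg).
by apply: wD_weak; exists g.
Qed.

End WeakDerivatives.

(** * Hardy inequality and integration by parts *)

Section BumpDerivative.
Context {R : realType}.

Definition dflat1 (s : R) : R := flat (flat_deriv 1) s.

Lemma dflat1E s : 0 < s -> dflat1 s = s^-1 ^+ 2 * expR (- s^-1).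
Proof.
move=> s0; rewrite /dflat1 /flat s0 /flat_deriv.
by rewrite derivC mulr0 subr0 mulr1 hornerXn.
Qed.

Lemma dflat1_ge0 s : 0 <= dflat1 s.
Proof.
have [s0|s0] := ltP 0 s; last by rewrite /dflat1 flat_le0.
by rewrite dflat1E// mulr_ge0 ?sqr_ge0 ?expR_ge0.
Qed.

(** With u = 1 / s the left side is (u + 2 u^2) e^(-u), and e^u >= 1 + u^2 / 2 is enough for the
    constant 5. The shift by 2 is made for s = K t - 1, where s + 2 = K (t + 1 / K): the derivative
    of the cutoff is then measured against the regularised distance t + 1 / K. *)
Lemma dflat1_bound s : dflat1 s * (s + 2) <= 5.
Proof.
have [s0|s0] := ltP 0 s; last by rewrite /dflat1 flat_le0// mul0r.
rewrite dflat1E//; set u := s^-1; have u0 : 0 < u by rewrite invr_gt0.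
have su : s * u = 1 by rewrite mulfV ?gt_eqF.
have E0 := expR_gt0 u.
rewrite expRN mulrAC ler_pdivrMr//.
rewrite (_ : u ^+ 2 * (s + 2) = u * (s * u) + 2 * u ^+ 2); last by ring.
have h2 := expR_ge1Dxn 1 (ltW u0).
have : 1 + u ^+ 2 / 2 <= expR u by apply: le_trans h2; rewrite lerD2l.
by rewrite su; have := sqr_ge0 (u - 1); lra.
Qed.

Lemma dflat1_scaled_bound (K t : R) : 0 < K -> 0 <= t ->
  K * dflat1 (K * t - 1) <= 5 * (t + K^-1)^-1.
Proof.
move=> K0 t0; have p : 0 < t + K^-1 by rewrite ltr_wpDl// invr_gt0.
rewrite ler_pdivlMr//; apply: le_trans (dflat1_bound (K * t - 1)).
rewrite [leLHS](_ : _ = dflat1 (K * t - 1) * (K * t + K * K^-1)); last by ring.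
by rewrite mulfV ?gt_eqF// ler_wpM2l ?dflat1_ge0//; lra.
Qed.

Lemma dflat1_scaled_cvg (t : R) : 0 < t ->
  k.+1%:R * dflat1 (k.+1%:R * t - 1) @[k --> \oo] --> (0 : R).
Proof.
(* With K = k + 1 and K t > 2, the argument s = K t - 1 is at least K t / 2, and the derivative is
   at most s^(-2); times K this is at most 4 / (t^2 K). *)
move=> t0; apply: (@squeeze_cvgr _ _ _ _ (cst 0) (fun k => 4 / t ^+ 2 * k.+1%:R^-1)).
- exists (Num.truncn (2 / t)).+1 => // k /= kt.
  have kt' : 2 / t < k.+1%:R.
    by apply: lt_le_trans (truncnS_gt _) _; rewrite ler_nat ltnW.
  have K0 : 0 < k.+1%:R :> R by [].
  move: kt' K0; move: (k.+1%:R) => K kt' K0.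
  have h : 2 < K * t by move: kt'; rewrite ltr_pdivrMr.
  have s0 : 0 < K * t - 1 by lra.
  rewrite mulr_ge0 ?dflat1_ge0 ?(ltW K0)//= dflat1E//.
  apply: (@le_trans _ _ (K * (K * t - 1)^-1 ^+ 2)).
    rewrite ler_wpM2l ?(ltW K0)// ler_piMr ?sqr_ge0//.
    by rewrite expR_le1 oppr_le0 invr_ge0 ltW.
  rewrite (_ : 4 / t ^+ 2 * K^-1 = K * ((K * t / 2)^-1 ^+ 2)); last first.
    by field; rewrite !gt_eqF.
  rewrite ler_wpM2l ?(ltW K0)// lerXn2r ?nnegrE ?invr_ge0 ?(ltW s0)//.
    by lra.
  by rewrite lef_pV2 ?posrE//; lra.
- exact: cvg_cst.
- by rewrite -(mulr0 (4 / t ^+ 2)); apply: cvgMl_tmp; exact: cvg_harmonic.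
Qed.

Definition dbump (L : R) (k : nat) (t : R) : R :=
  k.+1%:R * dflat1 (k.+1%:R * t - 1) * flat 1 (k.+1%:R * (L - t) - 1)
  - k.+1%:R * dflat1 (k.+1%:R * (L - t) - 1) * flat 1 (k.+1%:R * t - 1).

Lemma is_derive_bump L k (t : R) : is_derive t (1 : R) (bump L k) (dbump L k t).
Proof.
pose K : R := k.+1%:R.
have aff (a b : R) : is_derive t (1 : R) (fun t : R => a * t + b) a.
  have h1 : is_derive t (1 : R) (a \*: (@id R)) (a *: 1) by exact: is_deriveZ.
  have := is_deriveD h1 (is_derive_cst b t 1).
  by rewrite addr0 /GRing.scale/= mulr1.
have d1 := @is_derive1_comp _ (flat 1) (fun t => K * t + (- 1)) t _ _
  (is_derive_flat 1 _) (aff K (- 1)).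
have d2 := @is_derive1_comp _ (flat 1) (fun t => - K * t + (K * L - 1)) t _ _
  (is_derive_flat 1 _) (aff (- K) (K * L - 1)).
have eL : - K * t + (K * L - 1) = K * (L - t) - 1 by ring.
have := is_deriveM d1 d2; rewrite -/(dflat1 _) -/(dflat1 _) /= /GRing.scale/= eL.
have -> : (flat 1 \o (fun t => K * t + -1)) * (flat 1 \o (fun t => - K * t + (K * L - 1)))
    = bump L k.
  apply/funext => s; rewrite /bump [LHS]/GRing.mul/=; congr (_ * flat _ _).
  by rewrite /K; ring.
congr (is_derive _ _ _ _); rewrite /dbump -/K.
by move: (dflat1 _) (dflat1 _) (flat _ _) (flat _ _) => p q r s; ring.
Qed.

Lemma dbump_bound L k (t : R) : 0 <= t <= L ->
  `|dbump L k t| <= 5 * (t + k.+1%:R^-1)^-1 + 5 * (L - t + k.+1%:R^-1)^-1.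
Proof.
move=> /andP[t0 tL]; have K0 : 0 < k.+1%:R :> R by [].
rewrite /dbump; apply: le_trans (ler_normB _ _) _; apply: lerD.
  rewrite normrM; have /andP[f0 f1] := flat1_bound (k.+1%:R * (L - t) - 1).
  rewrite (ger0_norm f0) ger0_norm; last by rewrite mulr_ge0 ?dflat1_ge0.
  apply: le_trans (dflat1_scaled_bound K0 t0).
  by rewrite ler_piMr// mulr_ge0 ?dflat1_ge0.
rewrite normrM; have /andP[f0 f1] := flat1_bound (k.+1%:R * t - 1).
rewrite (ger0_norm f0) ger0_norm; last by rewrite mulr_ge0 ?dflat1_ge0.
have Lt : 0 <= L - t by rewrite subr_ge0.
apply: le_trans (dflat1_scaled_bound K0 Lt).
by rewrite ler_piMr// mulr_ge0 ?dflat1_ge0.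
Qed.

Lemma dbump_cvg L (t : R) : 0 < t < L -> dbump L k t @[k --> \oo] --> (0 : R).
Proof.
move=> /andP[t0 tL]; have Lt : 0 < L - t by rewrite subr_gt0.
rewrite -[X in _ --> X](subrr 0) -[X in X - _](mul0r 1) -[X in _ - X](mul0r 1).
by apply: cvgB; apply: cvgM; first [exact: dflat1_scaled_cvg|exact: flat1_cvg].
Qed.

End BumpDerivative.

Section Hardy.
Context {R : realType}.
Implicit Types (l : R * R) (f g u phi : R * R -> R).

(** The Hardy weight: the sum of the inverse distances to the two opposite sides, each regularised
    by [d]. The absolute values keep it positive and continuous on the whole line. *)
Definition wall (d L t : R) : R := (`|t| + d)^-1 + (`|L - t| + d)^-1.

Lemma continuous_shift_inv (d c : R) (s : R) : 0 < d ->
  continuous (fun t : R => (`|c + s * t| + d)^-1).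
Proof.
move=> d0 t; apply: cvgV; first by rewrite gt_eqF// ltr_wpDl.
apply: cvgD; last exact: cvg_cst.
apply: cvg_norm; apply: cvgD; first exact: cvg_cst.
by apply: cvgMl_tmp; exact: cvg_id.
Qed.

Lemma continuous_coord i (f : R -> R) : continuous f -> continuous (fun x => f (coord i x)).
Proof.
move=> cf x; apply: (@continuous_comp _ _ _ (coord i) f); last exact: cf.
by case: i; [exact: cvg_snd|exact: cvg_fst].
Qed.

Lemma boundary_slice_le l i phi : smooth phi ->
  \int[lebesgue_measure]_(t in `[0, coord (~~ i) l])
    (phi (with_coord i (coord i l) t) ^+ 2 + phi (with_coord i 0 t) ^+ 2)
  <= boundary_norm_sq l phi.
Proof.
move=> sphi; rewrite /boundary_norm_sq.
have ge0 (L : R) (F G : R -> R) :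
    0 <= \int[lebesgue_measure]_(t in `[0, L]) (F t ^+ 2 + G t ^+ 2).
  by apply: Rintegral_ge0 => t _; rewrite addr_ge0 ?sqr_ge0.
case: i => /=.
  rewrite (_ : Rintegral _ _ _ =
      \int[lebesgue_measure]_(t in `[0, l.1]) (phi (t, 0) ^+ 2 + phi (t, l.2) ^+ 2)).
    by rewrite lerDl ge0.
  by apply: eq_Rintegral => t _; rewrite addrC.
rewrite (_ : Rintegral _ _ _ =
    \int[lebesgue_measure]_(t in `[0, l.2]) (phi (0, t) ^+ 2 + phi (l.1, t) ^+ 2)).
  by rewrite lerDr ge0.
by apply: eq_Rintegral => t _; rewrite addrC.
Qed.

Lemma is_derive_coord i (h : R -> R) x (d : R) : is_derive (coord i x) (1 : R) h d ->
  is_derive x (dir i) (fun x => h (coord i x)) d.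
Proof. by case: i => hd; [apply/is_derive_sndP|apply/is_derive_fstP]. Qed.

Lemma is_derive_wall_diff (d L t : R) : 0 < d -> 0 < t < L ->
  is_derive t (1 : R) (fun t => (`|L - t| + d)^-1 - (`|t| + d)^-1)
    ((`|L - t| + d)^-1 ^+ 2 + (`|t| + d)^-1 ^+ 2).
Proof.
move=> d0 /andP[t0 tL]; have Lt0 : 0 < L - t by rewrite subr_gt0.
rewrite (gtr0_norm t0) (gtr0_norm Lt0).
apply: (@near_eq_is_derive _ _ _ (fun t => (L - t + d)^-1 - (t + d)^-1)).
  near=> s; have s0 : 0 < s by near: s; exact: lt_nbhsr.
  have sL : s < L by near: s; exact: lt_nbhsl.
  by rewrite (gtr0_norm s0) gtr0_norm// subr_gt0.
have h1 : is_derive t (1 : R) (fun t : R => L - t + d) (-1).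
  have := is_deriveD (is_deriveB (is_derive_cst L t 1) (is_derive_id t 1)) (is_derive_cst d t 1).
  by rewrite addr0 sub0r.
have h2 : is_derive t (1 : R) (fun t : R => t + d) 1.
  by have := is_deriveD (is_derive_id t (1 : R)) (is_derive_cst d t 1); rewrite addr0.
have n1 : L - t + d != 0 by rewrite gt_eqF// addr_gt0.
have n2 : t + d != 0 by rewrite gt_eqF// addr_gt0.
have := is_deriveB (@is_deriveV _ (fun t => L - t + d) t _ _ n1 h1)
  (@is_deriveV _ (fun t => t + d) t _ _ n2 h2).
congr (is_derive _ _ _ _); rewrite /GRing.scale/= !exprVn; ring.
Unshelve. all: by end_near. Qed.

(* Hardy's inequality in the variable i, regularised by d: integrate the
   derivative of psi phi^2, where psi = (L - t + d)^-1 - (t + d)^-1 satisfies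
   psi^2 <= psi'. *)
Lemma hardy l i phi (d : R) : (forall j, 0 < coord j l) -> 0 < d -> smooth phi ->
  ip l (fun x => wall d (coord i l) (coord i x) * phi x)
       (fun x => wall d (coord i l) (coord i x) * phi x) <=
  4 / d * boundary_norm_sq l phi + 8 * ip l (partial i phi) (partial i phi).
Proof.
move=> lp d0 sphi; set L := coord i l; pose m x := wall d L (coord i x).
pose a (t : R) := (`|t| + d)^-1; pose b (t : R) := (`|L - t| + d)^-1.
have ca : continuous a.
  have := @continuous_shift_inv d 0 1 d0; rewrite (_ : (fun t => _) = a)//.
  by apply/funext => t; rewrite /a mul1r add0r.
have cb : continuous b.
  have := @continuous_shift_inv d L (-1) d0; rewrite (_ : (fun t => _) = b)//.
  by apply/funext => t; rewrite /b mulN1r.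
have cm (f g : R * R -> R) : continuous f -> continuous g -> continuous (fun x => f x * g x).
  by move=> cf cg x; apply: cvgM; [exact: cf|exact: cg].
have cA (f g : R * R -> R) : continuous f -> continuous g -> continuous (fun x => f x + g x).
  by move=> cf cg x; apply: cvgD; [exact: cf|exact: cg].
have cphi := smooth_continuous sphi.
have cdphi := smooth_continuous (smooth_partial i sphi).
pose psi (t : R) := b t - a t; pose psi' (t : R) := b t ^+ 2 + a t ^+ 2.
have cpsi : continuous psi by move=> t; apply: cvgB; [exact: cb|exact: ca].
have cpsi' : continuous psi'.
  have cX (g : R -> R) : continuous g -> continuous (fun t => g t ^+ 2).
    by move=> cg t; apply: (@continuous_comp _ _ _ g (fun y => y ^+ 2));
      [exact: cg|exact: exprn_continuous].
  by move=> t; apply: cvgD; [exact: cX cb t|exact: cX ca t].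
pose F x := psi (coord i x) * (phi x * phi x).
pose dphi := partial i phi.
pose f x := psi (coord i x) * (phi x * dphi x + phi x * dphi x) + phi x * phi x * psi' (coord i x).
have cF : continuous F by apply: (cm); [exact: continuous_coord|exact: cm].
have cf : continuous f.
  apply: (cA); first by apply: (cm); [exact: continuous_coord|apply: (cA); exact: cm].
  by apply: (cm); [exact: cm|exact: continuous_coord].
have dF x : 0 < coord i x < coord i l -> is_derive x (dir i) F (f x).
  move=> xl; have dp := is_derive_coord (is_derive_wall_diff d0 xl).
  have dphix := smooth_is_derive i x sphi.
  exact: is_deriveM dp (is_deriveM dphix dphix).
have E := plate_FTC (lp i) cF cf dF.
(* On the two sides psi takes the values 1 / d - 1 / (L + d) and its opposite, whence the factor 1 /
   d. *)
have bdry : \int[area]_(x in plate l) f x <= d^-1 * boundary_norm_sq l phi.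
  rewrite E; pose s t := phi (with_coord i (coord i l) t) ^+ 2 + phi (with_coord i 0 t) ^+ 2.
  have cs : continuous s.
    move=> t; rewrite /s /continuous_at; under eq_fun do rewrite !expr2; rewrite !expr2.
    by apply: cvgD; apply: cvgM; exact: continuous_with_coord.
  have d1 : 0 <= d^-1 by rewrite invr_ge0 ltW.
  have integ (g : R -> R) : continuous g ->
      lebesgue_measure.-integrable `[0, coord (~~ i) l] (EFin \o g).
    move=> cg; apply: continuous_compact_integrable; first exact: segment_compact.
    exact: continuous_subspaceT.
  apply: (@le_trans _ _ (\int[lebesgue_measure]_(t in `[0, coord (~~ i) l]) (d^-1 * s t))).
    apply: le_Rintegral => //.
    - apply: integ => t; apply: cvgB; exact: continuous_with_coord.
    - by apply: integ => t; apply: cvgMl_tmp; exact: cs.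
    move=> t _; rewrite /F /s.
    have cc c : coord i (with_coord i c t) = c by rewrite /coord /with_coord; case: (i).
    rewrite !cc -!expr2 mulrDr -mulNr.
    have L0 : 0 < L := lp i.
    have h1 : (L + d)^-1 <= d^-1 by rewrite lef_pV2 ?posrE ?addr_gt0//; lra.
    have h2 : 0 <= (L + d)^-1 by rewrite invr_ge0; lra.
    have e1 : psi L <= d^-1.
      by rewrite /psi /b /a subrr normr0 add0r (gtr0_norm L0); lra.
    have e2 : - psi 0 <= d^-1.
      by rewrite /psi /b /a subr0 normr0 add0r (gtr0_norm L0); lra.
    by apply: lerD; rewrite ler_wpM2r ?sqr_ge0.
  rewrite RintegralZl//; last exact: integ.
  by rewrite ler_wpM2l// boundary_slice_le.
have N1 : ip l (fun x => m x * phi x) (fun x => m x * phi x) <=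
    4 * \int[area]_(x in plate l) f x + 8 * ip l dphi dphi.
  have mP := @measurable_plate _ l.
  have I1 := continuous_integrable l cf; have I2 := continuous_integrable l (cm _ _ cdphi cdphi).
  have cmm : continuous (fun x => m x * phi x).
    apply: (cm) => //; apply: (@continuous_coord i (fun t => wall d (coord i l) t)) => t.
    by apply: cvgD; [exact: ca|exact: cb].
  rewrite -RintegralZl// /ip -RintegralZl// -RintegralD//; last 2 first.
  - apply: (continuous_integrable l (f := fun x => 4 * f x)) => x.
    by apply: cvgMl_tmp; exact: cf.
  - apply: (continuous_integrable l (f := fun x => 8 * (dphi x * dphi x))) => x.
    by apply: cvgMl_tmp; exact: (cm _ _ cdphi cdphi).
  apply: le_Rintegral => //.
  - exact: (continuous_integrable l (cm _ _ cmm cmm)).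
  - apply: (continuous_integrable l (f := fun x => 4 * f x + 8 * (dphi x * dphi x))) => x.
    apply: cvgD; apply: cvgMl_tmp; first exact: cf.
    exact: (cm _ _ cdphi cdphi).
  move=> x _; rewrite /f /m /wall -/(a _) -/(b _) /psi /psi'.
  move: (a _) (b _) (phi x) (dphi x) => A B p q; clear.
  (* Four times the integrand plus 8 q^2 minus ((A + B) p)^2 equals 2 ((B - A) p + 2 q)^2 + ((A + B)
     p)^2; this explains the constants 4 and 8. *)
  have := sqr_ge0 ((B - A) * p + 2 * q); have := sqr_ge0 ((A + B) * p).
  by rewrite -subr_ge0 => h1 h2; rewrite -subr_ge0; lra.
apply: le_trans N1 _; rewrite lerD2r; apply: le_trans (ler_wpM2l _ bdry) _ => //.
by rewrite mulrA.
Qed.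

End Hardy.

(** * Integration by parts against functions with zero trace *)

Section ZeroTrace.
Context {R : realType}.
Implicit Types (l : R * R) (f g u w phi : R * R -> R).

Lemma Rintegral_sqr3 l f g u : L2 l f -> L2 l g -> L2 l u ->
  \int[area]_(x in plate l) (f x ^+ 2 + g x ^+ 2 + u x ^+ 2) =
  ip l f f + ip l g g + ip l u u.
Proof.
move=> Lf Lg Lu; have mP := @measurable_plate _ l.
have If := L2_mul Lf Lf; have Ig := L2_mul Lg Lg; have Iu := L2_mul Lu Lu.
have Ifg : area.-integrable (plate l) (fun x => (f x * f x + g x * g x)%:E).
  exact (@integrableD _ _ _ area _ mP _ _ If Ig).
by rewrite /ip -!RintegralD.
Qed.

Lemma H1_dist_sqE l f w : smooth f -> L2 l w ->
  H1_dist_sq l f w = ip l (fun x => f x - w x) (fun x => f x - w x)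
   + ip l (fun x => partial false f x - wD l 1 0 w x) (fun x => partial false f x - wD l 1 0 w x)
   + ip l (fun x => partial true f x - wD l 0 1 w x) (fun x => partial true f x - wD l 0 1 w x).
Proof.
move=> sf Lw.
have Lc g : smooth g -> L2 l g by move=> sg; apply: L2_continuous; exact: smooth_continuous.
have L0 : L2 l (fun x => f x - w x) := L2_sub (Lc _ sf) Lw.
have L1 : L2 l (fun x => partial false f x - wD l 1 0 w x).
  exact: (L2_sub (Lc _ (smooth_partial false sf)) (L2_wD _ _ _ _)).
have L2' : L2 l (fun x => partial true f x - wD l 0 1 w x).
  exact: (L2_sub (Lc _ (smooth_partial true sf)) (L2_wD _ _ _ _)).
exact: Rintegral_sqr3 L0 L1 L2'.
Qed.

(** The booleans are coerced to numbers: [(~~ i, i)] is the multi-index of one derivative in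
    direction [i], that is (1, 0) or (0, 1). Below, its double is that of the pure second
    derivative. *)
Lemma ip_le_H1_dist_sq l f w : smooth f -> L2 l w ->
  ip l (fun x => f x - w x) (fun x => f x - w x) <= H1_dist_sq l f w /\
  forall i : bool, ip l (fun x => partial i f x - wD l (~~ i) i w x)
                        (fun x => partial i f x - wD l (~~ i) i w x) <= H1_dist_sq l f w.
Proof.
move=> sf Lw; rewrite (H1_dist_sqE sf Lw); split; last case.
- by rewrite -addrA lerDl addr_ge0 ?ip_ge0.
- by rewrite lerDr addr_ge0 ?ip_ge0.
- by rewrite addrAC lerDr addr_ge0 ?ip_ge0.
Qed.

Lemma zero_trace_approx l w (e : R) : zero_trace l w -> 0 < e ->
  exists phi, [/\ smooth phi, boundary_norm_sq l phi <= e,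
    ip l (fun x => phi x - w x) (fun x => phi x - w x) <= e &
    forall i : bool, ip l (fun x => partial i phi x - wD l (~~ i) i w x)
                          (fun x => partial i phi x - wD l (~~ i) i w x) <= e].
Proof.
move=> [[Lw _] [phi [sphi H1 B]]] e0.
move/cvgr0Pnorm_lt : H1 => /(_ _ e0) H1; move/cvgr0Pnorm_lt : B => /(_ _ e0) B.
have [n _ /(_ n (leqnn n)) [h1 h2]] := filterI H1 B.
have [p0 p1] := ip_le_H1_dist_sq (sphi n) Lw.
have h1' := le_trans (ler_norm _) (ltW h1).
exists (phi n); split; [exact: sphi|exact: le_trans (ler_norm _) (ltW h2)| |].
  exact: le_trans p0 h1'.
by move=> i; exact: le_trans (p1 i) h1'.
Qed.

(* Hardy's inequality controls wall * phi, which leaves this bounded factor of the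
   derivative of the cutoff; it tends to 0 pointwise. *)
Definition cutoff_ratio l i k (x : R * R) : R :=
  partial i (cutoff l k) x * (wall k.+1%:R^-1 (coord i l) (coord i x))^-1.

Lemma partial_cutoff l i k : partial i (cutoff l k) =
  if i then (fun x => bump l.1 k x.1 * dbump l.2 k x.2)
  else (fun x => dbump l.1 k x.1 * bump l.2 k x.2).
Proof. by apply: partial_prod; exact: is_derive_bump. Qed.

Lemma partial_cutoff_le l i k x :
  `|partial i (cutoff l k) x| <= `|dbump (coord i l) k (coord i x)|.
Proof.
rewrite partial_cutoff; case: i => /=.
  have /andP[b0 b1] := bump_bound l.1 k x.1.
  by rewrite (normrM (bump l.1 k x.1)) ler_piMl// ger0_norm.
have /andP[b0 b1] := bump_bound l.2 k x.2.
by rewrite (normrM (dbump l.1 k x.1)) ler_piMr// ger0_norm.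
Qed.

Lemma wall_gt0 (d L t : R) : 0 < d -> 0 < wall d L t.
Proof. by move=> d0; rewrite addr_gt0// invr_gt0 ltr_wpDl. Qed.

Lemma plate_coord l i x : plate l x -> 0 <= coord i x <= coord i l.
Proof. by move=> [/=]; rewrite !in_itv/= => h1 h2; case: i. Qed.

Lemma open_plate_coord l i x : open_plate l x -> 0 < coord i x < coord i l.
Proof. by move=> [/=]; rewrite !in_itv/= => h1 h2; case: i. Qed.

Lemma cutoff_ratio_bound l i k x : plate l x -> `|cutoff_ratio l i k x| <= 5.
Proof.
move=> /(plate_coord i) Px; have k0 : 0 < k.+1%:R^-1 :> R by rewrite invr_gt0.
have w0 := wall_gt0 (coord i l) (coord i x) k0.
have wi : 0 <= (wall k.+1%:R^-1 (coord i l) (coord i x))^-1 by rewrite invr_ge0 ltW.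
rewrite /cutoff_ratio normrM (ger0_norm wi) ler_pdivrMr//.
apply: le_trans (partial_cutoff_le l i k x) _; apply: le_trans (dbump_bound k Px) _.
have /andP[p1 p2] := Px.
by rewrite /wall mulrDr (ger0_norm p1) ger0_norm// subr_ge0.
Qed.

Lemma cutoff_ratio_cvg l i x : open_plate l x ->
  cutoff_ratio l i k x @[k --> \oo] --> (0 : R).
Proof.
move=> /(open_plate_coord i) Ox; have /andP[p1 p2] := Ox.
set L := coord i l in Ox p2 *; set t := coord i x in Ox p1 p2 *.
(* The weight is at least 1 / (L + 1) between the sides, so dividing by it costs at most the factor
   L + 1. *)
apply/cvgr0Pnorm_lt => e e0; have eL : 0 < e / (L + 1) by rewrite divr_gt0//; lra.
have := dbump_cvg Ox; move/cvgr0Pnorm_lt => /(_ _ eL); apply: filterS => k h.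
have k0 : 0 < k.+1%:R^-1 :> R by rewrite invr_gt0.
have k1 : k.+1%:R^-1 <= 1 :> R by rewrite invf_le1// ler1n.
have w0 := wall_gt0 L t k0.
have wi : 0 <= (wall k.+1%:R^-1 L t)^-1 by rewrite invr_ge0 ltW.
rewrite /cutoff_ratio normrM (ger0_norm wi) ltr_pdivrMr//.
apply: le_lt_trans (partial_cutoff_le l i k x) _; apply: lt_le_trans h _.
rewrite ler_pM2l// /wall (gtr0_norm p1).
apply: (@le_trans _ _ (t + k.+1%:R^-1)^-1).
  rewrite lef_pV2 ?posrE ?(addr_gt0 p1 k0) ?(addr_gt0 (lt_trans p1 p2) ltr01)//.
  exact: lerD (ltW p2) k1.
by rewrite lerDl invr_ge0 addr_ge0// ltW.
Qed.

Lemma continuous_wall (d L : R) : 0 < d -> continuous (wall d L).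
Proof.
move=> d0 t; apply: cvgD.
  have := @continuous_shift_inv _ d 0 1 d0 t.
  rewrite (_ : (fun t => _) = (fun t => (`|t| + d)^-1))//.
  by apply/funext => s; rewrite mul1r add0r.
have := @continuous_shift_inv _ d L (-1) d0 t.
rewrite (_ : (fun t => _) = (fun t => (`|L - t| + d)^-1))//.
by apply/funext => s; rewrite mulN1r.
Qed.

Lemma continuous_cutoff_ratio l i k : continuous (cutoff_ratio l i k).
Proof.
have k0 : 0 < k.+1%:R^-1 :> R by rewrite invr_gt0.
have cw := @continuous_coord _ i _ (@continuous_wall _ (coord i l) k0).
have cp := smooth_continuous (smooth_partial i (smooth_cutoff l k)).
move=> x; have w0 : wall k.+1%:R^-1 (coord i l) (coord i x) != 0 by rewrite gt_eqF// wall_gt0.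
exact: cvgM (cp x) (cvgV w0 (cw x)).
Qed.

Lemma cutoff_ratio_ip_cvg l i g : L2 l g ->
  ip l (fun x => cutoff_ratio l i k x * g x) (fun x => cutoff_ratio l i k x * g x)
    @[k --> \oo] --> (0 : R).
Proof.
move=> Lg; have mg := L2_measurable Lg.
have mr k : measurable_fun (plate l) (cutoff_ratio l i k).
  apply: measurable_funTS; apply: continuous_measurable_fun2.
  exact: continuous_cutoff_ratio.
have -> : 0 = \int[area]_(x in plate l) (cst 0 x : R).
  by rewrite Rintegral_cst ?mul0r//; exact: measurable_plate.
apply: (@plate_dominated_cvg _ l
  (fun k x => (cutoff_ratio l i k x * g x) * (cutoff_ratio l i k x * g x))
  (cst 0) (fun x => (5 * g x) * (5 * g x))).
- by move=> k; apply: measurable_funM; apply: measurable_funM.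
- exact: measurable_cst.
- by apply: L2_mul; exact: L2_scale.
- move=> k x Px; rewrite -!expr2 !(exprMn _ _ (g x)) ger0_norm; last by rewrite mulr_ge0 ?sqr_ge0.
  rewrite ler_wpM2r ?sqr_ge0// -real_normK ?num_real// lerXn2r ?nnegrE//.
  exact: cutoff_ratio_bound.
move=> x Ox; have c : cutoff_ratio l i k x * g x @[k --> \oo] --> (0 : R).
  by rewrite -(mul0r (g x)); apply: cvgMr_tmp; exact: cutoff_ratio_cvg.
by rewrite /cst -(mulr0 0); exact: cvgM.
Qed.

(** Testing against the approximant phi_k times the cutoff chi_k gives three terms. Two converge to
    the terms of the conclusion. The third, where chi_k is differentiated, is the pairing of
    [cutoff_ratio] times g, which tends to 0 in L^2, with the weight times phi_k, which Hardy's
    inequality keeps bounded. *)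
Lemma zero_trace_ibp l i w g dg : 0 < l.1 -> 0 < l.2 -> zero_trace l w ->
  L2 l g -> L2 l dg ->
  (forall phi, test_function l phi -> ip l g (partial i phi) = - ip l dg phi) ->
  ip l dg w = - ip l g (wD l (~~ i) i w).
Proof.
move=> l1 l2 zw Lg Ldg gdg; have Lw : L2 l w by case: zw => -[].
pose e k : R := k.+1%:R^-1; have e0 k : 0 < e k by rewrite invr_gt0.
have e2 k : 0 < e k * e k by rewrite mulr_gt0.
pose Dw := wD l (~~ i) i w; have LDw : L2 l Dw by exact: L2_wD.
(* The tolerance is the square of e k = 1 / (k + 1), because Hardy's inequality with width e k
   multiplies the boundary term by 4 / e k. *)
have /choice[phi Hphi] k := zero_trace_approx zw (e2 k).
have sphi k : smooth (phi k) by case: (Hphi k).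
have Lc f : smooth f -> L2 l f by move=> sf; apply: L2_continuous; exact: smooth_continuous.
have Lphi k := Lc _ (sphi k).
have Ldphi k := Lc _ (smooth_partial i (sphi k)).
have e1 k : e k <= 1 by rewrite invf_le1// ler1n.
have ee k : e k * e k <= e k by rewrite ler_piMl// ltW.
have ecvg : e k * e k @[k --> \oo] --> 0.
  by rewrite -(mulr0 0); apply: cvgM; exact: cvg_harmonic.
have Lcut k f : L2 l f -> L2 l (fun x => cutoff l k x * f x).
  move=> Lf; apply: (@L2_bmul _ _ 1) => //.
    apply: measurable_funTS; apply: continuous_measurable_fun2.
    exact: smooth_continuous (smooth_cutoff l k).
  by move=> x _; have /andP[c0 c1] := cutoff_bound l k x; rewrite ger0_norm.
have Ncut k f : L2 l f ->
    ip l (fun x => cutoff l k x * f x) (fun x => cutoff l k x * f x) <= ip l f f.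
  move=> Lf; apply: le_Rintegral; first exact: measurable_plate.
  - by apply: L2_mul; exact: Lcut.
  - exact: L2_mul.
  move=> x _; have /andP[c0 c1] := cutoff_bound l k x.
  by rewrite -!expr2 exprMn ler_piMl ?sqr_ge0// exprn_ile1.
(* The product chi F is split as chi (F - f) + chi f: the first part is small since 0 <= chi <= 1,
   the second converges by dominated convergence. *)
have weak f F h : L2 l f -> (forall k, L2 l (F k)) -> L2 l h ->
    (forall k, ip l (fun x => F k x - f x) (fun x => F k x - f x) <= e k * e k) ->
    ip l h (fun x => cutoff l k x * F k x) @[k --> \oo] --> ip l h f.
  move=> Lf LF Lh FF.
  have E k : ip l h (fun x => cutoff l k x * F k x) =
      ip l (fun x => cutoff l k x * (F k x - f x)) h + ip l h (fun x => cutoff l k x * f x).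
    rewrite (ipC l _ h) -ipDr//; last 2 first.
    - by apply: Lcut; exact: L2_sub.
    - exact: Lcut.
    by apply: eq_ip => x _; ring.
  have A : ip l (fun x => cutoff l k x * (F k x - f x)) h @[k --> \oo] --> 0.
    apply: ip_sqr_cvg0 => //; first by move=> k; apply: Lcut; exact: L2_sub.
    apply: (@squeeze_cvgr _ _ _ _ (cst 0) (fun k => e k * e k)) => //; last exact: cvg_cst.
    apply: nearW => k; rewrite ip_ge0/=; apply: le_trans (FF k).
    by apply: Ncut; exact: L2_sub.
  rewrite (_ : (fun k => ip l h (fun x => cutoff l k x * F k x)) = (fun k =>
    ip l (fun x => cutoff l k x * (F k x - f x)) h + ip l h (fun x => cutoff l k x * f x))).
    by rewrite -[ip l h f]add0r; exact: cvgD A (ip_cutoff_cvg Lh Lf).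
  by apply/funext => k; rewrite E.
have c1 := weak w phi dg Lw Lphi Ldg (fun k => let: And4 _ _ H _ := Hphi k in H).
have c2 := weak Dw (fun k => partial i (phi k)) g LDw Ldphi Lg
  (fun k => let: And4 _ _ _ H := Hphi k in H i).
pose r k x := wall (e k) (coord i l) (coord i x) * phi k x.
have Lr k : L2 l (r k).
  have cw := @continuous_coord _ i _ (@continuous_wall _ (coord i l) (e0 k)).
  by apply: L2_continuous => x; apply: (cvgM (cw x) (smooth_continuous (sphi k) (x:=x))).
(* The boundary term contributes 4 e k <= 4; the derivative of phi_k is at squared distance at most
   1 from [Dw], hence 2 + 2 |Dw|^2. *)
have Nr k : ip l (r k) (r k) <= 4 + 8 * (2 + 2 * ip l Dw Dw).
  have lp j : 0 < coord j l by case: j.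
  apply: le_trans (hardy i lp (e0 k) (sphi k)) _; case: (Hphi k) => _ B _ /(_ i) Hd.
  apply: lerD.
    apply: (@le_trans _ _ (4 / e k * (e k * e k))).
      by rewrite ler_wpM2l// divr_ge0// ltW.
    rewrite (_ : 4 / e k * (e k * e k) = 4 * e k); last by field; rewrite gt_eqF.
    by rewrite ler_piMr.
  rewrite ler_wpM2l//.
  have := ip_triangle (L2_sub (Ldphi k) LDw) LDw.
  rewrite (_ : (fun x => _ + _) = partial i (phi k)).
    move=> /le_trans; apply; rewrite lerD2r -[leRHS]mulr1 ler_wpM2l//.
    by have := ee k; have := e1 k; lra.
  by apply/funext => x; rewrite subrK.
have c3 : ip l g (fun x => phi k x * partial i (cutoff l k) x) @[k --> \oo] --> 0.
  have Lrat k : L2 l (fun x => cutoff_ratio l i k x * g x).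
    apply: (@L2_bmul _ _ 5) => //; last by move=> x; exact: cutoff_ratio_bound.
    apply: measurable_funTS; apply: continuous_measurable_fun2.
    exact: continuous_cutoff_ratio.
  have E k : ip l g (fun x => phi k x * partial i (cutoff l k) x) =
      ip l (fun x => cutoff_ratio l i k x * g x) (r k).
    apply: eq_ip => x _; rewrite /cutoff_ratio /r -/(e k).
    have := wall_gt0 (coord i l) (coord i x) (e0 k).
    move: (wall _ _ _) (partial _ _ _) (g x) (phi k x) => W P G p W0.
    by field; rewrite gt_eqF.
  have sq : ip l g (fun x => phi k x * partial i (cutoff l k) x) ^+ 2 @[k --> \oo] --> 0.
    pose C := 4 + 8 * (2 + 2 * ip l Dw Dw).
    apply: (@squeeze_cvgr _ _ _ _ (cst 0) (fun k => ip l (fun x => cutoff_ratio l i k x * g x)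
        (fun x => cutoff_ratio l i k x * g x) * C)).
    - apply: nearW => k; rewrite sqr_ge0 E/=.
      apply: le_trans (ip_CauchySchwarz (Lrat k) (Lr k)) _.
      by rewrite ler_wpM2l ?ip_ge0.
    - exact: cvg_cst.
    - by rewrite -(mul0r C); apply: cvgMr_tmp; exact: cutoff_ratio_ip_cvg.
  apply/cvgr0Pnorm_lt => d d0; have d2 : 0 < d ^+ 2 by rewrite exprn_gt0.
  move/cvgr0Pnorm_lt : sq => /(_ _ d2); apply: filterS => k.
  by rewrite normrX ltr_pXn2r// ?nnegrE// ltW.
have Z k : ip l dg (fun x => cutoff l k x * phi k x)
   + ip l g (fun x => cutoff l k x * partial i (phi k) x)
   + ip l g (fun x => phi k x * partial i (cutoff l k) x) = 0.
  have sc := smooth_cutoff l k.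
  have := gdg _ (test_function_cutoff l k (sphi k)).
  rewrite (partial_mul i (sphi k) sc) ipDr//; last 2 first.
  - exact: (Lc _ (smooth_mul (sphi k) (smooth_partial i sc))).
  - exact: (Lc _ (smooth_mul sc (smooth_partial i (sphi k)))).
  rewrite (_ : ip l dg _ = ip l dg (fun x => cutoff l k x * phi k x)).
    by move=> H; rewrite -addrA [X in _ + X]addrC H subrr.
  by apply: eq_ip => x _; rewrite [phi k x * _]mulrC.
(* The three terms sum to 0 for every k, so the sum of their limits is 0. *)
have c0 : (fun k : nat => 0 : R) @ \oo --> ip l dg w + ip l g Dw + 0.
  rewrite (_ : (fun k : nat => 0 : R) = (fun k => ip l dg (fun x => cutoff l k x * phi k x) +
    ip l g (fun x => cutoff l k x * partial i (phi k) x) +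
    ip l g (fun x => phi k x * partial i (cutoff l k) x))).
    exact: cvgD (cvgD c1 c2) c3.
  by apply/funext => k; rewrite Z.
have E0 : ip l dg w + ip l g Dw + 0 = 0.
  by rewrite -(cvg_lim (@Rhausdorff R) c0) (cvg_lim (@Rhausdorff R) (cvg_cst _)).
by apply/eqP; rewrite -addr_eq0 -[X in X == _]addr0 E0.
Qed.

End ZeroTrace.

(** * Green's formula for the bilaplacian *)

Section Green.
Context {R : realType}.
Implicit Types (l : R * R) (f g u v w z phi : R * R -> R).

Lemma weak_partial l (i : bool) u g phi : is_weak_derivative l (~~ i) i u g ->
  test_function l phi -> ip l u (partial i phi) = - ip l g phi.
Proof. by case: i => wg tphi; rewrite -mulN1r -[X in X * _]expr1; exact: wg. Qed.

Lemma weak_partial2 l (i : bool) u g phi : is_weak_derivative l (~~ i).*2 i.*2 u g ->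
  test_function l phi -> ip l u (partial i (partial i phi)) = ip l g phi.
Proof.
case: i => wg tphi; refine (etrans (wg _ tphi) _);
  by rewrite -/(ip l g phi) sqrrN expr1n mul1r.
Qed.

Lemma weak_add l i j u u' g g' : L2 l u -> L2 l u' -> L2 l g -> L2 l g' ->
  is_weak_derivative l i j u g -> is_weak_derivative l i j u' g' ->
  is_weak_derivative l i j (fun x => u x + u' x) (fun x => g x + g' x).
Proof.
move=> Lu Lu' Lg Lg' wg wg' phi tphi.
have Lp := test_function_L2 tphi.
have Lp' := test_function_L2 (test_function_iter false i (test_function_iter true j tphi)).
refine (etrans (ipDl Lu Lu' Lp') (etrans _ (congr1 _ (esym (ipDl Lg Lg' Lp))))).
by rewrite mulrDr; congr (_ + _); [exact: wg|exact: wg'].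
Qed.

(** Obtained by testing the derivatives of [u] against derivatives of phi; the sign of order (i, j)
    occurs twice and cancels. It is needed because membership in H^4 speaks of derivatives of [u],
    while the bilaplacian differentiates weak derivatives again. *)
Lemma weak_comp l i j a b u g : is_weak_derivative l i j u (wD l i j u) ->
  is_weak_derivative l (i + a) (j + b) u g ->
  is_weak_derivative l a b (wD l i j u) g.
Proof.
move=> w1 w2 phi tphi.
have tphi' := test_function_iter false a (test_function_iter true b tphi).
have e1 : ip l u (iter i (partial false) (iter j (partial true)
      (iter a (partial false) (iter b (partial true) phi)))) =
    (-1) ^+ (i + j) * ip l (wD l i j u) (iter a (partial false) (iter b (partial true) phi)).
  exact: w1 tphi'.
have e2 : ip l u (iter (i + a) (partial false) (iter (j + b) (partial true) phi)) =
    (-1) ^+ (i + a + (j + b)) * ip l g phi by exact: w2 tphi.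
have sphi : smooth phi by case: tphi.
rewrite (partial_iter_comm true false j a (smooth_iter true b sphi)) in e1.
rewrite !iterD e1 in e2.
have s : (-1) ^+ (i + j) * (-1) ^+ (i + j) = 1 :> R by rewrite -expr2 sqrr_sign.
refine (etrans (esym (mul1r _)) _); rewrite -s -mulrA.
refine (etrans (congr1 _ e2) _).
by rewrite mulrA [(i + a + _)%N]addnACA [(-1) ^+ (i + j + _)]exprD [X in X * _]mulrA s mul1r.
Qed.

Lemma sobolev_wD l m u i j : sobolev l m u -> (i + j <= m)%N ->
  is_weak_derivative l i j u (wD l i j u).
Proof. by move=> [_ H] ij; apply: wD_weak; exact: H. Qed.

(** Both sides equal minus the pairing of the first derivatives in direction [i]: one integration by
    parts uses the zero trace of [z], the other that of [v]. *)
Lemma green1 l (i : bool) z v : 0 < l.1 -> 0 < l.2 -> zero_trace l z ->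
  (exists2 g, L2 l g & is_weak_derivative l (~~ i).*2 i.*2 z g) ->
  sobolev0 l 2 v ->
  ip l z (wD l (~~ i).*2 i.*2 v) = ip l (wD l (~~ i).*2 i.*2 z) v.
Proof.
move=> l1 l2 zz z2 [sv zv].
have lei : ((~~ i) + i <= 1)%N by case: i {z2}.
have le2 : ((~~ i).*2 + i.*2 <= 2)%N by case: i {z2 lei}.
have v1 := sobolev_wD sv (leq_trans lei (isT : (1 <= 2)%N)); have v2 := sobolev_wD sv le2.
have z1 := sobolev_wD (proj1 zz) lei; have {}z2 := wD_weak z2.
have s1 : ip l (wD l (~~ i).*2 i.*2 v) z = - ip l (wD l (~~ i) i v) (wD l (~~ i) i z).
  apply: zero_trace_ibp => //; try exact: L2_wD.
  move=> phi tphi; have tp := test_function_partial i tphi.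
  by apply: oppr_inj; rewrite opprK -(weak_partial2 v2 tphi) (weak_partial v1 tp).
have s2 : ip l (wD l (~~ i).*2 i.*2 z) v = - ip l (wD l (~~ i) i z) (wD l (~~ i) i v).
  apply: zero_trace_ibp => //; try exact: L2_wD.
  move=> phi tphi; have tp := test_function_partial i tphi.
  by apply: oppr_inj; rewrite opprK -(weak_partial2 z2 tphi) (weak_partial z1 tp).
exact: etrans (ipC _ _ _) (etrans s1 (esym (etrans s2 (congr1 -%R (ipC _ _ _))))).
Qed.

(** As [wD] is a choice, additivity is obtained from uniqueness, and only after pairing. *)
Lemma wD_add l i j u u' h : 0 < l.1 -> 0 < l.2 -> L2 l u -> L2 l u' -> L2 l h ->
  (exists2 g, L2 l g & is_weak_derivative l i j u g) ->
  (exists2 g, L2 l g & is_weak_derivative l i j u' g) ->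
  ip l (wD l i j (fun x => u x + u' x)) h = ip l (wD l i j u) h + ip l (wD l i j u') h.
Proof.
move=> l1 l2 Lu Lu' Lh /wD_weak wu /wD_weak wu'.
have La := L2_wD l i j u; have Lb := L2_wD l i j u'.
have := wD_unique l1 l2 (L2_add La Lb) (weak_add Lu Lu' La Lb wu wu').
move=> /(ip0_orth (L2_sub (L2_wD l i j _) (L2_add La Lb)) Lh).
rewrite (ipBl (L2_wD _ _ _ _) (L2_add La Lb) Lh) (ipDl La Lb Lh).
by move=> /eqP; rewrite subr_eq0 => /eqP.
Qed.

(** The product of the Laplacians has four terms, each a pure second derivative of [u] times one of
    [v]. In each, the two integrations by parts are in the direction of the derivative on [v], and
    the zero traces are those of [v] and of the second derivative of [u]. *)
Lemma green l u v : 0 < l.1 -> 0 < l.2 -> sobolev l 4 u ->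
  zero_trace l (wD l 2 0 u) -> zero_trace l (wD l 0 2 u) -> sobolev0 l 2 v ->
  ip l (laplacian l v) (laplacian l u) = ip l (laplacian l (laplacian l u)) v.
Proof.
move=> l1 l2 su z1 z2 sv.
have Lv : L2 l v by case: sv => -[].
have ex i j a b : (i + a + (j + b) <= 4)%N ->
    exists2 g, L2 l g & is_weak_derivative l a b (wD l i j u) g.
  move=> le; exists (wD l (i + a) (j + b) u); first exact: L2_wD.
  apply: weak_comp; last exact: (sobolev_wD su le).
  by apply: (sobolev_wD su); apply: leq_trans le; rewrite addnACA leq_addr.
have LD i j w : L2 l (wD l i j w) by exact: L2_wD.
have Llap w : L2 l (laplacian l w) by exact: L2_laplacian.
have g1 := @green1 l false _ _ l1 l2 z1 (ex 2 0 2 0 isT) sv.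
have g2 := @green1 l true _ _ l1 l2 z1 (ex 2 0 0 2 isT) sv.
have g3 := @green1 l false _ _ l1 l2 z2 (ex 0 2 2 0 isT) sv.
have g4 := @green1 l true _ _ l1 l2 z2 (ex 0 2 0 2 isT) sv.
rewrite /= in g1 g2 g3 g4.
have e1 := wD_add l1 l2 (LD 2 0 u) (LD 0 2 u) Lv (ex 2 0 2 0 isT) (ex 0 2 2 0 isT).
have e2 := wD_add l1 l2 (LD 2 0 u) (LD 0 2 u) Lv (ex 2 0 0 2 isT) (ex 0 2 0 2 isT).
have E1 : ip l (wD l 2 0 (laplacian l u)) v =
    ip l (wD l 2 0 u) (wD l 2 0 v) + ip l (wD l 0 2 u) (wD l 2 0 v).
  exact: etrans e1 (congr2 +%R (esym g1) (esym g3)).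
have E2 : ip l (wD l 0 2 (laplacian l u)) v =
    ip l (wD l 2 0 u) (wD l 0 2 v) + ip l (wD l 0 2 u) (wD l 0 2 v).
  exact: etrans e2 (congr2 +%R (esym g2) (esym g4)).
have d w : L2 l w -> ip l (laplacian l v) w = ip l w (wD l 2 0 v) + ip l w (wD l 0 2 v).
  by move=> Lw; refine (etrans (ipC _ _ _) _); exact: ipDr.
have F0 : ip l (laplacian l v) (laplacian l u) =
    ip l (laplacian l v) (wD l 2 0 u) + ip l (laplacian l v) (wD l 0 2 u).
  exact: ipDr.
have E0 : ip l (laplacian l (laplacian l u)) v =
    ip l (wD l 2 0 (laplacian l u)) v + ip l (wD l 0 2 (laplacian l u)) v.
  exact: ipDl.
refine (etrans F0 (etrans (congr2 +%R (d _ (LD _ _ _)) (d _ (LD _ _ _))) _)).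
refine (etrans _ (esym (etrans E0 (congr2 +%R E1 E2)))).
exact: addrACA.
Qed.

End Green.

(** * Dissipativity *)

Section EnergyIdentity.
Context {R : realType}.
Implicit Types (l : R * R) (f g u v w z phi : R * R -> R).

(** Splitting an integral requires integrability of every partial sum. This relation carries
    integrability and value together while an integrand is assembled from products of L^2
    functions. *)
Inductive product_sum l : (R * R -> R) -> R -> Prop :=
| product_sum_term c f g : L2 l f -> L2 l g ->
    product_sum l (fun x => c * (f x * g x)) (c * ip l f g)
| product_sum_add F a G b : product_sum l F a -> product_sum l G b ->
    product_sum l (fun x => F x + G x) (a + b).

Lemma product_sumP l F a : product_sum l F a ->
  area.-integrable (plate l) (EFin \o F) /\ \int[area]_(x in plate l) F x = a.
Proof.
have mP := @measurable_plate _ l.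
elim=> [c f g Lf Lg|{}F {}a G b _ [iF <-] _ [iG <-]].
  have iZ := L2_mul (L2_scale c Lf) Lg.
  split; first by move: iZ; under eq_fun do rewrite -mulrA.
  by rewrite RintegralZl//; exact: L2_mul.
split; last by rewrite RintegralD.
exact (@integrableD _ _ _ area _ mP _ _ iF iG).
Qed.

(** Green's formula removes the bending terms. In V v + W1 v y2 - W2 v y1 the products of the
    velocity with the angular acceleration cancel, so that v no longer occurs in the result. *)
Lemma plate_energy l (a w1 w2 W1 W2 : R) DV DU BL v V y1 y2 :
  L2 l DV -> L2 l DU -> L2 l BL -> L2 l v -> L2 l y1 -> L2 l y2 ->
  ip l DV DU = ip l BL v ->
  (forall x, V x = - a ^+ 2 * BL x + y1 x * W2 - y2 x * W1) ->
  \int[area]_(x in plate l) (a ^+ 2 * DV x * DU x + V x * v x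
     + (w1 * V x + W1 * v x) * y2 x - (w2 * V x + W2 * v x) * y1 x) =
  a ^+ 2 * w2 * ip l y1 BL - a ^+ 2 * w1 * ip l y2 BL
  + (w1 * W2 + w2 * W1) * ip l y1 y2 - w1 * W1 * ip l y2 y2 - w2 * W2 * ip l y1 y1.
Proof.
move=> LDV LDU LBL Lv Ly1 Ly2 E VE.
have T c f g (Lf : L2 l f) (Lg : L2 l g) := product_sum_term c Lf Lg.
have [_] := product_sumP (product_sum_add (product_sum_add (product_sum_add
  (product_sum_add (product_sum_add (product_sum_add
  (T (a ^+ 2) _ _ LDV LDU) (T (- a ^+ 2) _ _ LBL Lv)) (T (a ^+ 2 * w2) _ _ Ly1 LBL))
  (T (- (a ^+ 2 * w1)) _ _ Ly2 LBL)) (T (w1 * W2 + w2 * W1) _ _ Ly1 Ly2))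
  (T (- (w1 * W1)) _ _ Ly2 Ly2)) (T (- (w2 * W2)) _ _ Ly1 Ly1)).
rewrite E => H; refine (etrans _ (etrans H _)); last by ring.
by apply: eq_Rintegral => x _; rewrite VE; ring.
Qed.

(* Jhat is the inverse of [[M1, 0, p], [0, M2, q], [p, q, Z]]. *)
Lemma arrow_inverse (M1 M2 Z p q D b1 b2 b3 W1 W2 W3 : R) :
  D = M1 * M2 * Z - p ^+ 2 * M2 - q ^+ 2 * M1 -> D != 0 ->
  W1 = (M2 * Z - q ^+ 2) / D * b1 + p * q / D * b2 + - (M2 * p / D) * b3 ->
  W2 = p * q / D * b1 + (M1 * Z - p ^+ 2) / D * b2 + - (M1 * q / D) * b3 ->
  W3 = - (M2 * p / D) * b1 + - (M1 * q / D) * b2 + M1 * M2 / D * b3 ->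
  [/\ M1 * W1 + p * W3 = b1, M2 * W2 + q * W3 = b2 & p * W1 + q * W2 + Z * W3 = b3].
Proof. by move=> -> D0 -> -> ->; split; field. Qed.

(** P1 and P2 are the moments of the bilaplacian against [y1] and [y2], and the K's are the second
    moments of the plates; both drop out between the plate and body terms. In the attitude part the
    products of two g's cancel by skew symmetry, and the terms from the added 1 cancel against the
    restoring torques of the feedback. The hypotheses are the Euler equations of the closed loop. *)
Lemma energy_balance (M1 M2 Z p q K11 K12 K22 P1 P2 k a1 a2 a3 w1 w2 w3 W1 W2 W3
    g11 g12 g13 g21 g22 g23 g31 g32 g33 : R) :
  M1 * W1 + p * W3 = - k * w1 + a2 * g23 - a3 * g32 + P2 ->
  M2 * W2 + q * W3 = - k * w2 - a1 * g13 + a3 * g31 - P1 ->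
  p * W1 + q * W2 + Z * W3 = - k * w3 + a1 * g12 - a2 * g21 ->
  w2 * P1 - w1 * P2 - (w1 * W2 + w2 * W1) * K12 - w1 * W1 * K22 - w2 * W2 * K11
  + (((M1 + K22) * W1 + K12 * W2 + p * W3) * w1
     + (K12 * W1 + (M2 + K11) * W2 + q * W3) * w2
     + (p * W1 + q * W2 + Z * W3) * w3)
  + (a1 * (w3 * g12 - w2 * g13) * g11 + a1 * (w1 * g13 - w3 * (g11 + 1)) * g12
       + a1 * (w2 * (g11 + 1) - w1 * g12) * g13
     + (a2 * (w3 * (g22 + 1) - w2 * g23) * g21 + a2 * (w1 * g23 - w3 * g21) * g22
       + a2 * (w2 * g21 - w1 * (g22 + 1)) * g23)
     + (a3 * (w3 * g32 - w2 * (g33 + 1)) * g31 + a3 * (w1 * (g33 + 1) - w3 * g31) * g32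
       + a3 * (w2 * g31 - w1 * g32) * g33))
  = - k * (w1 ^+ 2 + w2 ^+ 2 + w3 ^+ 2).
Proof.
move=> N1 N2 N3.
have -> : - k * (w1 ^+ 2 + w2 ^+ 2 + w3 ^+ 2) = w1 * (- k * w1) + w2 * (- k * w2) + w3 * (- k * w3).
  by ring.
have -> : - k * w1 = M1 * W1 + p * W3 - (a2 * g23 - a3 * g32 + P2) by rewrite N1; ring.
have -> : - k * w2 = M2 * W2 + q * W3 - (- a1 * g13 + a3 * g31 - P1) by rewrite N2; ring.
have -> : - k * w3 = p * W1 + q * W2 + Z * W3 - (a1 * g12 - a2 * g21) by rewrite N3; ring.
by ring.
Qed.

End EnergyIdentity.

Section Dissipative.
Context {R : realType} (p : params R).
Hypothesis l1 : forall n, 0 < (len p n).1.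
Hypothesis l2 : forall n, 0 < (len p n).2.
Implicit Types (n : 'I_2) (i j : 'I_3) (xi : state R).

Lemma sum3E (F : 'I_3 -> R) : \sum_i F i = F c1 + F c2 + F c3.
Proof.
rewrite !big_ord_recl big_ord0 addr0 addrA.
by congr (F _ + F _ + F _); exact: val_inj.
Qed.

Lemma L2_y1 n : L2 (len p n) (y1 p n).
Proof. by apply: L2_add; [exact: L2_fst|exact: L2_cst]. Qed.

Lemma L2_y2 n : L2 (len p n) (y2 p n).
Proof. by apply: L2_add; [exact: L2_snd|exact: L2_cst]. Qed.

Definition isum (f g : 'I_2 -> R * R -> R) : R :=
  \sum_(n < 2) rho p n * ip (len p n) (f n) (g n).

Lemma plate_sqr_cst n (f : R * R -> R) (c : R) : L2 (len p n) f ->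
  \int[area]_(x in Om p n) (f x ^+ 2 + c ^+ 2) =
  ip (len p n) f f + c ^+ 2 * ((len p n).1 * (len p n).2).
Proof.
move=> Lf; have H := product_sumP (product_sum_add (product_sum_term 1 Lf Lf)
  (product_sum_term (c ^+ 2) (L2_cst _ 1) (L2_cst _ 1))).
refine (etrans _ (etrans (proj2 H) _)).
  by apply: eq_Rintegral => x _; rewrite /cst; ring.
rewrite mul1r; congr (_ + _ * _); rewrite /ip /cst.
under eq_Rintegral do rewrite mulr1.
rewrite Rintegral_cst; last exact: measurable_plate.
by rewrite mul1r area_plate// ltW.
Qed.

Let T := \sum_(n < 2) rho p n * d3 p n ^+ 2 * (len p n).1 * (len p n).2.

Lemma J11E : J11 p = isum (y2 p) (y2 p) + T.
Proof.
rewrite /J11 /intp /isum /T -big_split/=; apply: eq_bigr => n _.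
by rewrite plate_sqr_cst; [ring|exact: L2_y2].
Qed.

Lemma J22E : J22 p = isum (y1 p) (y1 p) + T.
Proof.
rewrite /J22 /intp /isum /T -big_split/=; apply: eq_bigr => n _.
by rewrite plate_sqr_cst; [ring|exact: L2_y1].
Qed.

(** The d_3^2 parts of J11 and J22 are absorbed in [Mm]. This exhibits I + J as the matrix inverted
    by [Jhat] plus second moments of the plates, which cancel in the energy balance. *)
Lemma inertia_JmxE (w : 'cV[R]_3) :
  [/\ ((Imx p + Jmx p) *m w) c1 0 =
        (Mm p c1 + isum (y2 p) (y2 p)) * w c1 0 + J12 p * w c2 0 + J13 p * w c3 0,
      ((Imx p + Jmx p) *m w) c2 0 =
        J12 p * w c1 0 + (Mm p c2 + isum (y1 p) (y1 p)) * w c2 0 + J23 p * w c3 0 &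
      ((Imx p + Jmx p) *m w) c3 0 =
        J13 p * w c1 0 + J23 p * w c2 0 + (inertia p c3 + J33 p) * w c3 0].
Proof.
have e1 : inertia p c1 + J11 p = Mm p c1 + isum (y2 p) (y2 p) by rewrite J11E /Mm -/T; ring.
have e2 : inertia p c2 + J22 p = Mm p c2 + isum (y1 p) (y1 p) by rewrite J22E /Mm -/T; ring.
split; rewrite mxE sum3E !mxE /= ?mulr1n ?mulr0n ?add0r.
- by rewrite e1.
- by rewrite e2.
- by [].
Qed.

Lemma intp_y12 (a b : R) (v : 'I_2 -> R * R -> R) : (forall n, L2 (len p n) (v n)) ->
  intp p (fun n x => (a * y1 p n x + b * y2 p n x) * v n x) =
  a * isum (y1 p) v + b * isum (y2 p) v.
Proof.
move=> Lv; rewrite /intp /isum !mulr_sumr -big_split/=; apply: eq_bigr => n _.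
have H := product_sumP (product_sum_add (product_sum_term a (L2_y1 n) (Lv n))
  (product_sum_term b (L2_y2 n) (Lv n))).
rewrite (_ : Rintegral _ _ _ = a * ip (len p n) (y1 p n) (v n) + b * ip (len p n) (y2 p n) (v n)).
  by ring.
refine (etrans _ (proj2 H)).
by apply: eq_Rintegral => x _; ring.
Qed.

Definition bsum (f : 'I_2 -> R * R -> R) xi : R :=
  \sum_(n < 2) rho p n * stiff p n ^+ 2 * ip (len p n) (f n) (bilaplacian p n (su xi n)).

Lemma bsum_y12 (a b : R) xi :
  \sum_(n < 2) rho p n * stiff p n ^+ 2 * \int[area]_(x in Om p n)
    ((a * y2 p n x - b * y1 p n x) * bilaplacian p n (su xi n) x) =
  a * bsum (y2 p) xi - b * bsum (y1 p) xi.
Proof.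
rewrite /bsum !mulr_sumr -sumrB; apply: eq_bigr => n _.
have Lb : L2 (len p n) (bilaplacian p n (su xi n)) by exact: L2_laplacian.
have H := product_sumP (product_sum_add (product_sum_term a (L2_y2 n) Lb)
  (product_sum_term (- b) (L2_y1 n) Lb)).
rewrite (_ : Rintegral _ _ _ = a * ip (len p n) (y2 p n) (bilaplacian p n (su xi n)) +
   - b * ip (len p n) (y1 p n) (bilaplacian p n (su xi n))).
  by ring.
refine (etrans _ (proj2 H)).
by apply: eq_Rintegral => x _; ring.
Qed.

(** The gyroscopic terms and the velocity integrals of [A_om] are opposite to those of the feedback,
    coefficient by coefficient in [Jhat]. What is left is damping, restoring torque and bending
    moments. *)
Lemma opF_somE xi i : (forall n, L2 (len p n) (sv xi n)) ->
  let w j := som xi j 0 in let g := sg xi in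
  som (opF p xi) i 0 =
    Jhat p i c1 * (- gain p * w c1 + alpha p c2 * g c2 c3 - alpha p c3 * g c3 c2
                   + bsum (y2 p) xi)
  + Jhat p i c2 * (- gain p * w c2 - alpha p c1 * g c1 c3 + alpha p c3 * g c3 c1
                   - bsum (y1 p) xi)
  + Jhat p i c3 * (- gain p * w c3 + alpha p c1 * g c1 c2 - alpha p c2 * g c2 c1).
Proof.
move=> Lv w g; rewrite /= mxE [A_om _ _ _ _]mxE [X in _ + X]mxE sum3E.
rewrite bsum_y12 /opG ![(\col__ _) _ _]mxE /= -/(w c1) -/(w c2) -/(w c3).
set S1 := isum (y1 p) (sv xi); set S2 := isum (y2 p) (sv xi).
rewrite (_ : intp p _ = (Jhat p i c3 * w c1 - Jhat p i c1 * w c3) * S1 +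
    (Jhat p i c3 * w c2 - Jhat p i c2 * w c3) * S2); last first.
  rewrite -intp_y12//; rewrite /intp; apply: eq_bigr => n _; congr (_ * _).
  by apply: eq_Rintegral => x _; ring.
rewrite (_ : intp p (fun n x => y1 p n x * sv xi n x) = S1)//.
rewrite (_ : intp p (fun n x => y2 p n x * sv xi n x) = S2)//.
rewrite (_ : intp p _ = w c1 * S1 + w c2 * S2); last first.
  rewrite -intp_y12//; rewrite /intp; apply: eq_bigr => n _; congr (_ * _).
  by apply: eq_Rintegral => x _; ring.
by rewrite -/g; ring.
Qed.

(** A and B couple the plates to the angular acceleration in the same way, so only the total angular
    acceleration of the closed loop appears. *)
Lemma opF_svE xi n x : sv (opF p xi) n x = - stiff p n ^+ 2 * bilaplacian p n (su xi n) x
  + y1 p n x * som (opF p xi) c2 0 - y2 p n x * som (opF p xi) c1 0.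
Proof.
have somE i : som (opF p xi) i 0 = A_om p xi i 0 + \sum_m Jhat p i m * opG p xi m 0.
  by rewrite /= mxE [X in _ + X]mxE.
rewrite !somE /=; move: (A_om p xi c1 0) (A_om p xi c2 0) => A1 A2.
rewrite (_ : \sum_m (_ - _) * _ = (\sum_m Jhat p c2 m * opG p xi m 0) * y1 p n x
  - (\sum_m Jhat p c1 m * opG p xi m 0) * y2 p n x); first by ring.
by rewrite !mulr_suml -sumrB; apply: eq_bigr => m _; ring.
Qed.

Lemma opF_sgE xi : let w j := som xi j 0 in let g := sg xi in
  \sum_i \sum_j alpha p i * sg (opF p xi) i j * sg xi i j =
    (alpha p c1 * (w c3 * g c1 c2 - w c2 * g c1 c3) * g c1 c1
     + alpha p c1 * (w c1 * g c1 c3 - w c3 * (g c1 c1 + 1)) * g c1 c2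
     + alpha p c1 * (w c2 * (g c1 c1 + 1) - w c1 * g c1 c2) * g c1 c3)
  + (alpha p c2 * (w c3 * (g c2 c2 + 1) - w c2 * g c2 c3) * g c2 c1
     + alpha p c2 * (w c1 * g c2 c3 - w c3 * g c2 c1) * g c2 c2
     + alpha p c2 * (w c2 * g c2 c1 - w c1 * (g c2 c2 + 1)) * g c2 c3)
  + (alpha p c3 * (w c3 * g c3 c2 - w c2 * (g c3 c3 + 1)) * g c3 c1
     + alpha p c3 * (w c1 * (g c3 c3 + 1) - w c3 * g c3 c1) * g c3 c2
     + alpha p c3 * (w c2 * g c3 c1 - w c1 * g c3 c2) * g c3 c3).
Proof. by rewrite /= addr0 /A_g !sum3E !mxE. Qed.

Lemma sum_energy (r a X Y K12 K22 K11 : 'I_2 -> R) (w1 w2 W1 W2 : R) :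
  \sum_(n < 2) r n * (a n ^+ 2 * w2 * X n - a n ^+ 2 * w1 * Y n
    + (w1 * W2 + w2 * W1) * K12 n - w1 * W1 * K22 n - w2 * W2 * K11 n) =
  w2 * (\sum_(n < 2) r n * a n ^+ 2 * X n) - w1 * (\sum_(n < 2) r n * a n ^+ 2 * Y n)
  - (w1 * W2 + w2 * W1) * (- \sum_(n < 2) r n * K12 n)
  - w1 * W1 * (\sum_(n < 2) r n * K22 n) - w2 * W2 * (\sum_(n < 2) r n * K11 n).
Proof. by rewrite !big_ord_recl !big_ord0; ring. Qed.

Lemma opF_energy xi : Ddet p != 0 -> dom_F p xi ->
  innerH p (opF p xi) xi = - gain p * (som xi c1 0 ^+ 2 + som xi c2 0 ^+ 2 + som xi c3 0 ^+ 2).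
Proof.
move=> D0 [Hxi Dxi]; have Lv n : L2 (len p n) (sv xi n) by have [] := Hxi n.
have W1 := opF_somE c1 Lv; have W2 := opF_somE c2 Lv; have W3 := opF_somE c3 Lv.
pose w j := som xi j 0; pose W j := som (opF p xi) j 0.
have l1' n : 0 < (len p n).1 by exact: l1.
have E n : \int[area]_(x in Om p n) (stiff p n ^+ 2 * laplacian (len p n) (su (opF p xi) n) x
       * laplacian (len p n) (su xi n) x + sv (opF p xi) n x * sv xi n x
     + (w c1 * sv (opF p xi) n x + W c1 * sv xi n x) * y2 p n x
     - (w c2 * sv (opF p xi) n x + W c2 * sv xi n x) * y1 p n x) =
  stiff p n ^+ 2 * w c2 * ip (len p n) (y1 p n) (bilaplacian p n (su xi n))
  - stiff p n ^+ 2 * w c1 * ip (len p n) (y2 p n) (bilaplacian p n (su xi n))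
  + (w c1 * W c2 + w c2 * W c1) * ip (len p n) (y1 p n) (y2 p n)
  - w c1 * W c1 * ip (len p n) (y2 p n) (y2 p n)
  - w c2 * W c2 * ip (len p n) (y1 p n) (y1 p n).
  apply: plate_energy; try exact: L2_laplacian; [exact: Lv|exact: L2_y1|exact: L2_y2| |].
    have -> : su (opF p xi) n = sv xi n by apply/funext => x; rewrite /= addr0.
    have [[s4 _] s2 z1 z2] := Dxi n.
    exact: green.
  exact: opF_svE.
have EI : intp p (fun n x => stiff p n ^+ 2 * laplacian (len p n) (su (opF p xi) n) x
       * laplacian (len p n) (su xi n) x + sv (opF p xi) n x * sv xi n x
     + (w c1 * sv (opF p xi) n x + W c1 * sv xi n x) * y2 p n x
     - (w c2 * sv (opF p xi) n x + W c2 * sv xi n x) * y1 p n x) =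
  w c2 * bsum (y1 p) xi - w c1 * bsum (y2 p) xi
  - (w c1 * W c2 + w c2 * W c1) * J12 p
  - w c1 * W c1 * isum (y2 p) (y2 p) - w c2 * W c2 * isum (y1 p) (y1 p).
  refine (etrans _ (sum_energy (rho p) (stiff p)
    (fun n => ip (len p n) (y1 p n) (bilaplacian p n (su xi n)))
    (fun n => ip (len p n) (y2 p n) (bilaplacian p n (su xi n)))
    (fun n => ip (len p n) (y1 p n) (y2 p n)) (fun n => ip (len p n) (y2 p n) (y2 p n))
    (fun n => ip (len p n) (y1 p n) (y1 p n)) (w c1) (w c2) (W c1) (W c2))).
  by apply: eq_bigr => n _; congr (_ * _); exact: E.
have [I1 I2 I3] := inertia_JmxE (som (opF p xi)).
rewrite /innerH [intp _ _]EI opF_sgE sum3E I1 I2 I3.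
rewrite -/(w c1) -/(w c2) -/(w c3) -/(W c1) -/(W c2) -/(W c3).
rewrite -/(W c1) -/(w c1) -/(w c2) -/(w c3) in W1.
rewrite -/(W c2) -/(w c1) -/(w c2) -/(w c3) in W2.
rewrite -/(W c3) -/(w c1) -/(w c2) -/(w c3) in W3.
rewrite ![Jhat _ _ _]mxE/= in W1 W2 W3.
(* The brackets multiplied by the entries of [Jhat] are the torques; inverting [Jhat] turns the
   three formulas into the Euler equations. *)
move: W1; set b1 := (X in _ * X + _ + _) => W1.
move: W2; set b2 := (X in _ + _ * X + _) => W2.
move: W3; set b3 := (X in _ + _ * X) => W3.
have [N1 N2 N3] := arrow_inverse erefl D0 W1 W2 W3.
exact: energy_balance N1 N2 N3.
Qed.

End Dissipative.

(** * Density of the domain *)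

Section SmoothSobolev.
Context {R : realType}.
Implicit Types (l : R * R) (f g u v w z phi : R * R -> R).

Lemma L2_smooth l f : smooth f -> L2 l f.
Proof. by move=> sf; apply: L2_continuous; exact: smooth_continuous. Qed.

Lemma sobolev_smooth l m f : 0 < l.1 -> 0 < l.2 -> smooth f -> sobolev l m f.
Proof.
move=> l1 l2 sf; split=> [|i j _]; first exact: L2_smooth.
exists (iter i (partial false) (iter j (partial true) f)).
  exact: (L2_smooth _ (smooth_iter false i (smooth_iter true j sf))).
exact: is_weak_derivative_smooth.
Qed.

Lemma eq_weak l i j f g d : L2 l f -> L2 l g ->
  ip l (fun x => g x - f x) (fun x => g x - f x) = 0 ->
  is_weak_derivative l i j f d -> is_weak_derivative l i j g d.
Proof.
move=> Lf Lg e wf phi tphi.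
have Lp := test_function_L2 (test_function_iter false i (test_function_iter true j tphi)).
have := ip0_orth (L2_sub Lg Lf) Lp e; rewrite (ipBl Lg Lf Lp) => /eqP.
by rewrite subr_eq0 => /eqP E; exact: etrans E (wf _ tphi).
Qed.

Lemma ip_sub_sym l f g :
  ip l (fun x => f x - g x) (fun x => f x - g x) = ip l (fun x => g x - f x) (fun x => g x - f x).
Proof. by apply: eq_ip => x _; ring. Qed.

(** The constant sequence [f] serves as approximation. Allowing [g] to differ from [f] by a null
    function is what makes this applicable to the representative chosen by [wD]. *)
Lemma zero_trace_smooth l f g : 0 < l.1 -> 0 < l.2 -> smooth f ->
  (forall i x, coord i x = 0 \/ coord i x = coord i l -> f x = 0) ->
  L2 l g -> ip l (fun x => g x - f x) (fun x => g x - f x) = 0 -> zero_trace l g.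
Proof.
move=> l1 l2 sf f0 Lg gf; have Lf := L2_smooth l sf.
have wf i j := is_weak_derivative_smooth i j l1 l2 sf.
have wg i j := eq_weak Lf Lg gf (wf i j).
have Ld i j : L2 l (iter i (partial false) (iter j (partial true) f)).
  exact: (L2_smooth _ (smooth_iter false i (smooth_iter true j sf))).
split.
  split=> // i j _; exists (iter i (partial false) (iter j (partial true) f)).
    exact: Ld.
  exact: wg.
exists (fun=> f); split; first by move=> _; exact: sf.
  apply: cvg_near_cst; apply: nearW => _; rewrite (H1_dist_sqE sf Lg).
  have e0 := etrans (ip_sub_sym l f g) gf.
  have e1 := etrans (ip_sub_sym _ _ _) (wD_unique l1 l2 (Ld 1 0) (wg 1 0)).
  have e2 := etrans (ip_sub_sym _ _ _) (wD_unique l1 l2 (Ld 0 1) (wg 0 1)).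
  refine (etrans (congr2 +%R (congr2 +%R e0 e1) e2) _).
  by rewrite !addr0.
apply: cvg_near_cst; apply: nearW => _; rewrite /boundary_norm_sq.
have z (L : R) (F G : R -> R) : (forall t, F t = 0) -> (forall t, G t = 0) ->
    \int[lebesgue_measure]_(t in `[0, L]) (F t ^+ 2 + G t ^+ 2) = 0.
  move=> F0 G0; under eq_Rintegral do rewrite F0 G0 expr0n addr0.
  by rewrite Rintegral_cst ?mul0r.
rewrite (z _ (fun t => f (t, 0)) (fun t => f (t, l.2))); last 2 first.
- by move=> t; apply: (f0 true); left.
- by move=> t; apply: (f0 true); right.
rewrite (z _ (fun t => f (0, t)) (fun t => f (l.1, t))) ?addr0//.
- by move=> t; apply: (f0 false); left.
- by move=> t; apply: (f0 false); right.
Qed.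

Lemma weak_sub l i j u u' g g' : L2 l u -> L2 l u' -> L2 l g -> L2 l g' ->
  is_weak_derivative l i j u g -> is_weak_derivative l i j u' g' ->
  is_weak_derivative l i j (fun x => u x - u' x) (fun x => g x - g' x).
Proof.
move=> Lu Lu' Lg Lg' wg wg' phi tphi.
have Lp := test_function_L2 tphi.
have Lp' := test_function_L2 (test_function_iter false i (test_function_iter true j tphi)).
refine (etrans (ipBl Lu Lu' Lp') (etrans _ (congr1 _ (esym (ipBl Lg Lg' Lp))))).
by rewrite mulrBr; congr (_ - _); [exact: wg|exact: wg'].
Qed.

(** The Laplacian of a difference is not literally the difference of Laplacians. The two functions
    have the same pairing with every L^2 function, and using this in both arguments gives equal
    norms. *)
Lemma laplacian_sub l u U s : 0 < l.1 -> 0 < l.2 -> sobolev l 2 u -> smooth U ->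
  (forall x, partial false (partial false U) x + partial true (partial true U) x = s x) ->
  let D := laplacian l (fun x => u x - U x) in
  ip l D D = ip l (fun x => laplacian l u x - s x) (fun x => laplacian l u x - s x).
Proof.
move=> l1 l2 su sU Us D; have Lu : L2 l u by case: su.
have LU := L2_smooth l sU.
have sU1 := smooth_partial false (smooth_partial false sU).
have sU2 := smooth_partial true (smooth_partial true sU).
have LU1 := L2_smooth l sU1; have LU2 := L2_smooth l sU2.
have Ls : L2 l s by rewrite -(funext Us); exact: L2_add.
have LD := L2_laplacian l (fun x => u x - U x); rewrite -/D in LD.
have Llu := L2_laplacian l u.
have w1 := weak_sub Lu LU (L2_wD l 2 0 u) LU1 (sobolev_wD su (isT : (2 + 0 <= 2)%N))
  (is_weak_derivative_smooth 2 0 l1 l2 sU).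
have w2 := weak_sub Lu LU (L2_wD l 0 2 u) LU2 (sobolev_wD su (isT : (0 + 2 <= 2)%N))
  (is_weak_derivative_smooth 0 2 l1 l2 sU).
have La := L2_sub (L2_wD l 2 0 u) LU1; have Lb := L2_sub (L2_wD l 0 2 u) LU2.
have u1 := wD_unique l1 l2 La w1; have u2 := wD_unique l1 l2 Lb w2.
have key h : L2 l h -> ip l D h = ip l (fun x => laplacian l u x - s x) h.
  move=> Lh.
  have o1 := ip0_orth (L2_sub (L2_wD l 2 0 _) La) Lh u1.
  have o2 := ip0_orth (L2_sub (L2_wD l 0 2 _) Lb) Lh u2.
  rewrite (ipBl (L2_wD _ _ _ _) La Lh) in o1.
  rewrite (ipBl (L2_wD _ _ _ _) Lb Lh) in o2.
  move/eqP: o1; rewrite subr_eq0 => /eqP o1.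
  move/eqP: o2; rewrite subr_eq0 => /eqP o2.
  refine (etrans (ipDl (L2_wD _ _ _ _) (L2_wD _ _ _ _) Lh) _).
  refine (etrans (congr2 +%R o1 o2) (etrans (esym (ipDl La Lb Lh)) _)).
  apply: eq_ip => x _; rewrite -Us /laplacian; congr (_ * _).
  by rewrite addrACA opprD.
by rewrite (key _ LD) ipC (key _ (L2_sub Llu Ls)).
Qed.

Lemma sine_span2_zero_trace l f : 0 < l.1 -> 0 < l.2 -> sine_span2 l f -> zero_trace l f.
Proof.
move=> l1' l2' sf; have smf := smooth_sine_span2 sf.
apply: (zero_trace_smooth l1' l2' smf).
- by move=> i x; apply: sine_span2_boundary sf; rewrite gt_eqF.
- exact: L2_smooth.
rewrite /ip; under eq_Rintegral do rewrite subrr mulr0.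
by rewrite Rintegral_cst ?mul0r//; exact: measurable_plate.
Qed.

Lemma sine_span2_sobolev0 l m f : 0 < l.1 -> 0 < l.2 -> sine_span2 l f -> sobolev0 l m f.
Proof.
move=> l1' l2' sf; split; last exact: sine_span2_zero_trace.
by apply: sobolev_smooth => //; exact: smooth_sine_span2 sf.
Qed.

(** A pure second derivative of a sine sum is again a sine sum, so it vanishes on all four sides. *)
Lemma sine_span2_wD_zero_trace l i f : 0 < l.1 -> 0 < l.2 -> sine_span2 l f ->
  zero_trace l (wD l (~~ i).*2 i.*2 f).
Proof.
move=> l1' l2' sf; have smf := smooth_sine_span2 sf.
have sf2 := sine_span2_partial2 i sf; have smf2 := smooth_sine_span2 sf2.
apply: (zero_trace_smooth l1' l2' smf2).
- by move=> j x; apply: sine_span2_boundary sf2; rewrite gt_eqF.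
- exact: L2_wD.
have := wD_unique l1' l2' (L2_smooth l smf2).
by move=> /(_ (~~ i).*2 i.*2 f); apply; case: i {sf2 smf2};
  exact: (is_weak_derivative_smooth _ _ l1' l2' smf).
Qed.

End SmoothSobolev.

Section Density.
Context {R : realType} (p : params R).
Hypothesis rho_gt0 : forall n, 0 < rho p n.
Hypothesis l1 : forall n, 0 < (len p n).1.
Hypothesis l2 : forall n, 0 < (len p n).2.
Implicit Types (n : 'I_2) (xi : state R).

Lemma dom_F_sine (U V : 'I_2 -> R * R -> R) w g :
  (forall n, sine_span2 (len p n) (U n)) -> (forall n, sine_span2 (len p n) (V n)) ->
  dom_F p (State U V w g).
Proof.
move=> sU sV; split=> n /=.
  split; first exact: sine_span2_sobolev0.
  by apply: L2_smooth; exact: smooth_sine_span2 (sV n).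
split; try exact: sine_span2_sobolev0.
- exact: (@sine_span2_wD_zero_trace _ _ false _ (l1 n) (l2 n) (sU n)).
- exact: (@sine_span2_wD_zero_trace _ _ true _ (l1 n) (l2 n) (sU n)).
Qed.

Lemma dom_F_dense : dense_in_H p (dom_F p).
Proof.
split=> [xi []//|xi Hxi e e0].
pose c n := rho p n * (stiff p n ^+ 2 + 1).
have c0 n : 0 < c n by rewrite mulr_gt0// ltr_wpDl ?sqr_ge0.
(* The squared error will be at most the sum of the [c n] times d; the added 1 makes this strictly
   less than C d = e^2. *)
pose C := \sum_(n < 2) c n + 1.
have C0 : 0 < C by rewrite ltr_wpDl// sumr_ge0// => n _; exact: ltW.
pose d := e ^+ 2 / C; have d0 : 0 < d by rewrite divr_gt0// exprn_gt0.
have Hu n : exists U, sine_span2 (len p n) U /\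
    let D := laplacian (len p n) (fun x => su xi n x - U x) in ip (len p n) D D < d.
  have [[su2 _] _] := Hxi n.
  have [s ss sd] := sine_span2_dense (l1 n) (l2 n) (L2_laplacian (len p n) (su xi n)) d0.
  have [U sU Us] := sine_span2_laplacian_inv (l1 n) (l2 n) ss.
  exists U; split=> //=.
  by rewrite (laplacian_sub (l1 n) (l2 n) su2 (smooth_sine_span2 sU) Us).
have Hv n : exists V, sine_span2 (len p n) V /\
    ip (len p n) (fun x => sv xi n x - V x) (fun x => sv xi n x - V x) < d.
  have [_ Lv] := Hxi n.
  by have [V sV Vd] := sine_span2_dense (l1 n) (l2 n) Lv d0; exists V.
have /choice[U HU] := Hu; have /choice[V HV] := Hv.
(* The finite-dimensional components are kept unchanged, so in the norm of the difference the
   coupling, inertia and attitude terms vanish. *)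
pose eta := State U V (som xi) (sg xi).
exists eta; split.
  by apply: dom_F_sine => n; [case: (HU n)|case: (HV n)].
rewrite /normH -[ltRHS](ger0_norm (ltW e0)) -sqrtr_sqr ltr_sqrt ?exprn_gt0//.
have -> : innerH p (state_sub xi eta) (state_sub xi eta) =
  \sum_(n < 2) rho p n * (stiff p n ^+ 2 *
     ip (len p n) (laplacian (len p n) (fun x => su xi n x - U n x))
        (laplacian (len p n) (fun x => su xi n x - U n x))
   + ip (len p n) (fun x => sv xi n x - V n x) (fun x => sv xi n x - V n x)).
  rewrite /innerH /= !subrr mulmx0.
  rewrite [X in _ + X + _]big1; last by move=> i _; rewrite !mxE mul0r.
  rewrite [X in _ + _ + X]big1; last first.
    by move=> i _; rewrite big1// => j _; rewrite !mxE !mulr0.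
  rewrite !addr0 /intp; apply: eq_bigr => n _; congr (_ * _).
  have LD := L2_laplacian (len p n) (fun x => su xi n x - U n x).
  have LV : L2 (len p n) (fun x => sv xi n x - V n x).
    by apply: L2_sub; [case: (Hxi n)|apply: L2_smooth; case: (HV n) => /smooth_sine_span2].
  have H := product_sumP (product_sum_add
    (product_sum_term (stiff p n ^+ 2) LD LD) (product_sum_term 1 LV LV)).
  refine (etrans _ (etrans (proj2 H) _)); last by rewrite mul1r.
  by apply: eq_Rintegral => x _; rewrite !mxE; ring.
apply: (@le_lt_trans _ _ (\sum_(n < 2) c n * d)).
  apply: ler_sum => n _; rewrite /c -mulrA ler_wpM2l ?(ltW (rho_gt0 n))// mulrDl mul1r.
  have [_ hU] := HU n; have [_ hV] := HV n.
  by apply: lerD; [rewrite ler_wpM2l ?sqr_ge0// ltW|exact: ltW].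
rewrite -mulr_suml (@lt_le_trans _ _ (C * d))//.
  by rewrite ltr_pM2r// ltrDl.
by rewrite /d mulrC divfK// gt_eqF.
Qed.

End Density.

Theorem theorem1 (R : realType) (p : params R)
  (inertia_gt0 : forall i : 'I_3, 0 < inertia p i)
  (rho_gt0 : forall n : 'I_2, 0 < rho p n)
  (stiff_gt0 : forall n : 'I_2, 0 < stiff p n)
  (len1_gt0 : forall n : 'I_2, 0 < (len p n).1)
  (len2_gt0 : forall n : 'I_2, 0 < (len p n).2)
  (gain_gt0 : 0 < gain p)
  (alpha_gt0 : forall i : 'I_3, 0 < alpha p i)
  (D_neq0 : Ddet p != 0) :
  dissipative p (dom_F p) (opF p) /\ dense_in_H p (dom_F p).
Proof.
split; last exact: dom_F_dense.
move=> xi Dxi; rewrite opF_energy// mulNr oppr_le0.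
by rewrite mulr_ge0 ?(ltW gain_gt0)// !addr_ge0 ?sqr_ge0.
Qed.
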